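(* (a) If $(s_n)$ is an almost extremal sequence for $\zeta(s)=1$, then $t_n:=\mathrm{Im}(s_n)$ satisfies $$\lim_{n\to\infty}2^{-it_n}=-1,\qquad \lim_{n\to\infty}p^{-it_n}=1\ \text{ for every odd prime } p.$$ (b) If $(\rho_n)$ is an almost extremal sequence for $\zeta'(s)=0$, then $t_n:=\mathrm{Im}(\rho_n)$ satisfies the same two limit relations.
   Context: $\zeta$ is the Riemann zeta function. Let $\sigma(1)$ be the supremum of all real $\sigma$ such that $\zeta(\sigma+it)=1$ for some real $t$ (it equals the unique solution $\sigma>1$ of $\zeta(\sigma)=\frac{2^\sigma+1}{2^\sigma-1}$). Let $E$ be the unique solution $\sigma>1$ of $\frac{2^{\sigma+1}}{4^\sigma-1}\log 2=-\frac{\zeta'(\sigma)}{\zeta(\sigma)}$. A sequence of complex numbers $(s_n)$ is almost extremal for $\zeta(s)=1$ if $\zeta(s_n)=1$ for all $n$ and $\lim_n\mathrm{Re}(s_n)=\sigma(1)$. A sequence $(\rho_n)$ is almost extremal for $\zeta'(s)=0$ if $\zeta'(\rho_n)=0$ for all $n$ and $\lim_n\mathrm{Re}(\rho_n)=E$. *)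

(* Defs.v *)
From Stdlib Require Import Reals ZArith Znumtheory.
From Coquelicot Require Import Coquelicot.
Open Scope R_scope.

Definition Cexp (z : C) : C := (exp (Re z) * cos (Im z), exp (Re z) * sin (Im z)).

(* [x ^ s] with the principal logarithm; meaningful for [0 < x] only. *)
Definition cpow (x : R) (s : C) : C := Cexp (s * RtoC (ln x)).

(* The Riemann zeta function is characterised as the analytic continuation of
   its Dirichlet series to the complex plane minus 1. This determines [zeta] on
   that domain; the value at the pole 1 is arbitrary, which is why the
   solutions considered below are required to differ from 1. *)
Definition is_riemann_zeta (zeta : C -> C) : Prop :=
  (forall s : C, 1 < Re s ->
     is_series (fun n : nat => cpow (INR (S n)) (- s)) (zeta s)) /\
  (forall s : C, s <> RtoC 1 -> ex_derive zeta s).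

Definition zeta_one (zeta : C -> C) (s : C) : Prop :=
  s <> RtoC 1 /\ zeta s = RtoC 1.

(* [C_derive] is the complex derivative wherever the function is complex
   differentiable, hence everywhere except at 1 for the zeta function. *)
Definition zeta'_zero (zeta : C -> C) (s : C) : Prop :=
  s <> RtoC 1 /\ C_derive zeta s = RtoC 0.

Definition is_sigma1 (zeta : C -> C) (sigma1 : R) : Prop :=
  is_lub (fun sigma : R => exists t : R,
            zeta_one zeta (RtoC sigma + Ci * RtoC t)%C) sigma1.

Definition is_E (zeta : C -> C) (E : R) : Prop :=
  1 < E /\
  RtoC (Rpower 2 (E + 1) / (Rpower 4 E - 1) * ln 2) =
    (- (C_derive zeta (RtoC E) / zeta (RtoC E)))%C.

Definition almost_extremal_one (zeta : C -> C) (sigma1 : R) (s : nat -> C) : Prop :=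
  (forall n : nat, zeta_one zeta (s n)) /\
  is_lim_seq (fun n : nat => Re (s n)) sigma1.

Definition almost_extremal_deriv (zeta : C -> C) (E : R) (rho : nat -> C) : Prop :=
  (forall n : nat, zeta'_zero zeta (rho n)) /\
  is_lim_seq (fun n : nat => Re (rho n)) E.

Definition limit_relations (t : nat -> R) : Prop :=
  filterlim (fun n : nat => cpow 2 (- (Ci * RtoC (t n))))
    eventually (locally (RtoC (-1))) /\
  (forall p : nat, prime (Z.of_nat p) -> p <> 2%nat ->
     filterlim (fun n : nat => cpow (INR p) (- (Ci * RtoC (t n))))
       eventually (locally (RtoC 1))).

(* Main.v *)
(** Nothing beyond the half-plane [Re s > 1] is needed.

    For [zeta s = 1]: multiplying by [1 - 2^(-s)] turns the equation into
    [sum_(n odd, n >= 3) n^(-s) = - 2^(-s)].  Comparing absolute values gives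
    [Re s <= sigma0], where [sum_(n odd, n >= 3) (2/n)^sigma0 = 1], and near equality
    forces every [(n/2)^(-it)] close to -1, i.e. [2^(-it) + n^(-it) -> 0]; taking [n = 3] and
    [n = 9] gives [3^(-it) -> 1], hence all the limits.  That [sigma(1)] is not smaller than
    [sigma0] follows from Bohr's argument: a real [t] with [2^(-it)] close to -1 and [n^(-it)]
    close to 1 for the odd [n <= N] exists because the [2k]-th moment of the Dirichlet
    polynomial [sum_(n <= N) b_n n^(-it)], with [b] completely multiplicative, [b_2 = -1] and
    [b_p = 1], counts coincidences among [N^k] products taking only polynomially many values in
    [k]; near [sigma0 + it] the equation is then solved by a contraction.

    For [zeta' s = 0]: sieving [sum n^(-s)] and [sum (ln n) n^(-s)] simultaneously gives
    [- zeta'/zeta (s) = sum_p ln p / (p^s - 1)].  The equation defining [E] says that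
    [ln 2 / (2^E + 1)], the least possible modulus of the term at 2, equals the sum of the terms
    at the odd primes at the real point [E], their largest possible modulus. *)

(* The two halves are asymmetric. [E] is given by an equation, so the equality case of the
   comparison of moduli is available at once; [sigma1] is only a supremum, and the squeeze works
   only once solutions with real part arbitrarily near sigma0 have been produced. For these,
   Kronecker's theorem would need the independence of the logarithms of the primes and several
   variables; moments need only that [ln] is injective on positive integers, and a bounded primitive
   replaces the integral mean value. A contraction takes the place of Rouché's theorem, so no
   complex integration enters. Infinite Euler products are avoided too: sieving up to [N] gives
   series tending to 1, hence their nonvanishing, and logarithmic series tending to 0, so that sums
   over primes are finite sums plus a small remainder. The limits in both halves come from one
   device: isolate one term, bound all others by their values at the real point [Re s], solve for
   the angle of the isolated term, and squeeze it against its extreme value. For numbers of modulus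
   1 it is enough that the real part tends to 1 or -1. *)
Require Import Defs.
From Stdlib Require Import Reals Lra Lia List ZArith Znumtheory Classical.
From Coquelicot Require Import Coquelicot.
Open Scope R_scope.

(** * Complex exponential *)

Lemma Cmod_sqr (z : C) : Cmod z * Cmod z = Re z * Re z + Im z * Im z.
Proof. generalize (Cmod2_alt z); simpl; lra. Qed.

Lemma C_eq (z w : C) : Re z = Re w -> Im z = Im w -> z = w.
Proof. destruct z, w; simpl; intros; subst; reflexivity. Qed.

Lemma Cmod_minus_sym (z w : C) : Cmod (z - w) = Cmod (w - z).
Proof. rewrite <- Cmod_opp; f_equal; ring. Qed.

Lemma Cmod_minus_le (z w : C) : Cmod (z - w) <= Cmod z + Cmod w.
Proof. unfold Cminus; rewrite <- (Cmod_opp w); apply Cmod_triangle. Qed.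

Lemma Cmod_minus_ge (z w : C) : Cmod z - Cmod w <= Cmod (z - w).
Proof.
  generalize (Cmod_triangle (z - w) w); replace (z - w + w)%C with z by ring; lra.
Qed.

Lemma re_le_mod (z : C) : Re z <= Cmod z.
Proof. apply Rle_trans with (1 := Rle_abs _), re_le_Cmod. Qed.

Lemma re_ge_mod (z : C) : - Cmod z <= Re z.
Proof. generalize (re_le_Cmod z); intros H; apply Rabs_le_between in H; lra. Qed.

Lemma im_le_Cmod (z : C) : Rabs (Im z) <= Cmod z.
Proof.
  apply Rle_trans with (2 := Rmax_Cmod z), Rmax_r.
Qed.

Lemma Cexp_plus (z w : C) : Cexp (z + w) = (Cexp z * Cexp w)%C.
Proof.
  unfold Cexp; apply C_eq; simpl; rewrite exp_plus;
    [rewrite cos_plus | rewrite sin_plus]; unfold Re, Im; ring.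
Qed.

Lemma Cexp_0 : Cexp 0 = RtoC 1.
Proof. apply C_eq; simpl; rewrite exp_0, ?cos_0, ?sin_0; ring. Qed.

Lemma Cmod_Cexp (z : C) : Cmod (Cexp z) = exp (Re z).
Proof.
  apply Rsqr_inj; [apply Cmod_ge_0 | left; apply exp_pos |].
  unfold Rsqr; rewrite Cmod_sqr; simpl.
  generalize (sin2_cos2 (Im z)); unfold Rsqr; intros H.
  replace (exp (Re z) * exp (Re z)) with
    (exp (Re z) * exp (Re z) * (sin (Im z) * sin (Im z) + cos (Im z) * cos (Im z)))
    by (rewrite H; ring).
  unfold Re, Im; ring.
Qed.

Lemma Cexp_R (x : R) : Cexp (RtoC x) = RtoC (exp x).
Proof. apply C_eq; simpl; rewrite ?cos_0, ?sin_0; ring. Qed.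

(* Projecting the increment on its own direction reduces to the real mean value theorem. *)
Lemma curve_mean_value (g1 g2 d1 d2 : R -> R) (M : R) :
  (forall x, 0 <= x <= 1 -> is_derive g1 x (d1 x)) ->
  (forall x, 0 <= x <= 1 -> is_derive g2 x (d2 x)) ->
  (forall x, 0 <= x <= 1 -> Cmod (d1 x, d2 x) <= M) ->
  Cmod (g1 1 - g1 0, g2 1 - g2 0) <= M.
Proof.
  intros H1 H2 HM.
  set (w := (g1 1 - g1 0, g2 1 - g2 0)).
  set (a := Re w); set (b := Im w).
  destruct (MVT_gen (fun x => a * g1 x + b * g2 x) 0 1
              (fun x => a * d1 x + b * d2 x)) as [c [Hc Hc']].
  - rewrite Rmin_left, Rmax_right by lra; intros x Hx.
    apply (is_derive_plus (fun x => a * g1 x) (fun x => b * g2 x));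
      apply is_derive_scal; [apply H1 | apply H2]; lra.
  - rewrite Rmin_left, Rmax_right by lra; intros x Hx.
    apply continuity_pt_filterlim.
    apply (ex_derive_continuous (fun x => a * g1 x + b * g2 x)).
    exists (a * d1 x + b * d2 x).
    apply (is_derive_plus (fun x => a * g1 x) (fun x => b * g2 x));
      apply is_derive_scal; [apply H1 | apply H2]; lra.
  - rewrite Rmin_left, Rmax_right in Hc by lra.
    specialize (HM c Hc).
    assert (Hw : Cmod w * Cmod w = a * d1 c + b * d2 c).
    { rewrite Cmod_sqr. fold a b. 
      transitivity (a * (g1 1 - g1 0) + b * (g2 1 - g2 0)); [reflexivity | lra]. }
    assert (Hp : a * d1 c + b * d2 c <= Cmod w * Cmod (d1 c, d2 c)).
    { rewrite <- (Cmod_conj (d1 c, d2 c)), <- Cmod_mult.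
      replace (a * d1 c + b * d2 c) with (Re (w * Cconj (d1 c, d2 c))).
      - apply re_le_mod.
      - rewrite re_mult; unfold a, b; simpl; ring. }
    assert (H0 := Cmod_ge_0 w).
    destruct (Req_dec (Cmod w) 0) as [E0 | E0].
    + rewrite E0. apply Rle_trans with (2 := HM), Cmod_ge_0.
    + apply Rmult_le_reg_l with (Cmod w); [lra|].
      apply Rle_trans with (Cmod w * Cmod (d1 c, d2 c)); [lra|].
      apply Rmult_le_compat_l; lra.
Qed.

(** The path [Cexp (x * z)], [0 <= x <= 1], has speed |z| e^(x Re z). The maximum with 0 covers both
    signs of [Re z]. *)
Lemma Cexp_minus_1_le (z : C) : Cmod (Cexp z - 1) <= Cmod z * exp (Rmax 0 (Re z)).
Proof.
  set (a := Re z); set (b := Im z).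
  assert (H := curve_mean_value
    (fun x => exp (x * a) * cos (x * b)) (fun x => exp (x * a) * sin (x * b))
    (fun x => Re (z * Cexp (x * z))%C) (fun x => Im (z * Cexp (x * z))%C)
    (Cmod z * exp (Rmax 0 a))).
  replace (Cexp z - 1)%C with
    (exp (1 * a) * cos (1 * b) - exp (0 * a) * cos (0 * b),
     exp (1 * a) * sin (1 * b) - exp (0 * a) * sin (0 * b)).
  - apply H.
    + intros x _. auto_derive; [trivial|]. unfold Cexp; simpl. unfold a, b, Re, Im.
      replace (x * fst z - 0 * snd z) with (x * fst z) by ring.
      replace (x * snd z + 0 * fst z) with (x * snd z) by ring. ring.
    + intros x _. auto_derive; [trivial|]. unfold Cexp; simpl. unfold a, b, Re, Im.
      replace (x * fst z - 0 * snd z) with (x * fst z) by ring.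
      replace (x * snd z + 0 * fst z) with (x * snd z) by ring. ring.
    + intros x Hx.
      replace (Re (z * Cexp (x * z)), Im (z * Cexp (x * z)))%C
        with (z * Cexp (x * z))%C by (apply C_eq; reflexivity).
      rewrite Cmod_mult, Cmod_Cexp, re_scal_l. fold a.
      apply Rmult_le_compat_l; [apply Cmod_ge_0|].
      assert (x * a <= Rmax 0 a).
      { unfold Rmax; destruct (Rle_dec 0 a); nra. }
      destruct H0 as [H0|H0]; [left; now apply exp_increasing | rewrite H0; lra].
  - apply C_eq; simpl; unfold a, b, Re, Im;
      rewrite !Rmult_1_l, !Rmult_0_l, exp_0, ?cos_0, ?sin_0; ring.
Qed.

Lemma Rexp_le (x y : R) : x <= y -> exp x <= exp y.
Proof. intros [H | ->]; [left; now apply exp_increasing | lra]. Qed.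

Lemma Cexp_lipschitz (z w : C) :
  Cmod (Cexp z - Cexp w) <= Cmod (z - w) * exp (Rmax (Re z) (Re w)).
Proof.
  replace (Cexp z - Cexp w)%C with (Cexp w * (Cexp (z - w) - 1))%C.
  - rewrite Cmod_mult, Cmod_Cexp.
    apply Rle_trans with (exp (Re w) * (Cmod (z - w) * exp (Rmax 0 (Re (z - w))))).
    + apply Rmult_le_compat_l; [left; apply exp_pos | apply Cexp_minus_1_le].
    + right. rewrite (Rmult_comm (exp (Re w))), Rmult_assoc, <- exp_plus.
      do 2 f_equal.
      replace (Re (z - w)) with (Re z - Re w) by (unfold Re; simpl; ring).
      unfold Rmax; destruct (Rle_dec 0 (Re z - Re w)), (Rle_dec (Re z) (Re w)); lra.
  - replace (Cexp z) with (Cexp (w + (z - w))) by (f_equal; ring).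
    rewrite Cexp_plus; ring.
Qed.

Lemma Cexp_minus_1_le_mod (z : C) : Cmod (Cexp z - 1) <= Cmod z * exp (Cmod z).
Proof.
  apply Rle_trans with (1 := Cexp_minus_1_le z).
  apply Rmult_le_compat_l; [apply Cmod_ge_0|].
  apply Rexp_le, Rmax_lub; [apply Cmod_ge_0 | apply re_le_mod].
Qed.

(** Along the segment from 0 to [z] the derivative of the remainder is [z * (Cexp (x * z) - 1)],
    which the first-order bound controls. *)
Lemma Cexp_taylor_1 (z : C) :
  Cmod (Cexp z - 1 - z) <= Cmod z * Cmod z * exp (Cmod z).
Proof.
  set (a := Re z); set (b := Im z).
  assert (H := curve_mean_value
    (fun x => exp (x * a) * cos (x * b) - x * a)
    (fun x => exp (x * a) * sin (x * b) - x * b)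
    (fun x => Re (z * (Cexp (x * z) - 1))%C) (fun x => Im (z * (Cexp (x * z) - 1))%C)
    (Cmod z * Cmod z * exp (Cmod z))).
  replace (Cexp z - 1 - z)%C with
    (exp (1 * a) * cos (1 * b) - 1 * a - (exp (0 * a) * cos (0 * b) - 0 * a),
     exp (1 * a) * sin (1 * b) - 1 * b - (exp (0 * a) * sin (0 * b) - 0 * b)).
  - apply H.
    + intros x _. auto_derive; [trivial|]. unfold Cexp; simpl. unfold a, b, Re, Im.
      replace (x * fst z - 0 * snd z) with (x * fst z) by ring.
      replace (x * snd z + 0 * fst z) with (x * snd z) by ring. ring.
    + intros x _. auto_derive; [trivial|]. unfold Cexp; simpl. unfold a, b, Re, Im.
      replace (x * fst z - 0 * snd z) with (x * fst z) by ring.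
      replace (x * snd z + 0 * fst z) with (x * snd z) by ring. ring.
    + intros x Hx.
      replace (Re (z * (Cexp (x * z) - 1)), Im (z * (Cexp (x * z) - 1)))%C
        with (z * (Cexp (x * z) - 1))%C by (apply C_eq; reflexivity).
      rewrite Cmod_mult, Rmult_assoc.
      apply Rmult_le_compat_l; [apply Cmod_ge_0|].
      apply Rle_trans with (1 := Cexp_minus_1_le_mod _).
      rewrite Cmod_mult, Cmod_R, Rabs_pos_eq by lra.
      assert (H0 := Cmod_ge_0 z).
      apply Rmult_le_compat; [nra | left; apply exp_pos | nra | apply Rexp_le; nra].
  - apply C_eq; simpl; unfold a, b, Re, Im;
      rewrite !Rmult_1_l, !Rmult_0_l, exp_0, ?cos_0, ?sin_0; ring.
Qed.

(** * Absolutely convergent complex series *)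

Definition summable (f : nat -> C) : Prop := ex_series (fun n => Cmod (f n)).

(** Two real series give a total function, so identities can be rewritten before convergence is
    discussed; under [summable] the value is the actual sum. *)
Definition Csum (f : nat -> C) : C :=
  (Series (fun n => Re (f n)), Series (fun n => Im (f n))).

Lemma ex_series_dom (a b : nat -> R) :
  (forall n, Rabs (a n) <= b n) -> ex_series b -> ex_series a.
Proof. intros H; apply (@ex_series_le R_AbsRing R_CompleteNormedModule), H. Qed.

Lemma summable_dom (f : nat -> C) (b : nat -> R) :
  (forall n, Cmod (f n) <= b n) -> ex_series b -> summable f.
Proof.
  intros H; apply ex_series_dom; intros n.
  rewrite Rabs_pos_eq by apply Cmod_ge_0; apply H.
Qed.

Lemma summable_re (f : nat -> C) : summable f -> ex_series (fun n => Re (f n)).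
Proof. apply ex_series_dom; intros n; apply re_le_Cmod. Qed.

Lemma summable_im (f : nat -> C) : summable f -> ex_series (fun n => Im (f n)).
Proof. apply ex_series_dom; intros n; apply im_le_Cmod. Qed.

Lemma summable_scal (c : C) (f : nat -> C) :
  summable f -> summable (fun n => c * f n)%C.
Proof.
  intros Hf; apply summable_dom with (fun n => Cmod c * Cmod (f n)).
  - intros n; rewrite Cmod_mult; lra.
  - now apply (ex_series_scal_l (Cmod c) (fun n => Cmod (f n))).
Qed.

Lemma Csum_ext (f g : nat -> C) : (forall n, f n = g n) -> Csum f = Csum g.
Proof. intros H; apply C_eq; simpl; apply Series_ext; intros n; now rewrite H. Qed.

Lemma Csum_plus (f g : nat -> C) : summable f -> summable g ->
  Csum (fun n => f n + g n)%C = (Csum f + Csum g)%C.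
Proof.
  intros Hf Hg; apply C_eq; simpl; rewrite <- Series_plus;
    auto using summable_re, summable_im.
Qed.

Lemma Csum_scal (c : C) (f : nat -> C) : summable f ->
  Csum (fun n => c * f n)%C = (c * Csum f)%C.
Proof.
  intros Hf; assert (H1 := summable_re f Hf); assert (H2 := summable_im f Hf).
  apply C_eq; simpl; rewrite <- !Series_scal_l.
  - rewrite <- Series_minus; [reflexivity | |];
      now apply (ex_series_scal_l (K := R_AbsRing) (V := R_NormedModule)).
  - rewrite <- Series_plus; [reflexivity | |];
      now apply (ex_series_scal_l (K := R_AbsRing) (V := R_NormedModule)).
Qed.

Lemma Csum_minus (f g : nat -> C) : summable f -> summable g ->
  Csum (fun n => f n - g n)%C = (Csum f - Csum g)%C.
Proof.
  intros Hf Hg; apply C_eq; simpl.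
  - apply (Series_minus (fun n => Re (f n)) (fun n => Re (g n)));
      auto using summable_re.
  - apply (Series_minus (fun n => Im (f n)) (fun n => Im (g n)));
      auto using summable_im.
Qed.

(** Multiplying by the conjugate of the sum [w] reduces the triangle inequality to real series:
    |w|^2 is the sum of the real parts of [Cconj w * f n], each at most |w| [b n]. *)
Lemma Cmod_Csum_le (f : nat -> C) (b : nat -> R) :
  (forall n, Cmod (f n) <= b n) -> ex_series b -> Cmod (Csum f) <= Series b.
Proof.
  intros Hfb Hb; assert (Hf := summable_dom _ _ Hfb Hb).
  set (w := Csum f).
  assert (Hw : Cmod w * Cmod w <= Cmod w * Series b).
  { assert (Hc : (Cconj w * w)%C = Csum (fun n => Cconj w * f n)%C)
      by (symmetry; now apply Csum_scal).
    replace (Cmod w * Cmod w) with (Re (Cconj w * w))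
      by (rewrite Cmod_sqr, re_mult, re_conj, im_conj; ring).
    rewrite Hc; simpl Re; rewrite <- Series_scal_l.
    assert (Hle : forall n, Rabs (Re (Cconj w * f n)) <= Cmod w * b n).
    { intros n; apply Rle_trans with (1 := re_le_Cmod _).
      rewrite Cmod_mult, Cmod_conj.
      apply Rmult_le_compat_l; [apply Cmod_ge_0 | apply Hfb]. }
    assert (Hex : ex_series (fun n => Cmod w * b n))
      by now apply (ex_series_scal_l (Cmod w) b).
    apply Rle_trans with (Series (fun n => Rabs (Re (Cconj w * f n)))).
    - apply Rle_trans with (1 := Rle_abs _), Series_Rabs.
      apply ex_series_dom with (2 := Hex); intros n; rewrite Rabs_Rabsolu; apply Hle.
    - apply Series_le; [intros n; split; [apply Rabs_pos | apply Hle] | exact Hex]. }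
  assert (H0 := Cmod_ge_0 w).
  destruct (Req_dec (Cmod w) 0) as [E | E].
  (* The zero series is written with terms [0 * 0] so that [Series_scal_l] evaluates it. *)
  - rewrite E; replace 0 with (Series (fun _ : nat => 0 * 0)) by (rewrite Series_scal_l; ring).
    apply Series_le; [intros n; rewrite Rmult_0_l; split; [lra|] | exact Hb].
    apply Rle_trans with (2 := Hfb n), Cmod_ge_0.
  - apply Rmult_le_reg_l with (Cmod w); lra.
Qed.

Lemma re_sum_n (f : nat -> C) (n : nat) :
  Re (@sum_n C_AbelianMonoid f n) = sum_n (fun k => Re (f k)) n.
Proof.
  induction n as [|n IH]; [now rewrite !sum_O|].
  rewrite !sum_Sn, <- IH; reflexivity.
Qed.

Lemma im_sum_n (f : nat -> C) (n : nat) :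
  Im (@sum_n C_AbelianMonoid f n) = sum_n (fun k => Im (f k)) n.
Proof.
  induction n as [|n IH]; [now rewrite !sum_O|].
  rewrite !sum_Sn, <- IH; reflexivity.
Qed.

(** Balls in [C] are products of intervals, so convergence of the partial sums is convergence of
    both components; absolute convergence is not involved. *)
Lemma is_series_Csum_eq (f : nat -> C) (l : C) :
  @is_series C_AbsRing C_NormedModule f l -> Csum f = l.
Proof.
  intros H; apply C_eq; apply is_series_unique;
    unfold is_series in *; apply filterlim_locally; intros eps;
    assert (H' := proj1 (filterlim_locally _ _) H eps);
    apply filter_imp with (2 := H'); intros n [H1 H2].
  - rewrite <- re_sum_n; exact H1.
  - rewrite <- im_sum_n; exact H2.
Qed.

(** * Multiples and tails *)

Definition divides (p n : nat) : bool := Nat.eqb (n mod p) 0.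

Lemma divides_spec (p n : nat) : p <> 0%nat -> divides p n = true <-> Nat.divide p n.
Proof.
  intros Hp; unfold divides; rewrite Nat.eqb_eq; apply Nat.Lcm0.mod_divide.
Qed.

(** The upper limit closes a block of [p] consecutive indices, and only the first index of each
    block is a multiple of [p]. *)
Lemma sum_n_multiples (a : nat -> R) (p M : nat) : p <> 0%nat ->
  sum_n (fun n => if divides p n then a n else 0) (p * M + (p - 1))
  = sum_n (fun m => a (p * m)%nat) M.
Proof.
  intros Hp.
  assert (Hblock : forall M j, (j < p)%nat ->
    sum_n (fun n => if divides p n then a n else 0) (p * M + j)
    = sum_n (fun n => if divides p n then a n else 0) (p * M)).
  { intros K j; induction j as [|j IH]; intros Hj.
    - now rewrite Nat.add_0_r.
    - rewrite Nat.add_succ_r, sum_Sn, IH by lia.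
      replace (divides p (S (p * K + j))) with false; [apply Rplus_0_r|].
      symmetry; unfold divides; apply Nat.eqb_neq.
      replace (S (p * K + j)) with (S j + K * p)%nat by lia.
      rewrite Nat.Div0.mod_add, Nat.mod_small by lia; lia. }
  rewrite Hblock by lia.
  induction M as [|M IH].
  - rewrite Nat.mul_0_r, !sum_O.
    replace (divides p 0) with true; [now rewrite Nat.mul_0_r|].
    symmetry; now apply divides_spec; [|exists 0%nat].
  - replace (p * S M)%nat with (S (p * M + (p - 1))) at 1 by lia.
    rewrite sum_Sn, sum_Sn, Hblock, IH by lia.
    replace (S (p * M + (p - 1))) with (p * S M)%nat by lia.
    replace (divides p (p * S M)) with true; [reflexivity|].
    symmetry; apply divides_spec; [exact Hp | exists (S M); lia].
Qed.

Lemma Series_multiples (a : nat -> R) (p : nat) : p <> 0%nat ->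
  ex_series (fun n => Rabs (a n)) ->
  Series (fun n => if divides p n then a n else 0) = Series (fun m => a (p * m)%nat).
Proof.
  intros Hp Ha; symmetry; apply is_series_unique.
  assert (Hex : ex_series (fun n => if divides p n then a n else 0)).
  { apply ex_series_dom with (2 := Ha); intros n.
    destruct (divides p n); [lra | rewrite Rabs_R0; apply Rabs_pos]. }
  apply Series_correct in Hex.
  change (is_lim_seq (sum_n (fun n => if divides p n then a n else 0))
    (Series (fun n => if divides p n then a n else 0))) in Hex.
  assert (H := is_lim_seq_subseq _ _ (fun M => p * M + (p - 1))%nat
    ltac:(apply eventually_subseq; intros n; nia) Hex).
  apply (is_lim_seq_ext _ (sum_n (fun m => a (p * m)%nat))) with (2 := H).
  intros M; now apply sum_n_multiples.
Qed.

Lemma Csum_multiples (f : nat -> C) (p : nat) : p <> 0%nat -> summable f ->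
  Csum (fun n => if divides p n then f n else 0) = Csum (fun m => f (p * m)%nat).
Proof.
  intros Hp Hf; apply C_eq; simpl.
  - rewrite <- (Series_multiples (fun n => Re (f n))); [|exact Hp|].
    + apply Series_ext; intros n; destruct (divides p n); reflexivity.
    + apply ex_series_dom with (2 := Hf); intros n; rewrite Rabs_Rabsolu; apply re_le_Cmod.
  - rewrite <- (Series_multiples (fun n => Im (f n))); [|exact Hp|].
    + apply Series_ext; intros n; destruct (divides p n); reflexivity.
    + apply ex_series_dom with (2 := Hf); intros n; rewrite Rabs_Rabsolu; apply im_le_Cmod.
Qed.

Lemma Series_tail (b : nat -> R) (N : nat) : ex_series b ->
  is_series (fun n => if Nat.ltb N n then b n else 0) (Series b - sum_n b N).
Proof.
  intros Hb; apply Series_correct in Hb.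
  assert (Hl : is_lim_seq (fun n => sum_n b n - sum_n b N) (Series b - sum_n b N)).
  { apply is_lim_seq_minus'; [exact Hb | apply is_lim_seq_const]. }
  apply is_lim_seq_ext_loc with (2 := Hl).
  exists N; intros n Hn; induction Hn as [|n Hn IH].
  - rewrite Rminus_diag. symmetry.
    transitivity (sum_n (fun _ => 0) N).
    + apply sum_n_ext_loc; intros k Hk.
      destruct (Nat.ltb_spec N k); [lia | reflexivity].
    + rewrite sum_n_const; ring.
  - rewrite !sum_Sn, <- IH.
    destruct (Nat.ltb_spec N (S n)); [|lia].
    unfold plus; simpl; ring.
Qed.

Lemma Series_tail_small (b : nat -> R) (eps : R) : 0 < eps -> ex_series b ->
  exists N0, forall N, (N0 <= N)%nat ->
    Rabs (Series (fun n => if Nat.ltb N n then b n else 0)) < eps.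
Proof.
  intros He Hb.
  assert (H := Series_correct _ Hb).
  destruct (proj1 (filterlim_locally _ _) H (mkposreal _ He)) as [N0 HN0].
  exists N0; intros N HN; specialize (HN0 N HN).
  replace (Series (fun n => if Nat.ltb N n then b n else 0)) with (Series b - sum_n b N)
    by (symmetry; apply is_series_unique, Series_tail, Hb).
  rewrite Rabs_minus_sym.
  exact HN0.
Qed.

(** * Dirichlet monomials *)

(* [n ^ (-s)], with the value 0 at [n = 0] so that series may start at 0. *)
Definition dm (s : C) (n : nat) : C :=
  match n with O => 0 | S _ => Cexp (- s * RtoC (ln (INR n))) end.

Definition pw (x : R) (n : nat) : R :=
  match n with O => 0 | S _ => exp (- x * ln (INR n)) end.

(** At [n = 0] this relies on the default value 0 of [ln] outside the positive reals. *)
Lemma lnN_ge_0 (n : nat) : 0 <= ln (INR n).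
Proof.
  destruct n as [|n].
  - change (INR 0) with 0; unfold ln; destruct (Rlt_dec 0 0) as [H | H];
      [destruct (Rlt_irrefl _ H) | apply Rle_refl].
  - rewrite <- ln_1; apply ln_le; [lra|].
    rewrite S_INR; generalize (pos_INR n); lra.
Qed.

Lemma lnN_gt_0 (n : nat) : (2 <= n)%nat -> 0 < ln (INR n).
Proof.
  intros Hn; rewrite <- ln_1; apply ln_increasing; [lra|].
  apply le_INR in Hn; simpl in Hn; lra.
Qed.

Lemma pw_pos (x : R) (n : nat) : (0 < n)%nat -> 0 < pw x n.
Proof. destruct n; [lia | intros _; apply exp_pos]. Qed.

Lemma pw_ge_0 (x : R) (n : nat) : 0 <= pw x n.
Proof. destruct n; simpl; [lra | left; apply exp_pos]. Qed.

Lemma pw_decr (x y : R) (n : nat) : x <= y -> pw y n <= pw x n.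
Proof.
  intros H; destruct n as [|n]; [simpl; lra|].
  apply Rexp_le; generalize (lnN_ge_0 (S n)); nra.
Qed.

Lemma pw_lt_1 (x : R) (n : nat) : 0 < x -> (2 <= n)%nat -> pw x n < 1.
Proof.
  intros Hx Hn; generalize (lnN_gt_0 n Hn); destruct n as [|n]; [lia|]; intros H.
  rewrite <- exp_0; apply exp_increasing; nra.
Qed.

(** From u <= e^u with u = (y - x) ln n: a logarithm costs an arbitrarily small shift of the
    exponent. *)
Lemma lnN_pw_le (x y : R) (n : nat) : x < y ->
  ln (INR n) * pw y n <= / (y - x) * pw x n.
Proof.
  intros H; destruct n as [|n]; [simpl; lra|].
  unfold pw; set (l := ln (INR (S n))).
  apply Rmult_le_reg_l with (y - x); [lra|].
  replace ((y - x) * (/ (y - x) * exp (- x * l))) with (exp (- x * l)) by (field; lra).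
  replace (exp (- x * l)) with (exp ((y - x) * l) * exp (- y * l))
    by (rewrite <- exp_plus; f_equal; ring).
  rewrite <- Rmult_assoc; apply Rmult_le_compat_r; [left; apply exp_pos|].
  generalize (exp_ineq1_le ((y - x) * l)); lra.
Qed.

Lemma dm_mult (s : C) (m n : nat) : dm s (m * n) = (dm s m * dm s n)%C.
Proof.
  destruct m as [|m]; [simpl; ring|].
  destruct n as [|n]; [rewrite Nat.mul_0_r; simpl; ring|].
  change (dm s (S m * S n)) with (Cexp (- s * RtoC (ln (INR (S m * S n))))).
  unfold dm at 1 2; rewrite <- Cexp_plus; f_equal.
  rewrite mult_INR, ln_mult, RtoC_plus; [ring | |]; apply lt_0_INR; lia.
Qed.

Lemma dm_1 (s : C) : dm s 1 = RtoC 1.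
Proof. simpl; rewrite ln_1, Cmult_0_r; apply Cexp_0. Qed.

Lemma Cmod_dm (s : C) (n : nat) : Cmod (dm s n) = pw (Re s) n.
Proof.
  destruct n as [|n]; [apply Cmod_0|].
  unfold dm, pw; rewrite Cmod_Cexp, re_scal_r; reflexivity.
Qed.

Lemma dm_R (x : R) (n : nat) : dm (RtoC x) n = RtoC (pw x n).
Proof.
  destruct n as [|n]; [reflexivity|].
  unfold dm, pw; rewrite <- RtoC_opp, <- RtoC_mult; apply Cexp_R.
Qed.

Lemma dm_neq_0 (s : C) (n : nat) : (0 < n)%nat -> dm s n <> RtoC 0.
Proof. intros H; apply Cmod_gt_0; rewrite Cmod_dm; now apply pw_pos. Qed.

Lemma dm_plus (s w : C) (n : nat) : dm (s + w) n = (dm s n * dm w n)%C.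
Proof.
  destruct n as [|n]; [simpl; ring|].
  unfold dm; rewrite <- Cexp_plus; f_equal; ring.
Qed.

Lemma pw_plus (x y : R) (n : nat) : pw (x + y) n = pw x n * pw y n.
Proof.
  destruct n as [|n]; [simpl; ring|].
  unfold pw; rewrite <- exp_plus; f_equal; ring.
Qed.

Lemma dm_lipschitz (x : R) (s w : C) (n : nat) : x <= Re s -> x <= Re w ->
  Cmod (dm s n - dm w n) <= Cmod (s - w) * (ln (INR n) * pw x n).
Proof.
  intros Hs Hw; destruct n as [|n].
  - simpl; replace (RtoC 0 - RtoC 0)%C with (RtoC 0) by ring; rewrite Cmod_0; lra.
  - unfold dm, pw; set (l := ln (INR (S n))).
    assert (Hl : 0 <= l) by apply lnN_ge_0.
    apply Rle_trans with (1 := Cexp_lipschitz _ _).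
    replace (- s * l - - w * l)%C with (- (s - w) * RtoC l)%C by ring.
    rewrite Cmod_mult, Cmod_opp, Cmod_R, Rabs_pos_eq by exact Hl.
    rewrite Rmult_assoc; apply Rmult_le_compat_l; [apply Cmod_ge_0|].
    apply Rmult_le_compat_l; [exact Hl|].
    apply Rexp_le, Rmax_lub; rewrite re_scal_r; change (Re (- s)) with (- Re s);
      change (Re (- w)) with (- Re w); nra.
Qed.

(** An integral test without integrals. With m = n + 2, the bound 1/m <= ln m - ln (m - 1) and e^u -
    1 >= u for u = d (ln m - ln (m - 1)) give the claim; the double successor keeps both bases
    positive. *)
Lemma pw_telescope_le (d : R) (n : nat) : 0 < d ->
  pw (1 + d) (S (S n)) <= / d * (pw d (S n) - pw d (S (S n))).
Proof.
  intros Hd; unfold pw; set (l := ln (INR (S n))); set (l' := ln (INR (S (S n)))).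
  assert (Hn : 0 < INR (S n)) by (apply lt_0_INR; lia).
  assert (Hn' : INR (S (S n)) = INR (S n) + 1) by apply S_INR.
  assert (Hl' : exp (- l') = / INR (S (S n))) by (unfold l'; rewrite exp_Ropp, exp_ln; lra).
  assert (Hll : exp (- l') <= l' - l).
  { assert (H : 1 - (l' - l) <= exp (- (l' - l))) by
      (generalize (exp_ineq1_le (- (l' - l))); lra).
    replace (- (l' - l)) with (l + - l') in H by ring.
    rewrite exp_plus in H; unfold l at 2 in H; rewrite exp_ln in H by exact Hn.
    rewrite Hl', Hn' in H |- *.
    replace (INR (S n) * / (INR (S n) + 1)) with (1 - / (INR (S n) + 1)) in H
      by (field; lra). lra. }
  assert (H1 : exp (- (1 + d) * l') = exp (- l') * exp (- d * l'))
    by (rewrite <- exp_plus; f_equal; ring).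
  assert (H2 : exp (- d * l) = exp (d * (l' - l)) * exp (- d * l'))
    by (rewrite <- exp_plus; f_equal; ring).
  rewrite H1, H2.
  apply Rmult_le_reg_l with d; [exact Hd|].
  replace (d * (/ d * (exp (d * (l' - l)) * exp (- d * l') - exp (- d * l'))))
    with ((exp (d * (l' - l)) - 1) * exp (- d * l')) by (field; lra).
  rewrite <- Rmult_assoc; apply Rmult_le_compat_r; [left; apply exp_pos|].
  generalize (exp_ineq1_le (d * (l' - l))); nra.
Qed.

Lemma pw_N_decr (d : R) (n : nat) : 0 < d -> pw d (S (S n)) <= pw d (S n).
Proof.
  intros Hd; apply Rexp_le.
  assert (ln (INR (S n)) <= ln (INR (S (S n)))).
  { apply ln_le; [apply lt_0_INR; lia | apply le_INR; lia]. }
  nra.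
Qed.

Lemma ex_series_pw (x : R) : 1 < x -> ex_series (pw x).
Proof.
  intros Hx; set (d := x - 1); assert (Hd : 0 < d) by (unfold d; lra).
  (* The terms at 0 and 1 are dropped, since the telescoping bound starts at 2. *)
  apply ex_series_incr_1, ex_series_incr_1.
  apply ex_series_dom with (fun n => / d * (pw d (S n) - pw d (S (S n)))).
  - intros n; rewrite Rabs_pos_eq by apply pw_ge_0.
    replace x with (1 + d) by (unfold d; ring); now apply pw_telescope_le.
  - apply (ex_series_scal_l (/ d) (fun n => pw d (S n) - pw d (S (S n)))).
    destruct (ex_finite_lim_seq_decr (fun n => pw d (S n)) 0) as [l Hl].
    + intros n; now apply pw_N_decr.
    + intros n; apply pw_ge_0.
    + exists (pw d 1 - l).
      change (is_lim_seq (sum_n (fun n => pw d (S n) - pw d (S (S n)))) (pw d 1 - l)).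
      apply (is_lim_seq_ext (fun n => pw d 1 - pw d (S (S n)))).
      * intros n; induction n as [|n IH]; [now rewrite sum_O|].
        rewrite sum_Sn, <- IH; unfold plus; simpl; ring.
      * apply is_lim_seq_minus'; [apply is_lim_seq_const|].
        now apply (is_lim_seq_incr_1 (fun n => pw d (S n))) in Hl.
Qed.

Lemma ex_series_ln_pw (x : R) : 1 < x -> ex_series (fun n => ln (INR n) * pw x n).
Proof.
  intros Hx; set (y := (1 + x) / 2).
  apply ex_series_dom with (fun n => / (x - y) * pw y n).
  - intros n; rewrite Rabs_pos_eq.
    + apply lnN_pw_le; unfold y; lra.
    + apply Rmult_le_pos; [apply lnN_ge_0 | apply pw_ge_0].
  - apply (ex_series_scal_l (/ (x - y)) (pw y)), ex_series_pw; unfold y; lra.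
Qed.

Lemma ex_series_ln2_pw (x : R) : 1 < x ->
  ex_series (fun n => ln (INR n) * (ln (INR n) * pw x n)).
Proof.
  intros Hx; set (y := (1 + x) / 2).
  apply ex_series_dom with (fun n => / (x - y) * (ln (INR n) * pw y n)).
  - intros n; assert (H := lnN_ge_0 n); rewrite Rabs_pos_eq.
    + assert (H1 : ln (INR n) * pw x n <= / (x - y) * pw y n)
        by (apply lnN_pw_le; unfold y; lra).
      apply Rle_trans with (ln (INR n) * (/ (x - y) * pw y n));
        [now apply Rmult_le_compat_l | right; ring].
    + repeat apply Rmult_le_pos; try exact H; apply pw_ge_0.
  - apply (ex_series_scal_l (/ (x - y)) (fun n => ln (INR n) * pw y n)), ex_series_ln_pw;
      unfold y; lra.
Qed.

(** * Dirichlet series with real coefficients *)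

(** Logarithmic growth admits both the coefficients 0, 1 and their multiples by [ln n], is stable
    under dilating the index, and guarantees absolute convergence for [Re s > 1]. *)
Definition tame (c : nat -> R) : Prop :=
  exists K, forall n, Rabs (c n) <= K * (1 + ln (INR n)).

Definition DS (c : nat -> R) (s : C) : C := Csum (fun n => RtoC (c n) * dm s n)%C.

Definition rDS (c : nat -> R) (x : R) : R := Series (fun n => c n * pw x n).

Lemma tame_le (c d : nat -> R) : (forall n, Rabs (c n) <= Rabs (d n)) -> tame d -> tame c.
Proof. intros H [K HK]; exists K; intros n; apply Rle_trans with (1 := H n), HK. Qed.

Lemma tame_bounded (c : nat -> R) (K : R) : (forall n, Rabs (c n) <= K) -> tame c.
Proof.
  intros H; exists K; intros n; apply Rle_trans with (1 := H n).
  assert (0 <= K) by (apply Rle_trans with (2 := H n), Rabs_pos).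
  generalize (lnN_ge_0 n); nra.
Qed.

Lemma tame_ln : tame (fun n => ln (INR n)).
Proof.
  exists 1; intros n; generalize (lnN_ge_0 n); intros H; rewrite Rabs_pos_eq; lra.
Qed.

Lemma lnN_mult_le (p n : nat) : ln (INR (p * n)) <= ln (INR p) + ln (INR n).
Proof.
  destruct p as [|p]; [generalize (lnN_ge_0 n); simpl; lra|].
  destruct n as [|n].
  - rewrite Nat.mul_0_r; generalize (lnN_ge_0 (S p)); lra.
  - rewrite mult_INR, ln_mult; [lra | |]; apply lt_0_INR; lia.
Qed.

Lemma tame_dilate (c : nat -> R) (p : nat) : tame c -> tame (fun m => c (p * m)%nat).
Proof.
  intros [K HK]; exists (K * (1 + ln (INR p))); intros n.
  apply Rle_trans with (1 := HK _).
  assert (H0 := Rabs_pos (c 0%nat)); assert (H1 := HK 0%nat).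
  assert (H2 := lnN_ge_0 0); assert (H3 := lnN_ge_0 p); assert (H4 := lnN_ge_0 n).
  assert (0 <= K) by nra.
  rewrite Rmult_assoc; apply Rmult_le_compat_l; [assumption|].
  generalize (lnN_mult_le p n); nra.
Qed.

Lemma ex_series_tame (c : nat -> R) (x : R) : tame c -> 1 < x ->
  ex_series (fun n => Rabs (c n) * pw x n).
Proof.
  intros [K HK] Hx.
  apply ex_series_dom with (fun n => K * (pw x n + ln (INR n) * pw x n)).
  - intros n; assert (H := pw_ge_0 x n).
    rewrite Rabs_pos_eq by (apply Rmult_le_pos; [apply Rabs_pos | exact H]).
    apply Rle_trans with (K * (1 + ln (INR n)) * pw x n);
      [now apply Rmult_le_compat_r | right; ring].
  - apply (ex_series_scal_l K (fun n => pw x n + ln (INR n) * pw x n)).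
    apply (ex_series_plus (pw x) (fun n => ln (INR n) * pw x n));
      auto using ex_series_pw, ex_series_ln_pw.
Qed.

Lemma ex_series_ln_tame (c : nat -> R) (x : R) : tame c -> 1 < x ->
  ex_series (fun n => Rabs (c n) * (ln (INR n) * pw x n)).
Proof.
  intros [K HK] Hx.
  apply ex_series_dom with
    (fun n => K * (ln (INR n) * pw x n + ln (INR n) * (ln (INR n) * pw x n))).
  - intros n.
    assert (H : 0 <= ln (INR n) * pw x n)
      by (apply Rmult_le_pos; [apply lnN_ge_0 | apply pw_ge_0]).
    rewrite Rabs_pos_eq by (apply Rmult_le_pos; [apply Rabs_pos | exact H]).
    apply Rle_trans with (K * (1 + ln (INR n)) * (ln (INR n) * pw x n));
      [now apply Rmult_le_compat_r | right; ring].
  - apply (ex_series_scal_l K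
      (fun n => ln (INR n) * pw x n + ln (INR n) * (ln (INR n) * pw x n))).
    apply (ex_series_plus (fun n => ln (INR n) * pw x n)
      (fun n => ln (INR n) * (ln (INR n) * pw x n)));
      auto using ex_series_ln_pw, ex_series_ln2_pw.
Qed.

Lemma Cmod_DS_term (c : nat -> R) (s : C) (n : nat) :
  Cmod (RtoC (c n) * dm s n) = Rabs (c n) * pw (Re s) n.
Proof. now rewrite Cmod_mult, Cmod_R, Cmod_dm. Qed.

Lemma summable_DS (c : nat -> R) (s : C) : tame c -> 1 < Re s ->
  summable (fun n => RtoC (c n) * dm s n)%C.
Proof.
  intros Hc Hs; apply summable_dom with (fun n => Rabs (c n) * pw (Re s) n).
  - intros n; rewrite Cmod_DS_term; apply Rle_refl.
  - now apply ex_series_tame.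
Qed.

Lemma ex_series_rDS (c : nat -> R) (x : R) : tame c -> 1 < x ->
  ex_series (fun n => c n * pw x n).
Proof.
  intros Hc Hx; apply ex_series_dom with (2 := ex_series_tame c x Hc Hx).
  intros n; rewrite Rabs_mult, (Rabs_pos_eq (pw x n)) by apply pw_ge_0; apply Rle_refl.
Qed.

Lemma DS_R (c : nat -> R) (x : R) : DS c (RtoC x) = RtoC (rDS c x).
Proof.
  unfold DS, rDS; apply C_eq; simpl.
  - apply Series_ext; intros n; rewrite dm_R; simpl; ring.
  - transitivity (Series (fun _ : nat => 0 * 0)); [|rewrite Series_scal_l; ring].
    apply Series_ext; intros n; rewrite dm_R; simpl; ring.
Qed.

Lemma DS_ext (c d : nat -> R) (s : C) :
  (forall n, (0 < n)%nat -> c n = d n) -> DS c s = DS d s.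
Proof.
  intros H; apply Csum_ext; intros [|n]; [simpl; ring | rewrite H by lia; reflexivity].
Qed.

Lemma DS_plus (c d : nat -> R) (s : C) : tame c -> tame d -> 1 < Re s ->
  DS (fun n => c n + d n) s = (DS c s + DS d s)%C.
Proof.
  intros Hc Hd Hs; unfold DS; rewrite <- Csum_plus by now apply summable_DS.
  apply Csum_ext; intros n; rewrite RtoC_plus; ring.
Qed.

Lemma DS_scal (k : R) (c : nat -> R) (s : C) : tame c -> 1 < Re s ->
  DS (fun n => k * c n) s = (RtoC k * DS c s)%C.
Proof.
  intros Hc Hs; unfold DS; rewrite <- Csum_scal by now apply summable_DS.
  apply Csum_ext; intros n; rewrite RtoC_mult; ring.
Qed.

Lemma Cmod_DS_le (c d : nat -> R) (s : C) : tame d -> 1 < Re s ->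
  (forall n, Rabs (c n) <= d n) -> Cmod (DS c s) <= rDS d (Re s).
Proof.
  intros Hd Hs H; apply Cmod_Csum_le; [|now apply ex_series_rDS].
  intros n; rewrite Cmod_DS_term; apply Rmult_le_compat_r; [apply pw_ge_0 | apply H].
Qed.

Lemma DS_lipschitz (c : nat -> R) (x : R) (s w : C) : tame c -> 1 < x ->
  x <= Re s -> x <= Re w ->
  Cmod (DS c s - DS c w)
  <= Cmod (s - w) * Series (fun n => Rabs (c n) * (ln (INR n) * pw x n)).
Proof.
  intros Hc Hx Hs Hw; unfold DS.
  rewrite <- Csum_minus by (apply summable_DS; [exact Hc | lra]).
  rewrite <- Series_scal_l; apply Cmod_Csum_le.
  - intros n.
    replace (c n * dm s n - c n * dm w n)%C with (c n * (dm s n - dm w n))%C by ring.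
    rewrite Cmod_mult, Cmod_R.
    apply Rle_trans with (Rabs (c n) * (Cmod (s - w) * (ln (INR n) * pw x n))).
    + apply Rmult_le_compat_l; [apply Rabs_pos | now apply dm_lipschitz].
    + right; ring.
  - apply (ex_series_scal_l (Cmod (s - w))
      (fun n => Rabs (c n) * (ln (INR n) * pw x n))).
    now apply ex_series_ln_tame.
Qed.

(** A special case of the complex Lipschitz bound at real points, with an abscissa halfway between 1
    and [x]. *)
Lemma rDS_continuity_pt (c : nat -> R) (x : R) : tame c -> 1 < x ->
  continuity_pt (rDS c) x.
Proof.
  intros Hc Hx; set (y := (1 + x) / 2).
  set (K := Series (fun n => Rabs (c n) * (ln (INR n) * pw y n))).
  apply continuity_pt_locally; intros eps.
  assert (Hd : 0 < Rmin (x - y) (eps / (Rabs K + 1))).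
  { apply Rmin_pos; [unfold y; lra|].
    apply Rdiv_lt_0_compat; [apply cond_pos | generalize (Rabs_pos K); lra]. }
  exists (mkposreal _ Hd); intros u Hu.
  change (Rabs (u - x) < Rmin (x - y) (eps / (Rabs K + 1))) in Hu.
  assert (Hu1 := Rlt_le_trans _ _ _ Hu (Rmin_l _ _)).
  assert (Hu2 := Rlt_le_trans _ _ _ Hu (Rmin_r _ _)).
  apply Rle_lt_trans with (Rabs (u - x) * K).
  - rewrite <- !Cmod_R, !RtoC_minus, <- !DS_R.
    apply DS_lipschitz; [exact Hc | unfold y; lra | |]; simpl;
      apply Rabs_def2 in Hu1; lra.
  - assert (H := Rabs_pos K); assert (H' := Rle_abs K).
    apply Rmult_lt_compat_r with (r := Rabs K + 1) in Hu2; [|lra].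
    unfold Rdiv in Hu2; rewrite Rmult_assoc, Rinv_l in Hu2 by lra.
    generalize (Rabs_pos (u - x)); nra.
Qed.

Lemma rDS_lim (c : nat -> R) (u : nat -> R) (x : R) : tame c -> 1 < x ->
  is_lim_seq u x -> is_lim_seq (fun n => rDS c (u n)) (rDS c x).
Proof.
  intros Hc Hx Hu; apply (is_lim_seq_continuous (rDS c)); [|exact Hu].
  now apply rDS_continuity_pt.
Qed.

(** * The sieve of Eratosthenes on Dirichlet series *)

(** The multiples of [p] are reindexed as [p * m], and the monomial at [p * m] factors. *)
Lemma DS_sieve (c : nat -> R) (p : nat) (s : C) : p <> 0%nat -> tame c -> 1 < Re s ->
  DS c s = (DS (fun n => if divides p n then 0 else c n) s
            + dm s p * DS (fun m => c (p * m)%nat) s)%C.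
Proof.
  intros Hp Hc Hs.
  assert (H1 : tame (fun n => if divides p n then 0 else c n)).
  { apply tame_le with (2 := Hc); intros n; destruct (divides p n); [|lra].
    rewrite Rabs_R0; apply Rabs_pos. }
  assert (H2 : tame (fun n => if divides p n then c n else 0)).
  { apply tame_le with (2 := Hc); intros n; destruct (divides p n); [lra|].
    rewrite Rabs_R0; apply Rabs_pos. }
  transitivity (DS (fun n => (if divides p n then 0 else c n)
                             + (if divides p n then c n else 0)) s).
  { apply DS_ext; intros n _; destruct (divides p n); ring. }
  rewrite DS_plus by assumption; f_equal.
  transitivity (Csum (fun n => if divides p n then (c n * dm s n)%C else 0)).
  { apply Csum_ext; intros n; destruct (divides p n); [reflexivity | ring]. }
  rewrite Csum_multiples by (try exact Hp; now apply summable_DS).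
  unfold DS; rewrite <- Csum_scal
    by (apply summable_DS; [now apply tame_dilate | exact Hs]).
  apply Csum_ext; intros n; rewrite dm_mult; ring.
Qed.

(** The list is 2, ..., [N], so for [N = 1] nothing is sieved and [rcoef 1] gives the full zeta
    series. Testing all [d] instead of primes avoids enumerating the primes. *)
Definition rough (N n : nat) : bool :=
  forallb (fun d => negb (divides d n)) (seq 2 (N - 1)).

Definition isprime (p : nat) : bool := (Nat.leb 2 p && rough (p - 1) p)%bool.

Lemma rough_spec (N n : nat) :
  rough N n = true <-> forall d, (2 <= d <= N)%nat -> ~ Nat.divide d n.
Proof.
  unfold rough; rewrite forallb_forall; split.
  - intros H d Hd Hn; specialize (H d); rewrite in_seq in H.
    apply (divides_spec d n) in Hn; [|lia].
    rewrite Hn in H; discriminate H; lia.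
  - intros H d Hd; rewrite in_seq in Hd.
    destruct (divides d n) eqn:E; [|reflexivity].
    apply divides_spec in E; [|lia]. destruct (H d); [lia | exact E].
Qed.

Lemma isprime_spec (p : nat) :
  isprime p = true <-> (2 <= p)%nat /\ forall d, (2 <= d < p)%nat -> ~ Nat.divide d p.
Proof.
  unfold isprime; rewrite Bool.andb_true_iff, Nat.leb_le, rough_spec.
  split; intros [H1 H2]; split; auto; intros d Hd; apply H2; lia.
Qed.

Lemma prime_isprime (p : nat) : prime (Z.of_nat p) -> isprime p = true.
Proof.
  intros Hp; apply isprime_spec.
  assert (H2 := prime_ge_2 _ Hp); split; [lia|].
  intros d Hd [k Hk].
  assert (Hdiv : (Z.of_nat d | Z.of_nat p)%Z) by (exists (Z.of_nat k); lia).
  destruct (prime_divisors _ Hp _ Hdiv) as [H | [H | [H | H]]]; lia.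
Qed.

Lemma rough_S (N n : nat) : (1 <= N)%nat ->
  rough (S N) n = (rough N n && negb (divides (S N) n))%bool.
Proof.
  intros HN; unfold rough.
  replace (S N - 1)%nat with (N - 1 + 1)%nat by lia.
  rewrite seq_app, forallb_app; simpl.
  replace (S (S (N - 1))) with (S N) by lia; now rewrite Bool.andb_true_r.
Qed.

(** A composite [S N] has a divisor between 2 and [N], so its multiples have already been
    removed. *)
Lemma rough_S_composite (N n : nat) : (1 <= N)%nat -> isprime (S N) = false ->
  rough (S N) n = rough N n.
Proof.
  intros HN Hp; rewrite rough_S by exact HN.
  destruct (rough N n) eqn:E; [simpl | reflexivity].
  destruct (divides (S N) n) eqn:E'; [|reflexivity]. exfalso.
  apply divides_spec in E'; [|lia].
  rewrite <- Bool.not_true_iff_false in Hp; apply Hp, isprime_spec; split; [lia|].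
  intros d Hd Hd'.
  apply (proj1 (rough_spec N n) E d); [lia | now apply Nat.divide_trans with (S N)].
Qed.

(** Every [d] with 2 <= d <= N is coprime to the prime [S N], because their gcd is a divisor of
    [S N] smaller than it; Gauss's lemma then removes the factor [S N]. *)
Lemma rough_mult_prime (N m : nat) : (1 <= N)%nat -> isprime (S N) = true ->
  rough N (S N * m) = rough N m.
Proof.
  intros HN Hp; apply isprime_spec in Hp; destruct Hp as [_ Hp].
  apply Bool.eq_iff_eq_true; rewrite !rough_spec; split; intros H d Hd Hm.
  - apply (H d Hd); now apply Nat.divide_mul_r.
  - apply (H d Hd); apply Nat.gauss with (S N); [exact Hm|].
    assert (Hg1 := Nat.gcd_divide_l d (S N)); assert (Hg2 := Nat.gcd_divide_r d (S N)).
    assert (Hg3 : (Nat.gcd d (S N) <= d)%nat) by (apply Nat.divide_pos_le; [lia | exact Hg1]).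
    destruct (Nat.eq_dec (Nat.gcd d (S N)) 0) as [E | E].
    { apply Nat.gcd_eq_0_l in E; lia. }
    destruct (Nat.eq_dec (Nat.gcd d (S N)) 1) as [E' | E']; [exact E'|].
    destruct (Hp (Nat.gcd d (S N))); [lia | exact Hg2].
Qed.

Definition rcoef (N n : nat) : R := if rough N n then 1 else 0.

(** For [N >= 1] and [Re s > 1], [DA N] is zeta(s) times the product of 1 - p^(-s) over the primes p
    <= N, and [DB N] is minus its derivative. *)
Definition DA (N : nat) (s : C) : C := DS (rcoef N) s.
Definition DB (N : nat) (s : C) : C := DS (fun n => rcoef N n * ln (INR n)) s.

Lemma rcoef_01 (N n : nat) : 0 <= rcoef N n <= 1.
Proof. unfold rcoef; destruct (rough N n); lra. Qed.

Lemma tame_rcoef (N : nat) : tame (rcoef N).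
Proof.
  apply tame_bounded with 1; intros n; assert (H := rcoef_01 N n).
  rewrite Rabs_pos_eq; lra.
Qed.

Lemma tame_rcoef_ln (N : nat) : tame (fun n => rcoef N n * ln (INR n)).
Proof.
  apply tame_le with (2 := tame_ln); intros n; assert (H := rcoef_01 N n).
  rewrite Rabs_mult, (Rabs_pos_eq (rcoef N n)) by lra.
  generalize (Rabs_pos (ln (INR n))); nra.
Qed.

Lemma rcoef_S (N n : nat) : (1 <= N)%nat ->
  rcoef (S N) n = if divides (S N) n then 0 else rcoef N n.
Proof.
  intros HN; unfold rcoef; rewrite rough_S by exact HN.
  now destruct (rough N n), (divides (S N) n).
Qed.

Lemma DA_step (N : nat) (s : C) : (1 <= N)%nat -> isprime (S N) = true -> 1 < Re s ->
  DA (S N) s = (DA N s * (1 - dm s (S N)))%C.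
Proof.
  intros HN Hp Hs.
  assert (E := DS_sieve (rcoef N) (S N) s (Nat.neq_succ_0 N) (tame_rcoef N) Hs).
  rewrite (DS_ext (fun m => rcoef N (S N * m)) (rcoef N)) in E.
  2: { intros m _; unfold rcoef; now rewrite rough_mult_prime. }
  rewrite (DS_ext (fun n => if divides (S N) n then 0 else rcoef N n) (rcoef (S N))) in E.
  2: { intros m _; now rewrite rcoef_S. }
  unfold DA.
  transitivity (DS (rcoef N) s - dm s (S N) * DS (rcoef N) s)%C; [rewrite E at 1 |]; ring.
Qed.

(** The product rule for [DA N s * (1 - p^(-s))], obtained without differentiating: ln(p m) = ln p +
    ln m splits the sieved part. *)
Lemma DB_step (N : nat) (s : C) : (1 <= N)%nat -> isprime (S N) = true -> 1 < Re s ->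
  DB (S N) s = (DB N s * (1 - dm s (S N)) - ln (INR (S N)) * dm s (S N) * DA N s)%C.
Proof.
  intros HN Hp Hs.
  assert (E := DS_sieve _ (S N) s (Nat.neq_succ_0 N) (tame_rcoef_ln N) Hs).
  rewrite (DS_ext (fun m => rcoef N (S N * m) * ln (INR (S N * m)))
    (fun m => ln (INR (S N)) * rcoef N m + rcoef N m * ln (INR m))) in E.
  2: { intros m Hm; unfold rcoef; rewrite rough_mult_prime by assumption.
       rewrite mult_INR, ln_mult by (apply lt_0_INR; lia); destruct (rough N m); ring. }
  rewrite (DS_ext (fun n => if divides (S N) n then 0 else rcoef N n * ln (INR n))
    (fun n => rcoef (S N) n * ln (INR n))) in E.
  2: { intros m _; rewrite rcoef_S by exact HN.
       destruct (divides (S N) m); ring. }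
  rewrite DS_plus, DS_scal in E; auto using tame_rcoef, tame_rcoef_ln.
  - unfold DB, DA.
    set (B := DS (fun n => rcoef N n * ln (INR n)) s) in *.
    transitivity (B - dm s (S N) * (ln (INR (S N)) * DS (rcoef N) s + B))%C;
      [rewrite E at 1 |]; ring.
  - destruct (tame_rcoef N) as [K HK]; exists (Rabs (ln (INR (S N))) * K); intros n.
    rewrite Rabs_mult, Rmult_assoc; apply Rmult_le_compat_l; [apply Rabs_pos | apply HK].
Qed.

Lemma DA_composite (N : nat) (s : C) : (1 <= N)%nat -> isprime (S N) = false ->
  DA (S N) s = DA N s.
Proof.
  intros HN Hp; apply DS_ext; intros n _; unfold rcoef; now rewrite rough_S_composite.
Qed.

Lemma DB_composite (N : nat) (s : C) : (1 <= N)%nat -> isprime (S N) = false ->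
  DB (S N) s = DB N s.
Proof.
  intros HN Hp; apply DS_ext; intros n _; unfold rcoef; now rewrite rough_S_composite.
Qed.

Lemma Series_single (q : nat) (a : R) :
  Series (fun n => if Nat.eqb n q then a else 0) = a.
Proof.
  apply is_series_unique.
  change (is_lim_seq (sum_n (fun n => if Nat.eqb n q then a else 0)) a).
  apply is_lim_seq_ext_loc with (fun _ => a); [|apply is_lim_seq_const].
  exists q; intros n Hn; symmetry; induction Hn as [|n Hn IH].
  - assert (H : forall m, (m < q)%nat ->
      sum_n (fun n => if Nat.eqb n q then a else 0) m = 0).
    { intros m; induction m as [|m IH]; intros Hm.
      - rewrite sum_O; destruct q; [lia | reflexivity].
      - rewrite sum_Sn, IH by lia.
        destruct (Nat.eqb_spec (S m) q); [lia | apply Rplus_0_r]. }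
    destruct q as [|q]; [now rewrite sum_O|].
    rewrite sum_Sn, H, Nat.eqb_refl by lia; apply Rplus_0_l.
  - rewrite sum_Sn, IH; destruct (Nat.eqb_spec (S n) q); [lia | apply Rplus_0_r].
Qed.

Definition delta (q n : nat) : R := if Nat.eqb n q then 1 else 0.

Lemma tame_delta (q : nat) : tame (delta q).
Proof.
  apply tame_bounded with 1; intros n; unfold delta.
  destruct (Nat.eqb n q); rewrite ?Rabs_R1, ?Rabs_R0; lra.
Qed.

Lemma DS_delta (q : nat) (s : C) : DS (delta q) s = dm s q.
Proof.
  apply C_eq; unfold DS; simpl.
  - rewrite <- (Series_single q (Re (dm s q))); apply Series_ext; intros n.
    unfold delta; destruct (Nat.eqb_spec n q) as [-> |]; simpl; unfold Re; ring.
  - rewrite <- (Series_single q (Im (dm s q))); apply Series_ext; intros n.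
    unfold delta; destruct (Nat.eqb_spec n q) as [-> |]; simpl; unfold Im; ring.
Qed.

Lemma DS_minus (c d : nat -> R) (s : C) : tame c -> tame d -> 1 < Re s ->
  DS (fun n => c n - d n) s = (DS c s - DS d s)%C.
Proof.
  intros Hc Hd Hs; unfold DS; rewrite <- Csum_minus by now apply summable_DS.
  apply Csum_ext; intros n; rewrite RtoC_minus; ring.
Qed.

Lemma rough_large (N n : nat) : (2 <= N)%nat -> rough N n = true -> n = 1%nat \/ (N < n)%nat.
Proof.
  intros HN H; destruct (Nat.le_gt_cases n N) as [Hle | Hgt]; [left | now right].
  destruct n as [|[|n]]; [| reflexivity |]; exfalso.
  - apply (proj1 (rough_spec N _) H 2%nat); [lia | exists 0%nat; lia].
  - apply (proj1 (rough_spec N _) H (S (S n))); [lia | apply Nat.divide_refl].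
Qed.

Lemma rough_1 (N : nat) : rough N 1 = true.
Proof.
  apply rough_spec; intros d Hd Hd'; apply Nat.divide_1_r in Hd'; lia.
Qed.

(** After sieving up to [N] only 1 and integers above [N] survive, so the difference is bounded by a
    tail of a convergent series. Taking [N >= 2] also excludes the index 0. *)
Lemma DA_lim (s : C) (eps : R) : 1 < Re s -> 0 < eps ->
  exists N0, forall N, (N0 <= N)%nat -> Cmod (DA N s - 1) < eps.
Proof.
  intros Hs He.
  destruct (Series_tail_small _ _ He (ex_series_pw _ Hs)) as [N0 H].
  exists (max N0 2); intros N HN; specialize (H N ltac:(lia)).
  apply Rle_lt_trans with (2 := H), Rle_trans with (2 := Rle_abs _).
  unfold DA; rewrite <- (dm_1 s), <- DS_delta, <- DS_minus
    by auto using tame_rcoef, tame_delta.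
  apply Rle_trans with (rDS (fun n => if Nat.ltb N n then 1 else 0) (Re s)).
  - apply Cmod_DS_le; [| exact Hs |].
    + apply tame_bounded with 1; intros n.
      destruct (Nat.ltb N n); rewrite ?Rabs_R1, ?Rabs_R0; lra.
    + intros n; unfold rcoef, delta.
      destruct (rough N n) eqn:E.
      * apply rough_large in E; [|lia].
        destruct (Nat.eqb_spec n 1), (Nat.ltb_spec N n); try lia;
          rewrite ?Rminus_diag, ?Rminus_0_r, ?Rabs_R0, ?Rabs_R1; lra.
      * destruct (Nat.eqb_spec n 1) as [-> |]; [now rewrite rough_1 in E|].
        rewrite Rminus_diag, Rabs_R0; destruct (Nat.ltb N n); lra.
  - right; apply Series_ext; intros n; destruct (Nat.ltb N n); ring.
Qed.

Lemma DB_lim (s : C) (eps : R) : 1 < Re s -> 0 < eps ->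
  exists N0, forall N, (N0 <= N)%nat -> Cmod (DB N s) < eps.
Proof.
  intros Hs He.
  destruct (Series_tail_small _ _ He (ex_series_ln_pw _ Hs)) as [N0 H].
  exists (max N0 2); intros N HN; specialize (H N ltac:(lia)).
  apply Rle_lt_trans with (2 := H), Rle_trans with (2 := Rle_abs _).
  apply Rle_trans with (rDS (fun n => if Nat.ltb N n then ln (INR n) else 0) (Re s)).
  - apply Cmod_DS_le; [| exact Hs |].
    + apply tame_le with (2 := tame_ln); intros n.
      destruct (Nat.ltb N n); rewrite ?Rabs_R0; [lra | apply Rabs_pos].
    + intros n; assert (H0 := lnN_ge_0 n); unfold rcoef.
      destruct (rough N n) eqn:E.
      * apply rough_large in E; [|lia].
        rewrite Rmult_1_l, Rabs_pos_eq by exact H0.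
        destruct (Nat.ltb_spec N n); [lra|].
        destruct E as [-> | E]; [simpl; rewrite ln_1; lra | lia].
      * rewrite Rmult_0_l, Rabs_R0; destruct (Nat.ltb N n); lra.
  - right; apply Series_ext; intros n; destruct (Nat.ltb N n); ring.
Qed.

Lemma one_minus_dm_neq_0 (s : C) (p : nat) : 0 < Re s -> (2 <= p)%nat ->
  (1 - dm s p)%C <> RtoC 0.
Proof.
  intros Hs Hp E.
  assert (H : Cmod (dm s p) < 1) by (rewrite Cmod_dm; now apply pw_lt_1).
  replace (dm s p) with (RtoC 1 - (1 - dm s p))%C in H by ring.
  rewrite E in H; replace (1 - 0)%C with (RtoC 1) in H by ring.
  rewrite Cmod_1 in H; lra.
Qed.

(** A zero would persist at every later stage of the sieve, since each step multiplies by a factor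
    or changes nothing, whereas the sieved series tend to 1. *)
Lemma DA_neq_0 (N : nat) (s : C) : (1 <= N)%nat -> 1 < Re s -> DA N s <> RtoC 0.
Proof.
  intros HN Hs E.
  assert (H : forall k, DA (k + N) s = RtoC 0).
  { intros k; induction k as [|k IH]; [exact E|]; simpl.
    destruct (isprime (S (k + N))) eqn:Hp.
    - rewrite DA_step, IH by (assumption || lia); ring.
    - now rewrite DA_composite by (assumption || lia). }
  destruct (DA_lim s 1 Hs Rlt_0_1) as [N0 HN0].
  specialize (HN0 (N0 + N)%nat ltac:(lia)); rewrite H in HN0.
  replace (0 - 1)%C with (- (1))%C in HN0 by ring.
  rewrite Cmod_m1 in HN0; lra.
Qed.

(** The contribution ln p / (p^s - 1) of one prime to -zeta'/zeta; the value 0 elsewhere lets sums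
    run over consecutive integers. *)
Definition eterm (s : C) (p : nat) : C :=
  if isprime p then (ln (INR p) * (dm s p / (1 - dm s p)))%C else 0.

Definition rterm (x : R) (p : nat) : R :=
  if isprime p then ln (INR p) * (pw x p / (1 - pw x p)) else 0.

Fixpoint esum (j k : nat) (s : C) : C :=
  match k with O => 0 | S k => (esum j k s + eterm s (S (j + k)))%C end.

Fixpoint rsum (j k : nat) (x : R) : R :=
  match k with O => 0 | S k => rsum j k x + rterm x (S (j + k)) end.

(** Dividing the two sieve steps separates the logarithmic derivative of one Euler factor from that
    of the rest; a composite index changes neither series. *)
Lemma ratio_step (N : nat) (s : C) : (1 <= N)%nat -> 1 < Re s ->
  (DB N s / DA N s = eterm s (S N) + DB (S N) s / DA (S N) s)%C.
Proof.
  intros HN Hs; unfold eterm; destruct (isprime (S N)) eqn:Hp.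
  - assert (H1 := DA_neq_0 N s HN Hs).
    assert (H2 : (1 - dm s (S N))%C <> RtoC 0) by (apply one_minus_dm_neq_0; [lra | lia]).
    rewrite DA_step, DB_step by assumption; field; split; assumption.
  - rewrite DA_composite, DB_composite by assumption; ring.
Qed.

Lemma ratio_esum (j k : nat) (s : C) : (1 <= j)%nat -> 1 < Re s ->
  (DB j s / DA j s = esum j k s + DB (j + k) s / DA (j + k) s)%C.
Proof.
  intros Hj Hs; induction k as [|k IH].
  - rewrite Nat.add_0_r; simpl; ring.
  - rewrite IH, ratio_step, Nat.add_succ_r by (assumption || lia); simpl; ring.
Qed.

Lemma ratio_tail_small (j : nat) (s : C) (eps : R) : 1 < Re s -> 0 < eps ->
  exists k0, forall k, (k0 <= k)%nat -> Cmod (DB (j + k) s / DA (j + k) s) < eps.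
Proof.
  intros Hs He.
  (* Within 1/2 of its limit 1 the denominator has modulus above 1/2, which matches the bound
     [eps / 2] for the numerator. *)
  destruct (DA_lim s (1 / 2) Hs ltac:(lra)) as [N1 H1].
  destruct (DB_lim s (eps / 2) Hs ltac:(lra)) as [N2 H2].
  exists (1 + N1 + N2)%nat; intros k Hk.
  specialize (H1 (j + k)%nat ltac:(lia)); specialize (H2 (j + k)%nat ltac:(lia)).
  rewrite Cmod_div by (apply DA_neq_0; [lia | exact Hs]).
  assert (H3 : 1 / 2 < Cmod (DA (j + k) s)).
  { generalize (Cmod_minus_ge 1 (1 - DA (j + k) s)).
    replace (1 - (1 - DA (j + k) s))%C with (DA (j + k) s) by ring.
    rewrite Cmod_1, (Cmod_minus_sym 1); lra. }
  apply Rmult_lt_reg_r with (Cmod (DA (j + k) s)); [lra|].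
  unfold Rdiv; rewrite Rmult_assoc, Rinv_l by lra; nra.
Qed.

Lemma eterm_R (x : R) (p : nat) : 1 < x -> eterm (RtoC x) p = RtoC (rterm x p).
Proof.
  intros Hx; unfold eterm, rterm; destruct (isprime p) eqn:Hp; [|reflexivity].
  apply isprime_spec in Hp.
  assert (H := pw_lt_1 x p ltac:(lra) (proj1 Hp)).
  rewrite dm_R, RtoC_mult, RtoC_div, RtoC_minus by lra; reflexivity.
Qed.

Lemma esum_R (j k : nat) (x : R) : 1 < x -> esum j k (RtoC x) = RtoC (rsum j k x).
Proof.
  intros Hx; induction k as [|k IH]; [reflexivity|].
  simpl; now rewrite IH, eterm_R, RtoC_plus.
Qed.

Lemma Cmod_eterm_le (s : C) (p : nat) : 1 < Re s -> Cmod (eterm s p) <= rterm (Re s) p.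
Proof.
  intros Hs; unfold eterm, rterm; destruct (isprime p) eqn:Hp; [|rewrite Cmod_0; lra].
  apply isprime_spec in Hp; destruct Hp as [Hp _].
  assert (H := pw_lt_1 (Re s) p ltac:(lra) Hp); assert (H0 := pw_ge_0 (Re s) p).
  rewrite Cmod_mult, Cmod_R, Rabs_pos_eq by apply lnN_ge_0.
  apply Rmult_le_compat_l; [apply lnN_ge_0|].
  rewrite Cmod_div, Cmod_dm by (apply one_minus_dm_neq_0; [lra | exact Hp]).
  apply Rmult_le_compat_l; [exact H0|].
  apply Rinv_le_contravar; [lra|].
  generalize (Cmod_minus_ge 1 (dm s p)); rewrite Cmod_1, Cmod_dm; lra.
Qed.

Lemma Cmod_esum_le (j k : nat) (s : C) : 1 < Re s -> Cmod (esum j k s) <= rsum j k (Re s).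
Proof.
  intros Hs; induction k as [|k IH]; simpl; [rewrite Cmod_0; lra|].
  apply Rle_trans with (1 := Cmod_triangle _ _).
  generalize (Cmod_eterm_le s (S (j + k)) Hs); lra.
Qed.

Lemma Cmod_esum_minus_le (j k q : nat) (s : C) : 1 < Re s -> (j < q <= j + k)%nat ->
  Cmod (esum j k s - eterm s q) <= rsum j k (Re s) - rterm (Re s) q.
Proof.
  intros Hs; induction k as [|k IH]; intros Hq; [lia|]; simpl.
  destruct (Nat.eq_dec q (S (j + k))) as [-> | Hne].
  - replace (esum j k s + eterm s (S (j + k)) - eterm s (S (j + k)))%C
      with (esum j k s) by ring.
    generalize (Cmod_esum_le j k s Hs); lra.
  - replace (esum j k s + eterm s (S (j + k)) - eterm s q)%C
      with ((esum j k s - eterm s q) + eterm s (S (j + k)))%C by ring.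
    apply Rle_trans with (1 := Cmod_triangle _ _).
    specialize (IH ltac:(lia)); generalize (Cmod_eterm_le s (S (j + k)) Hs); lra.
Qed.

(** This is the sum of ln p / (p^x - 1) over the primes p > j. As a quotient of two series it
    inherits continuity from [rDS]. *)
Definition rratio (j : nat) (x : R) : R :=
  rDS (fun n => rcoef j n * ln (INR n)) x / rDS (rcoef j) x.

Lemma rDS_rcoef_neq_0 (j : nat) (x : R) : (1 <= j)%nat -> 1 < x -> rDS (rcoef j) x <> 0.
Proof.
  intros Hj Hx E; apply (DA_neq_0 j (RtoC x) Hj Hx).
  unfold DA; now rewrite DS_R, E.
Qed.

Lemma ratio_R (j : nat) (x : R) : (1 <= j)%nat -> 1 < x ->
  (DB j (RtoC x) / DA j (RtoC x))%C = RtoC (rratio j x).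
Proof.
  intros Hj Hx; unfold DB, DA, rratio; rewrite !DS_R, RtoC_div; [reflexivity|].
  now apply rDS_rcoef_neq_0.
Qed.

(* Every prime contributes at most as much at [s] as at [Re s]. *)
Lemma ratio_minus_eterm_le (j q : nat) (s : C) : (1 <= j < q)%nat -> 1 < Re s ->
  Cmod (DB j s / DA j s - eterm s q) <= rratio j (Re s) - rterm (Re s) q.
Proof.
  intros Hj Hs; apply le_epsilon; intros eps He.
  destruct (ratio_tail_small j s (eps / 2) Hs ltac:(lra)) as [k1 H1].
  destruct (ratio_tail_small j (RtoC (Re s)) (eps / 2) Hs ltac:(lra)) as [k2 H2].
  set (k := (k1 + k2 + q)%nat).
  specialize (H1 k ltac:(lia)); specialize (H2 k ltac:(lia)).
  assert (E1 := ratio_esum j k s ltac:(lia) Hs).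
  assert (E2 := ratio_esum j k (RtoC (Re s)) ltac:(lia) Hs).
  rewrite ratio_R, esum_R in E2 by (assumption || lia).
  set (e1 := (DB (j + k) s / DA (j + k) s)%C) in *.
  set (e2 := (DB (j + k) (RtoC (Re s)) / DA (j + k) (RtoC (Re s)))%C) in *.
  assert (E2' : rratio j (Re s) = rsum j k (Re s) + Re e2).
  { apply (f_equal Re) in E2; rewrite re_plus, !re_RtoC in E2; exact E2. }
  assert (H3 := re_ge_mod e2).
  rewrite E1; replace (esum j k s + e1 - eterm s q)%C
    with ((esum j k s - eterm s q) + e1)%C by ring.
  apply Rle_trans with (1 := Cmod_triangle _ _).
  generalize (Cmod_esum_minus_le j k q s Hs ltac:(lia)); lra.
Qed.

Lemma Cmod_ratio_le (j q : nat) (s : C) : (1 <= j < q)%nat -> 1 < Re s ->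
  Cmod (DB j s / DA j s) <= rratio j (Re s).
Proof.
  intros Hj Hs.
  replace (DB j s / DA j s)%C with ((DB j s / DA j s - eterm s q) + eterm s q)%C by ring.
  apply Rle_trans with (1 := Cmod_triangle _ _).
  generalize (ratio_minus_eterm_le j q s Hj Hs) (Cmod_eterm_le s q Hs); lra.
Qed.

Lemma rratio_lim (j : nat) (u : nat -> R) (x : R) : (1 <= j)%nat -> 1 < x ->
  is_lim_seq u x -> is_lim_seq (fun n => rratio j (u n)) (rratio j x).
Proof.
  intros Hj Hx Hu; apply is_lim_seq_div'.
  - apply rDS_lim; auto using tame_rcoef_ln.
  - apply rDS_lim; auto using tame_rcoef.
  - now apply rDS_rcoef_neq_0.
Qed.

(** * The zeta function and its derivative *)

Lemma rcoef_1 (n : nat) : rcoef 1 n = 1.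
Proof. reflexivity. Qed.

Lemma zeta_DA (zeta : C -> C) (s : C) : is_riemann_zeta zeta -> 1 < Re s ->
  zeta s = DA 1 s.
Proof.
  intros [Hz _] Hs; specialize (Hz s Hs).
  assert (H : @is_series C_AbsRing C_NormedModule (dm s) (zeta s)).
  (* The series defining zeta starts at [S 0]; prepending [dm s 0 = 0] aligns the indices. *)
  { apply is_series_decr_1.
    assert (E : zeta s = (zeta s + - RtoC 0)%C) by ring.
    rewrite E in Hz; exact Hz. }
  rewrite <- (is_series_Csum_eq _ _ H).
  apply Csum_ext; intros n; rewrite rcoef_1; ring.
Qed.

(** Factoring out n^(-s) leaves the second-order remainder of the exponential at -h ln n. Its factor
    e^(r ln n) is absorbed by lowering the exponent to [Re s - r]. *)
Lemma dm_taylor_1 (s h : C) (r : R) (n : nat) : Cmod h <= r ->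
  Cmod (dm (s + h) n - dm s n + h * (ln (INR n) * dm s n))
  <= Cmod h * Cmod h * (ln (INR n) * (ln (INR n) * pw (Re s - r) n)).
Proof.
  intros Hr; destruct n as [|n].
  - simpl; replace (0 - 0 + h * (ln 0 * 0))%C with (RtoC 0) by ring.
    rewrite Cmod_0; lra.
  - assert (Hl := lnN_ge_0 (S n)).
    assert (E : pw (Re s - r) (S n) = pw (Re s) (S n) * exp (r * ln (INR (S n))))
      by (unfold pw; rewrite <- exp_plus; f_equal; ring).
    rewrite E, dm_plus.
    replace (dm s (S n) * dm h (S n) - dm s (S n) + h * (ln (INR (S n)) * dm s (S n)))%C
      with (dm s (S n) * (dm h (S n) - 1 - (- h * ln (INR (S n)))))%C by ring.
    unfold dm at 2; set (l := ln (INR (S n))) in *.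
    rewrite Cmod_mult, Cmod_dm.
    apply Rle_trans with (pw (Re s) (S n) * (Cmod h * Cmod h * (l * l) * exp (r * l))).
    + apply Rmult_le_compat_l; [apply pw_ge_0|].
      apply Rle_trans with (1 := Cexp_taylor_1 _).
      rewrite Cmod_mult, Cmod_opp, Cmod_R, Rabs_pos_eq by exact Hl.
      replace (Cmod h * l * (Cmod h * l)) with (Cmod h * Cmod h * (l * l)) by ring.
      apply Rmult_le_compat_l.
      * repeat apply Rmult_le_pos; auto using Cmod_ge_0.
      * apply Rexp_le; now apply Rmult_le_compat_r.
    + right; ring.
Qed.

Lemma DA_taylor_1 (N : nat) (s : C) (r : R) (h : C) : 1 < Re s - r -> Cmod h <= r ->
  Cmod (DA N (s + h) - DA N s + h * DB N s)
  <= Cmod h * Cmod h * Series (fun n => ln (INR n) * (ln (INR n) * pw (Re s - r) n)).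
Proof.
  intros Hr Hh.
  assert (Hs : 1 < Re s) by (generalize (Cmod_ge_0 h); lra).
  assert (Hsh : 1 < Re (s + h)) by (rewrite re_plus; generalize (re_ge_mod h); lra).
  assert (E : (DA N (s + h) - DA N s + h * DB N s)%C =
    Csum (fun n => rcoef N n * (dm (s + h) n - dm s n + h * (ln (INR n) * dm s n)))%C).
  { unfold DA, DB, DS.
    rewrite <- Csum_scal by (apply (summable_DS (fun n => (rcoef N n * ln (INR n))%R));
      [apply tame_rcoef_ln | exact Hs]).
    rewrite <- Csum_minus by (apply summable_DS; auto using tame_rcoef).
    rewrite <- Csum_plus.
    - apply Csum_ext; intros n; rewrite RtoC_mult; ring.
    - apply summable_dom with (fun n => Cmod (rcoef N n * dm (s + h) n)
        + Cmod (rcoef N n * dm s n)).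
      + intros n; apply Cmod_minus_le.
      + apply (ex_series_plus (fun n => Cmod (rcoef N n * dm (s + h) n))
          (fun n => Cmod (rcoef N n * dm s n)));
          apply summable_DS; auto using tame_rcoef.
    - apply summable_scal, (summable_DS (fun n => (rcoef N n * ln (INR n))%R));
        [apply tame_rcoef_ln | exact Hs]. }
  rewrite E, <- Series_scal_l; apply Cmod_Csum_le.
  - intros n; rewrite Cmod_mult, Cmod_R.
    assert (H := rcoef_01 N n); rewrite Rabs_pos_eq by lra.
    generalize (dm_taylor_1 s h r n Hh)
      (Cmod_ge_0 (dm (s + h) n - dm s n + h * (ln (INR n) * dm s n))); nra.
  - apply (ex_series_scal_l (Cmod h * Cmod h)
      (fun n => ln (INR n) * (ln (INR n) * pw (Re s - r) n))).
    now apply ex_series_ln2_pw.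
Qed.

(** [C_derive] takes the limits of the two components of the difference quotient along the
    horizontal line through [s], so only real increments have to be estimated. *)
Lemma zeta_C_derive (zeta : C -> C) (s : C) : is_riemann_zeta zeta -> 1 < Re s ->
  C_derive zeta s = (- DB 1 s)%C.
Proof.
  intros Hz Hs; set (r := (Re s - 1) / 2).
  set (K := Series (fun n => ln (INR n) * (ln (INR n) * pw (Re s - r) n))).
  assert (Hr : 1 < Re s - r) by (unfold r; lra).
  assert (HK : 0 <= K).
  (* At the increment [r] the left side of the Taylor bound is nonnegative and [r * r] is positive,
     so [K] is nonnegative. *)
  { generalize (DA_taylor_1 1 s r (RtoC r) Hr).
    rewrite Cmod_R, Rabs_pos_eq by (unfold r; lra); fold K; intros H.
    specialize (H (Rle_refl r)).
    assert (0 < r * r) by (unfold r; apply Rmult_lt_0_compat; lra).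
    assert (H1 := Rle_trans _ _ _ (Cmod_ge_0 _) H).
    destruct (Rle_lt_dec 0 K); [assumption | nra]. }
  assert (Hq : forall x, Rabs (x - Re s) < r -> x <> Re s ->
    Cmod ((zeta (x, Im s) - zeta s) / ((x, Im s) - s) - - DB 1 s)
    <= Rabs (x - Re s) * K).
  { intros x Hx Hxs; set (h := x - Re s).
    assert (E : (x, Im s) = (s + RtoC h)%C).
    { apply C_eq; simpl; unfold h, Re, Im; ring. }
    rewrite E; assert (Hh : Cmod (RtoC h) <= r) by (rewrite Cmod_R; unfold h; lra).
    assert (Hh0 : RtoC h <> RtoC 0) by (intros H; apply RtoC_inj in H; unfold h in H; lra).
    assert (Hsh : 1 < Re (s + RtoC h)).
    { rewrite re_plus; generalize (re_ge_mod (RtoC h)); lra. }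
    rewrite !(zeta_DA zeta) by assumption.
    replace ((DA 1 (s + h) - DA 1 s) / (s + h - s) - - DB 1 s)%C
      with ((DA 1 (s + h) - DA 1 s + h * DB 1 s) / h)%C.
    2: { replace (s + h - s)%C with (RtoC h) by ring; field; exact Hh0. }
    rewrite Cmod_div by exact Hh0.
    assert (H0 : 0 < Cmod (RtoC h)) by now apply Cmod_gt_0.
    apply Rmult_le_reg_r with (Cmod (RtoC h)); [exact H0|].
    unfold Rdiv; rewrite Rmult_assoc, Rinv_l by lra; rewrite Rmult_1_r.
    apply Rle_trans with (1 := DA_taylor_1 1 s r (RtoC h) Hr Hh).
    fold K; rewrite Cmod_R; right; ring. }
  assert (Hlim : forall (f : C -> R), (forall z w, Rabs (f z - f w) <= Cmod (z - w)) ->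
    Lim (fun x => f ((zeta (x, Im s) - zeta s) / ((x, Im s) - s))%C) (Re s)
    = f (- DB 1 s)%C).
  { intros f Hf; apply is_lim_unique, is_lim_spec; intros eps; simpl.
    assert (Hd : 0 < Rmin r (eps / (K + 1))).
    { apply Rmin_pos; [unfold r; lra|].
      apply Rdiv_lt_0_compat; [apply cond_pos | lra]. }
    exists (mkposreal _ Hd); intros x Hx Hxs.
    change (Rabs (x - Re s) < Rmin r (eps / (K + 1))) in Hx.
    apply Rle_lt_trans with (1 := Hf _ _).
    apply Rle_lt_trans with (1 := Hq x (Rlt_le_trans _ _ _ Hx (Rmin_l _ _)) Hxs).
    assert (Hx' := Rlt_le_trans _ _ _ Hx (Rmin_r _ _)).
    apply Rle_lt_trans with (Rabs (x - Re s) * (K + 1)).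
    - apply Rmult_le_compat_l; [apply Rabs_pos | lra].
    - apply Rmult_lt_compat_r with (r := K + 1) in Hx'; [|lra].
      unfold Rdiv in Hx'; rewrite Rmult_assoc, Rinv_l in Hx' by lra; lra. }
  unfold C_derive, C_lim.
  transitivity (Re (- DB 1 s), Im (- DB 1 s))%C; [f_equal | apply C_eq; reflexivity].
  - refine (f_equal real (Hlim Re _)); intros z w.
    replace (Re z - Re w) with (Re (z - w)) by (unfold Re; simpl; ring); apply re_le_Cmod.
  - refine (f_equal real (Hlim Im _)); intros z w.
    replace (Im z - Im w) with (Im (z - w)) by (unfold Im; simpl; ring); apply im_le_Cmod.
Qed.

(** * Limits of unimodular numbers *)

Definition unim (t : R) (n : nat) : C := dm (Ci * RtoC t) n.

Lemma unim_cpow (t : R) (n : nat) : (0 < n)%nat ->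
  cpow (INR n) (- (Ci * RtoC t)) = unim t n.
Proof. destruct n; [lia | reflexivity]. Qed.

Lemma Cmod_unim (t : R) (n : nat) : (0 < n)%nat -> Cmod (unim t n) = 1.
Proof.
  intros Hn; unfold unim; rewrite Cmod_dm.
  replace (Re (Ci * RtoC t)) with 0 by (simpl; ring).
  destruct n; [lia | unfold pw; rewrite Ropp_0, Rmult_0_l; apply exp_0].
Qed.

Lemma dm_polar (s : C) (n : nat) : dm s n = (RtoC (pw (Re s) n) * unim (Im s) n)%C.
Proof.
  unfold unim; rewrite <- dm_R, <- dm_plus; f_equal.
  apply C_eq; simpl; unfold Re, Im; ring.
Qed.

Lemma Cmod_1_re_sqr (z : C) : Cmod z = 1 -> Re z * Re z + Im z * Im z = 1.
Proof. intros H; rewrite <- Cmod_sqr, H; ring. Qed.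

Lemma Cmod_1_re_bounds (z : C) : Cmod z = 1 -> -1 <= Re z <= 1.
Proof. intros H; assert (H1 := re_le_mod z); assert (H2 := re_ge_mod z); lra. Qed.

(** Since [e] is 1 or -1, the squared imaginary part 1 - (Re z)^2 tends to 0. *)
Lemma unit_re_lim (z : nat -> C) (e : R) : (forall n, Cmod (z n) = 1) -> e * e = 1 ->
  is_lim_seq (fun n => Re (z n)) e -> filterlim z eventually (locally (RtoC e)).
Proof.
  intros Hz He H; apply filterlim_locally; intros eps.
  assert (H2 : is_lim_seq (fun n => Re (z n) * Re (z n)) 1).
  { replace (Finite 1) with (Finite (e * e)) by now rewrite He.
    now apply is_lim_seq_mult'. }
  assert (Hp : 0 < eps * eps) by (apply Rmult_lt_0_compat; apply cond_pos).
  destruct (proj2 (is_lim_seq_spec _ _) H eps) as [N1 H1'].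
  destruct (proj2 (is_lim_seq_spec _ _) H2 (mkposreal _ Hp)) as [N2 H2'].
  exists (N1 + N2)%nat; intros n Hn.
  specialize (H1' n ltac:(lia)); specialize (H2' n ltac:(lia)); simpl in H2'.
  split; [exact H1'|].
  change (Rabs (Im (z n) - 0) < eps); rewrite Rminus_0_r.
  assert (H3 := Cmod_1_re_sqr _ (Hz n)).
  apply Rabs_def2 in H2'.
  apply Rsqr_incrst_0; [|apply Rabs_pos | left; apply cond_pos].
  rewrite <- Rsqr_abs; unfold Rsqr; lra.
Qed.

Lemma pw_lim (q : nat) (u : nat -> R) (x : R) :
  is_lim_seq u x -> is_lim_seq (fun n => pw (u n) q) (pw x q).
Proof.
  intros Hu; destruct q as [|q]; [apply is_lim_seq_const|]; unfold pw.
  apply (is_lim_seq_continuous (fun y => exp (- y * ln (INR (S q)))) u x); [|exact Hu].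
  apply continuity_pt_filterlim.
  apply (ex_derive_continuous (fun y => exp (- y * ln (INR (S q))))).
  auto_derive; trivial.
Qed.

Lemma lim_gt_eventually (u : nat -> R) (x y : R) : is_lim_seq u x -> y < x ->
  exists N, forall n, (N <= n)%nat -> y < u n.
Proof.
  intros Hu Hy; assert (Hd : 0 < x - y) by lra.
  destruct (proj2 (is_lim_seq_spec _ _) Hu (mkposreal _ Hd)) as [N HN]; simpl in HN.
  exists N; intros n Hn; specialize (HN n Hn); apply Rabs_def2 in HN; lra.
Qed.

Lemma Cmod_1_minus_sqr (a : R) (z : C) : Cmod z = 1 ->
  Cmod (1 - a * z) * Cmod (1 - a * z) = 1 - 2 * a * Re z + a * a.
Proof.
  intros Hz; rewrite Cmod_sqr.
  replace (Re (1 - a * z)) with (1 - a * Re z) by (simpl; unfold Re; ring).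
  replace (Im (1 - a * z)) with (- (a * Im z)) by (simpl; unfold Im; ring).
  generalize (Cmod_1_re_sqr _ Hz); intros H.
  replace (a * a) with (a * a * (Re z * Re z + Im z * Im z)) by (rewrite H; ring).
  ring.
Qed.

Lemma re_div_1_minus (a : R) (z : C) : 0 < a < 1 -> Cmod z = 1 ->
  Re (a * z / (1 - a * z)) = (a * Re z - a * a) / (1 - 2 * a * Re z + a * a).
Proof.
  intros Ha Hz.
  assert (Hb := Cmod_1_re_bounds z Hz).
  assert (H := Cmod_1_re_sqr _ Hz).
  unfold Cdiv, Cinv; rewrite re_mult; simpl.
  change (fst z) with (Re z); change (snd z) with (Im z).
  set (c := Re z) in *; set (d := Im z) in *.
  assert (Hn : 0 < 1 - 2 * a * c + a * a) by nra.
  replace ((1 + - (a * c - 0 * d)) * ((1 + - (a * c - 0 * d)) * 1) +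
    (0 + - (a * d + 0 * c)) * ((0 + - (a * d + 0 * c)) * 1))
    with (1 - 2 * a * c + a * a).
  - transitivity ((a * c - a * a * (c * c + d * d)) / (1 - 2 * a * c + a * a)).
    + field; lra.
    + rewrite H, Rmult_1_r; reflexivity.
  - replace (a * a) with (a * a * (c * c + d * d)) at 1 by (rewrite H; ring). ring.
Qed.

(** What remains after use are the conditions that limits of denominators are nonzero. *)
Ltac lim_arith :=
  repeat first
    [ eassumption | apply is_lim_seq_const | apply is_lim_seq_minus'
    | apply is_lim_seq_div' | apply is_lim_seq_plus' | apply is_lim_seq_mult' ].

Lemma lim_squeeze_below (u v : nat -> R) (x : R) :
  (exists N, forall n, (N <= n)%nat -> u n <= v n <= x) ->
  is_lim_seq u x -> is_lim_seq v x.
Proof.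
  intros H Hu; apply is_lim_seq_le_le_loc with (u := u) (w := fun _ => x);
    [exact H | exact Hu | apply is_lim_seq_const].
Qed.

Lemma lim_squeeze_above (u v : nat -> R) (x : R) :
  (exists N, forall n, (N <= n)%nat -> x <= v n <= u n) ->
  is_lim_seq u x -> is_lim_seq v x.
Proof.
  intros H Hu; apply is_lim_seq_le_le_loc with (u := fun _ => x) (w := u);
    [exact H | apply is_lim_seq_const | exact Hu].
Qed.

(** * Almost extremal zeros of the derivative *)

Lemma eterm_polar (s : C) (p : nat) : isprime p = true ->
  eterm s p = (ln (INR p) * (pw (Re s) p * unim (Im s) p
                             / (1 - pw (Re s) p * unim (Im s) p)))%C.
Proof. intros H; unfold eterm; rewrite H, <- dm_polar; reflexivity. Qed.

(** With a = 2^(-E) the left side of the equation for [E] is ln 2 times 2a/(1 - a^2). Subtracting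
    the term a/(1 - a) of the prime 2 leaves a/(1 + a). *)
Lemma is_E_rratio (zeta : C -> C) (E : R) : is_riemann_zeta zeta -> is_E zeta E ->
  rratio 2 E = ln 2 * (pw E 2 / (1 + pw E 2)).
Proof.
  intros Hz [HE H].
  rewrite zeta_C_derive, (zeta_DA zeta) in H by assumption.
  replace (- (- DB 1 E / DA 1 E))%C with (DB 1 E / DA 1 E)%C in H
    by (field; apply DA_neq_0; [lia | exact HE]).
  rewrite ratio_step, eterm_R, ratio_R, <- RtoC_plus in H by (assumption || simpl; lia || lra).
  apply RtoC_inj in H; unfold rterm in H; change (isprime 2) with true in H; cbv iota in H.
  assert (Ha0 := pw_pos E 2 ltac:(lia)); assert (Ha1 := pw_lt_1 E 2 ltac:(lra) ltac:(lia)).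
  assert (HI : INR 2 = 2) by (simpl; ring).
  assert (E1 : Rpower 2 (E + 1) = 2 / pw E 2).
  { unfold Rpower, pw; rewrite HI, Rmult_plus_distr_r, exp_plus, Rmult_1_l, exp_ln by lra.
    rewrite <- Ropp_mult_distr_l, exp_Ropp; field; apply Rgt_not_eq, exp_pos. }
  assert (E2 : Rpower 4 E = / (pw E 2 * pw E 2)).
  { unfold Rpower, pw; rewrite HI, <- exp_plus, <- exp_Ropp; f_equal.
    replace 4 with (2 * 2) by ring; rewrite ln_mult by lra; ring. }
  rewrite E1, E2, HI in H; set (a := pw E 2) in *.
  assert (Haa : 0 < 1 - a * a) by nra.
  assert (H' : rratio 2 E = 2 / a / (/ (a * a) - 1) * ln 2 - ln 2 * (a / (1 - a))) by lra.
  rewrite H'; field; repeat split; nra.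
Qed.

Lemma zeta'_zero_ratio (zeta : C -> C) (s : C) : is_riemann_zeta zeta -> 1 < Re s ->
  zeta'_zero zeta s -> (DB 2 s / DA 2 s)%C = (- eterm s 2)%C.
Proof.
  intros Hz Hs [_ H]; rewrite zeta_C_derive in H by assumption.
  assert (HB : DB 1 s = RtoC 0).
  { replace (DB 1 s) with (- - DB 1 s)%C by ring; rewrite H; ring. }
  assert (E := ratio_step 1 s (le_n 1) Hs); rewrite HB in E.
  transitivity ((eterm s 2 + DB 2 s / DA 2 s) - eterm s 2)%C; [ring|].
  rewrite <- E; unfold Cdiv; ring.
Qed.

(** The term at 2 equals minus the sum over the odd primes, so ln 2 x / |1 - x u| <= [rratio 2],
    where x = 2^(-Re rho) and u = 2^(-it). This bounds |1 - x u| from below, and |1 - x u|^2 = 1 - 2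
    x Re u + x^2 bounds [Re u] from above. *)
Lemma deriv_cos2_lim (zeta : C -> C) (E : R) (rho : nat -> C) :
  is_riemann_zeta zeta -> is_E zeta E -> almost_extremal_deriv zeta E rho ->
  is_lim_seq (fun n => Re (unim (Im (rho n)) 2)) (-1).
Proof.
  intros Hz HE [Hrho Hlim].
  assert (HE1 := proj1 HE).
  assert (HR := rratio_lim 2 _ _ ltac:(lia) HE1 Hlim); simpl in HR.
  assert (Ha := pw_lim 2 _ _ Hlim); simpl in Ha.
  rewrite (is_E_rratio zeta E Hz HE) in HR.
  change (is_lim_seq (fun n => pw (Re (rho n)) 2) (pw E 2)) in Ha.
  assert (Ha0 := pw_pos E 2 ltac:(lia)).
  assert (Hl2 : 0 < ln 2) by (rewrite <- ln_1; apply ln_increasing; lra).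
  set (a := pw E 2) in *; set (r := ln 2 * (a / (1 + a))) in *.
  assert (Hr : 0 < r).
  { unfold r; apply Rmult_lt_0_compat; [exact Hl2 | apply Rdiv_lt_0_compat; lra]. }
  destruct (lim_gt_eventually _ _ 1 Hlim HE1) as [N1 HN1].
  destruct (lim_gt_eventually _ _ 0 HR Hr) as [N2 HN2].
  apply lim_squeeze_above with (u := fun n =>
    (1 + pw (Re (rho n)) 2 * pw (Re (rho n)) 2
     - (ln 2 * pw (Re (rho n)) 2 / rratio 2 (Re (rho n)))
       * (ln 2 * pw (Re (rho n)) 2 / rratio 2 (Re (rho n))))
    / (2 * pw (Re (rho n)) 2)).
  - exists (N1 + N2)%nat; intros n Hn.
    specialize (HN1 n ltac:(lia)); specialize (HN2 n ltac:(lia)).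
    assert (Hu := Cmod_unim (Im (rho n)) 2 ltac:(lia)).
    split; [apply (Cmod_1_re_bounds _ Hu)|].
    assert (Hb := Cmod_ratio_le 2 3 (rho n) ltac:(lia) HN1).
    rewrite (zeta'_zero_ratio zeta) in Hb by auto.
    rewrite Cmod_opp, eterm_polar in Hb by reflexivity.
    assert (Hx0 := pw_pos (Re (rho n)) 2 ltac:(lia)).
    assert (Hnz : (1 - pw (Re (rho n)) 2 * unim (Im (rho n)) 2)%C <> RtoC 0).
    { rewrite <- dm_polar; apply one_minus_dm_neq_0; [lra | lia]. }
    assert (Hsq := Cmod_1_minus_sqr (pw (Re (rho n)) 2) _ Hu).
    rewrite Cmod_mult, Cmod_div, Cmod_mult, !Cmod_R, Hu, Rmult_1_r in Hb by exact Hnz.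
    replace (INR 2) with 2 in Hb by (simpl; ring).
    rewrite !Rabs_pos_eq in Hb by lra.
    assert (Hp : 0 < Cmod (1 - pw (Re (rho n)) 2 * unim (Im (rho n)) 2))
      by now apply Cmod_gt_0.
    set (x := pw (Re (rho n)) 2) in *; set (m := Cmod (1 - x * unim (Im (rho n)) 2)) in *.
    set (c := Re (unim (Im (rho n)) 2)) in *; set (R0 := rratio 2 (Re (rho n))) in *.
    assert (Hm : ln 2 * x / R0 <= m).
    { apply Rmult_le_reg_r with R0; [exact HN2|].
      unfold Rdiv; rewrite Rmult_assoc, Rinv_l by lra.
      apply Rmult_le_compat_r with (r := m) in Hb; [|lra].
      unfold Rdiv in Hb; replace (ln 2 * (x * / m) * m) with (ln 2 * x) in Hb by (field; lra).
      lra. }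
    assert (H0 : 0 <= ln 2 * x / R0).
    { apply Rlt_le, Rdiv_lt_0_compat; [apply Rmult_lt_0_compat|]; assumption. }
    apply Rmult_le_reg_r with (2 * x); [lra|].
    unfold Rdiv at 1; rewrite Rmult_assoc, Rinv_l by lra.
    nra.
  (* At the limit ln 2 a / r = 1 + a, and (1 + a^2 - (1 + a)^2) / (2a) = -1. *)
  - replace (Finite (-1)) with (Finite ((1 + a * a - (ln 2 * a / r) * (ln 2 * a / r)) / (2 * a))).
    + lim_arith; lra.
    + apply (f_equal Finite); unfold r; field; repeat split; nra.
Qed.

(** With the prime [q] isolated, real parts bound the term at [q] from below by its value at the
    real point plus an error. The error vanishes in the limit, because the term at 2 then cancels
    [rratio 2] exactly. *)
Lemma deriv_cos_lim (zeta : C -> C) (E : R) (rho : nat -> C) (q : nat) :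
  is_riemann_zeta zeta -> is_E zeta E -> almost_extremal_deriv zeta E rho ->
  isprime q = true -> q <> 2%nat ->
  is_lim_seq (fun n => Re (unim (Im (rho n)) q)) 1.
Proof.
  intros Hz HE Hrho Hq Hq2.
  assert (Hc := deriv_cos2_lim zeta E rho Hz HE Hrho).
  destruct Hrho as [Hrho Hlim].
  assert (Hq3 : (3 <= q)%nat) by (apply isprime_spec in Hq; lia).
  assert (HE1 := proj1 HE).
  assert (HR := rratio_lim 2 _ _ ltac:(lia) HE1 Hlim).
  assert (Ha := pw_lim 2 _ _ Hlim).
  assert (Hb := pw_lim q _ _ Hlim).
  rewrite (is_E_rratio zeta E Hz HE) in HR.
  assert (Ha0 := pw_pos E 2 ltac:(lia)).
  assert (Hb0 := pw_pos E q ltac:(lia)).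
  assert (Hb1 := pw_lt_1 E q ltac:(lra) ltac:(lia)).
  assert (Hlq := lnN_gt_0 q ltac:(lia)).
  set (a := pw E 2) in *; set (b := pw E q) in *.
  (* [m n] is the resulting lower bound for Re(y v / (1 - y v)), where y = q^(-Re rho) and v =
     q^(-it). *)
  set (m := fun n => (- (ln 2 * ((pw (Re (rho n)) 2 * Re (unim (Im (rho n)) 2)
      - pw (Re (rho n)) 2 * pw (Re (rho n)) 2)
      / (1 - 2 * pw (Re (rho n)) 2 * Re (unim (Im (rho n)) 2)
         + pw (Re (rho n)) 2 * pw (Re (rho n)) 2)))
      - rratio 2 (Re (rho n))) / ln (INR q)
      + pw (Re (rho n)) q / (1 - pw (Re (rho n)) q)).
  assert (Hm : is_lim_seq m (b / (1 - b))).
  { replace (Finite (b / (1 - b))) with (Finite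
      ((-1 * (ln 2 * ((a * -1 - a * a) / (1 - 2 * a * -1 + a * a))) - ln 2 * (a / (1 + a)))
       / ln (INR q) + b / (1 - b))).
    (* The negation becomes a product with -1, because [lim_arith] has no rule for opposites. *)
    - apply is_lim_seq_ext with (fun n => (-1 * (ln 2 * ((pw (Re (rho n)) 2 * Re (unim (Im (rho n)) 2)
      - pw (Re (rho n)) 2 * pw (Re (rho n)) 2)
      / (1 - 2 * pw (Re (rho n)) 2 * Re (unim (Im (rho n)) 2)
         + pw (Re (rho n)) 2 * pw (Re (rho n)) 2)))
      - rratio 2 (Re (rho n))) / ln (INR q)
      + pw (Re (rho n)) q / (1 - pw (Re (rho n)) q)).
      + intros n; unfold m; do 3 f_equal; ring.
      + lim_arith; nra.
    - apply (f_equal Finite); field; repeat split; nra. }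
  destruct (lim_gt_eventually _ _ 1 Hlim HE1) as [N1 HN1].
  assert (Hm0 : 0 < b / (1 - b)) by (apply Rdiv_lt_0_compat; lra).
  destruct (lim_gt_eventually _ _ 0 Hm Hm0) as [N2 HN2].
  (* The lower bound solves m (1 - 2 y d + y^2) <= y d - y^2 for the cosine d. Positivity of [m n]
     makes the coefficient y + 2 y m of d positive. *)
  apply lim_squeeze_below with (u := fun n =>
    (m n * (1 + pw (Re (rho n)) q * pw (Re (rho n)) q) + pw (Re (rho n)) q * pw (Re (rho n)) q)
    / (pw (Re (rho n)) q + 2 * pw (Re (rho n)) q * m n)).
  - exists (N1 + N2)%nat; intros n Hn.
    specialize (HN1 n ltac:(lia)); specialize (HN2 n ltac:(lia)).
    assert (Hu := Cmod_unim (Im (rho n)) 2 ltac:(lia)).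
    assert (Hv := Cmod_unim (Im (rho n)) q ltac:(lia)).
    split; [|apply (Cmod_1_re_bounds _ Hv)].
    assert (H := ratio_minus_eterm_le 2 q (rho n) ltac:(lia) HN1).
    rewrite (zeta'_zero_ratio zeta) in H by auto.
    apply (Rle_trans _ _ _ (re_le_mod _)) in H.
    rewrite !eterm_polar in H by (reflexivity || assumption).
    unfold Cminus in H at 1; rewrite re_plus in H.
    match type of H with Re (- ?z) + Re (- ?w) <= _ =>
      change (- Re z + - Re w <= rratio 2 (Re (rho n)) - rterm (Re (rho n)) q) in H end.
    assert (Hx0 := pw_pos (Re (rho n)) 2 ltac:(lia)).
    assert (Hx1 := pw_lt_1 (Re (rho n)) 2 ltac:(lra) ltac:(lia)).
    assert (Hy0 := pw_pos (Re (rho n)) q ltac:(lia)).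
    assert (Hy1 := pw_lt_1 (Re (rho n)) q ltac:(lra) ltac:(lia)).
    rewrite !re_scal_l, !re_div_1_minus in H by auto.
    unfold rterm in H; rewrite Hq in H.
    replace (INR 2) with 2 in H by (simpl; ring).
    assert (Hv' := Cmod_1_re_bounds _ Hv).
    set (y := pw (Re (rho n)) q) in *; set (d := Re (unim (Im (rho n)) q)) in *.
    set (g := (y * d - y * y) / (1 - 2 * y * d + y * y)) in *.
    set (v := (pw (Re (rho n)) 2 * Re (unim (Im (rho n)) 2)
        - pw (Re (rho n)) 2 * pw (Re (rho n)) 2)
        / (1 - 2 * pw (Re (rho n)) 2 * Re (unim (Im (rho n)) 2)
           + pw (Re (rho n)) 2 * pw (Re (rho n)) 2)) in *.
    assert (Hg : m n <= g).
    { apply Rmult_le_reg_l with (ln (INR q)); [exact Hlq|].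
      unfold m; fold y v.
      replace (ln (INR q) * ((- (ln 2 * v) - rratio 2 (Re (rho n))) / ln (INR q) + y / (1 - y)))
        with (- (ln 2 * v) - rratio 2 (Re (rho n)) + ln (INR q) * (y / (1 - y)))
        by (field; split; lra).
      lra. }
    assert (Hden : 0 < 1 - 2 * y * d + y * y) by nra.
    assert (Hg' : m n * (1 - 2 * y * d + y * y) <= y * d - y * y).
    { replace (y * d - y * y) with (g * (1 - 2 * y * d + y * y)) by (unfold g; field; lra).
      apply Rmult_le_compat_r; lra. }
    assert (Hden' : 0 < y + 2 * y * m n) by nra.
    apply Rmult_le_reg_r with (y + 2 * y * m n); [exact Hden'|].
    unfold Rdiv; rewrite Rmult_assoc, Rinv_l by lra; lra.
  - replace (Finite 1) with (Finite ((b / (1 - b) * (1 + b * b) + b * b)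
      / (b + 2 * b * (b / (1 - b))))).
    + lim_arith.
      assert (0 < 2 * b * (b / (1 - b))) by (apply Rmult_lt_0_compat; [lra | exact Hm0]). lra.
    + apply (f_equal Finite); field; split; nra.
Qed.

Lemma limit_relations_of_cos (t : nat -> R) :
  is_lim_seq (fun n => Re (unim (t n) 2)) (-1) ->
  (forall p, prime (Z.of_nat p) -> p <> 2%nat ->
     is_lim_seq (fun n => Re (unim (t n) p)) 1) ->
  limit_relations t.
Proof.
  intros H2 Hp; split.
  - apply filterlim_ext with (fun n => unim (t n) 2).
    + intros n; rewrite <- unim_cpow by lia; f_equal; simpl; ring.
    + apply unit_re_lim; [intros n; apply Cmod_unim; lia | ring | exact H2].
  - intros p Hpp Hp2; assert (H := prime_ge_2 _ Hpp).
    apply filterlim_ext with (fun n => unim (t n) p).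
    + intros n; rewrite <- unim_cpow by lia; reflexivity.
    + apply unit_re_lim; [intros n; apply Cmod_unim; lia | ring | now apply Hp].
Qed.

Lemma almost_extremal_deriv_limits (zeta : C -> C) (E : R) (rho : nat -> C) :
  is_riemann_zeta zeta -> is_E zeta E -> almost_extremal_deriv zeta E rho ->
  limit_relations (fun n => Im (rho n)).
Proof.
  intros Hz HE Hrho; apply limit_relations_of_cos.
  - now apply deriv_cos2_lim with zeta E.
  - intros p Hp Hp2; apply deriv_cos_lim with zeta E; auto using prime_isprime.
Qed.

(** * Simultaneous approximation of the signs *)

(** The number of trailing binary zeros is the 2-adic valuation; only its parity is recorded. *)
Fixpoint odd_val2 (p : positive) : bool :=
  match p with xO p => negb (odd_val2 p) | _ => false end.

(* The completely multiplicative function with value -1 at 2 and 1 at odd primes. *)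
Definition sgn2 (n : nat) : R := if odd_val2 (Pos.of_nat n) then -1 else 1.

Lemma odd_val2_mul (p q : positive) :
  odd_val2 (p * q) = xorb (odd_val2 p) (odd_val2 q).
Proof.
  induction p as [p _ | p IH |].
  - induction q as [q _ | q IH |]; [reflexivity | | now rewrite Pos.mul_1_r].
    rewrite Pos.mul_xO_r.
    change (negb (odd_val2 (p~1 * q)) = xorb (odd_val2 p~1) (negb (odd_val2 q))).
    rewrite IH; simpl; now destruct (odd_val2 q).
  - simpl; rewrite IH; now destruct (odd_val2 p), (odd_val2 q).
  - simpl; now destruct (odd_val2 q).
Qed.

Lemma sgn2_mult (m n : nat) : (0 < m)%nat -> (0 < n)%nat ->
  sgn2 (m * n) = sgn2 m * sgn2 n.
Proof.
  intros Hm Hn; unfold sgn2; rewrite Nat2Pos.inj_mul, odd_val2_mul by lia.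
  destruct (odd_val2 (Pos.of_nat m)), (odd_val2 (Pos.of_nat n)); simpl; ring.
Qed.

Lemma sgn2_sqr (n : nat) : sgn2 n * sgn2 n = 1.
Proof. unfold sgn2; destruct (odd_val2 _); ring. Qed.

Lemma sgn2_odd (k : nat) : sgn2 (2 * k + 1) = 1.
Proof.
  unfold sgn2; destruct k as [|k]; [reflexivity|].
  replace (Pos.of_nat (2 * S k + 1)) with (xI (Pos.of_nat (S k))); [reflexivity|].
  apply Pos2Nat.inj; rewrite Pos2Nat.inj_xI, !Nat2Pos.id by lia; lia.
Qed.

Definition lsum (f : nat -> C) (l : list nat) : C :=
  fold_right (fun n z => (f n + z)%C) (RtoC 0) l.

Definition rlsum {A : Type} (f : A -> R) (l : list A) : R :=
  fold_right (fun n z => f n + z) 0 l.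

Lemma lsum_app (f : nat -> C) (l l' : list nat) :
  lsum f (l ++ l') = (lsum f l + lsum f l')%C.
Proof. induction l as [|x l IH]; simpl; [|rewrite IH]; ring. Qed.

Lemma rlsum_cons {A : Type} (f : A -> R) (x : A) (l : list A) :
  rlsum f (x :: l) = f x + rlsum f l.
Proof. reflexivity. Qed.

Lemma rlsum_app {A : Type} (f : A -> R) (l l' : list A) :
  rlsum f (l ++ l') = rlsum f l + rlsum f l'.
Proof. induction l as [|x l IH]; simpl; [|rewrite IH]; ring. Qed.

Lemma rlsum_ext_in {A : Type} (f g : A -> R) (l : list A) :
  (forall x, In x l -> f x = g x) -> rlsum f l = rlsum g l.
Proof.
  induction l as [|x l IH]; intros H; [reflexivity|]; simpl.
  rewrite (H x), IH; [reflexivity | intros y Hy; apply H; now right | now left].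
Qed.

Lemma rlsum_plus {A : Type} (f g : A -> R) (l : list A) :
  rlsum (fun x => f x + g x) l = rlsum f l + rlsum g l.
Proof. induction l as [|x l IH]; simpl; [|rewrite IH]; ring. Qed.

Lemma rlsum_scal {A : Type} (k : R) (f : A -> R) (l : list A) :
  rlsum (fun x => k * f x) l = k * rlsum f l.
Proof. induction l as [|x l IH]; simpl; [|rewrite IH]; ring. Qed.

Lemma rlsum_map {A B : Type} (g : A -> B) (f : B -> R) (l : list A) :
  rlsum f (map g l) = rlsum (fun x => f (g x)) l.
Proof. induction l as [|x l IH]; simpl; [|rewrite IH]; reflexivity. Qed.

Lemma rlsum_list_prod {A B : Type} (f : A * B -> R) (l : list A) (l' : list B) :
  rlsum f (list_prod l l') = rlsum (fun x => rlsum (fun y => f (x, y)) l') l.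
Proof.
  induction l as [|x l IH]; simpl; [reflexivity|].
  now rewrite rlsum_app, rlsum_map, IH.
Qed.

(** Repetitions are kept on purpose: the multiplicity of a value is its coefficient in the k-th
    power of the Dirichlet polynomial. *)
Fixpoint prods (N k : nat) : list nat :=
  match k with
  | O => 1%nat :: nil
  | S k => flat_map (fun n => map (Nat.mul n) (prods N k)) (seq 1 N)
  end.

Lemma in_prods_pos (N k x : nat) : In x (prods N k) -> (0 < x)%nat.
Proof.
  revert x; induction k as [|k IH]; simpl; intros x Hx; [lia|].
  apply in_flat_map in Hx; destruct Hx as [n [Hn Hx]].
  apply in_map_iff in Hx; destruct Hx as [y [<- Hy]].
  apply in_seq in Hn; apply IH in Hy; nia.
Qed.

Lemma length_prods (N k : nat) : length (prods N k) = (N ^ k)%nat.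
Proof.
  induction k as [|k IH]; [reflexivity|]; simpl.
  rewrite flat_map_constant_length with (c := (N ^ k)%nat).
  - now rewrite length_seq.
  - intros n _; now rewrite length_map, IH.
Qed.

Lemma lsum_prods (f : nat -> C) (N k : nat) : f 1%nat = RtoC 1 ->
  (forall m n, (0 < m)%nat -> (0 < n)%nat -> f (m * n)%nat = (f m * f n)%C) ->
  lsum f (prods N k) = (lsum f (seq 1 N) ^ k)%C.
Proof.
  intros H1 Hf; induction k as [|k IH]; simpl; [rewrite H1; ring|].
  rewrite <- IH.
  assert (H : forall l, (forall n, In n l -> (0 < n)%nat) ->
    lsum f (flat_map (fun n => map (Nat.mul n) (prods N k)) l)
    = (lsum f l * lsum f (prods N k))%C).
  { intros l; induction l as [|n l IHl]; intros Hl; simpl; [ring|].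
    rewrite lsum_app, IHl by (intros m Hm; apply Hl; now right).
    replace (lsum f (map (Nat.mul n) (prods N k))) with (f n * lsum f (prods N k))%C;
      [ring|].
    assert (Hn : (0 < n)%nat) by (apply Hl; now left).
    generalize (in_prods_pos N k); generalize (prods N k).
    intros l'; induction l' as [|x l' IHl']; intros Hl'; simpl; [ring|].
    rewrite <- IHl' by (intros y Hy; apply Hl'; now right).
    rewrite Hf; [ring | exact Hn | apply Hl'; now left]. }
  apply H; intros n Hn; apply in_seq in Hn; lia.
Qed.

(* A product of [k] factors in [1..N] is determined by the multiplicity of each factor,
   so there are at most [(k + 1) ^ N] values. *)
Fixpoint prodval (N : nat) (e : nat -> nat) : nat :=
  match N with O => 1%nat | S N => (S N ^ e (S N) * prodval N e)%nat end.

Fixpoint prodvals (N k : nat) : list nat :=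
  match N with
  | O => 1%nat :: nil
  | S N => flat_map (fun e => map (Nat.mul (S N ^ e)) (prodvals N k)) (seq 0 (S k))
  end.

Lemma length_prodvals (N k : nat) : length (prodvals N k) = (S k ^ N)%nat.
Proof.
  induction N as [|N IH]; [reflexivity|].
  change (length (flat_map (fun e => map (Nat.mul (S N ^ e)) (prodvals N k)) (seq 0 (S k)))
    = (S k * S k ^ N)%nat).
  rewrite flat_map_constant_length with (c := (S k ^ N)%nat).
  - now rewrite length_seq.
  - intros n _; now rewrite length_map, IH.
Qed.

Lemma in_prodvals (N k : nat) (e : nat -> nat) :
  (forall n, (e n <= k)%nat) -> In (prodval N e) (prodvals N k).
Proof.
  intros He; induction N as [|N IH]; [now left|].
  apply in_flat_map; exists (e (S N)); split.
  - apply in_seq; specialize (He (S N)); lia.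
  - exact (in_map (Nat.mul (S N ^ e (S N))) _ _ IH).
Qed.

Lemma prodval_incr (N : nat) (e : nat -> nat) (n : nat) : (1 <= n <= N)%nat ->
  prodval N (fun m => if Nat.eqb m n then S (e m) else e m) = (n * prodval N e)%nat.
Proof.
  assert (Hlt : forall N, (N < n)%nat ->
    prodval N (fun m => if Nat.eqb m n then S (e m) else e m) = prodval N e).
  { intros M; induction M as [|M IH]; intros HM; [reflexivity|].
    cbn [prodval]; rewrite IH by lia; destruct (Nat.eqb_spec (S M) n); [lia | reflexivity]. }
  induction N as [|N IH]; intros Hn; [lia|]; cbn [prodval].
  destruct (Nat.eqb_spec (S N) n) as [E | E].
  - rewrite Hlt by lia; rewrite <- E, Nat.pow_succ_r'; lia.
  - rewrite IH by lia; lia.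
Qed.

Lemma in_prods_prodval (N k x : nat) : In x (prods N k) ->
  exists e, (forall n, (e n <= k)%nat) /\ x = prodval N e.
Proof.
  revert x; induction k as [|k IH]; simpl; intros x Hx.
  - destruct Hx as [<- | []]; exists (fun _ => 0%nat); split; [lia|].
    induction N as [|N IHN]; [reflexivity|]; cbn [prodval]; rewrite <- IHN; reflexivity.
  - apply in_flat_map in Hx; destruct Hx as [n [Hn Hx]].
    apply in_map_iff in Hx; destruct Hx as [y [<- Hy]].
    destruct (IH y Hy) as [e [He ->]]; apply in_seq in Hn.
    exists (fun m => if Nat.eqb m n then S (e m) else e m); split.
    + intros m; specialize (He m); destruct (Nat.eqb m n); lia.
    + symmetry; apply prodval_incr; lia.
Qed.

(** A nonzero frequency integrates to a bounded sine; the zero frequencies form the constant that is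
    subtracted. *)
Lemma cos_sum_primitive (l : list (R * R)) :
  exists (G : R -> R) (K : R), (forall t, Rabs (G t) <= K) /\
    forall t, is_derive G t (rlsum (fun cl => fst cl * cos (snd cl * t)) l
      - rlsum (fun cl => if Req_EM_T (snd cl) 0 then fst cl else 0) l).
Proof.
  induction l as [|[c lam] l [G [K [HK HG]]]]; simpl.
  - exists (fun _ => 0), 0; split; [intros t; rewrite Rabs_R0; lra|].
    intros t; rewrite Rminus_0_r; apply @is_derive_const.
  - destruct (Req_EM_T lam 0) as [-> | Hlam].
    + exists G, K; split; [exact HK|]; intros t.
      rewrite Rmult_0_l, cos_0, Rmult_1_r.
      replace (c + rlsum (fun cl => fst cl * cos (snd cl * t)) l -
        (c + rlsum (fun cl => if Req_EM_T (snd cl) 0 then fst cl else 0) l))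
        with (rlsum (fun cl => fst cl * cos (snd cl * t)) l
          - rlsum (fun cl => if Req_EM_T (snd cl) 0 then fst cl else 0) l) by ring.
      apply HG.
    + exists (fun t => c / lam * sin (lam * t) + G t), (Rabs (c / lam) + K); split.
      * intros t; apply Rle_trans with (1 := Rabs_triang _ _).
        apply Rplus_le_compat; [|apply HK]; rewrite Rabs_mult.
        rewrite <- Rmult_1_r; apply Rmult_le_compat_l; [apply Rabs_pos|].
        apply Rabs_le, SIN_bound.
      * intros t.
        replace (c * cos (lam * t) + rlsum (fun cl => fst cl * cos (snd cl * t)) l -
          (0 + rlsum (fun cl => if Req_EM_T (snd cl) 0 then fst cl else 0) l))
          with (c * cos (lam * t) + (rlsum (fun cl => fst cl * cos (snd cl * t)) l
          - rlsum (fun cl => if Req_EM_T (snd cl) 0 then fst cl else 0) l)) by ring.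
        apply (is_derive_plus (fun t => c / lam * sin (lam * t)) G); [|apply HG].
        auto_derive; [trivial | field; exact Hlam].
Qed.

(** The constant part is the mean value of the sum. If it exceeded [M], the bounded primitive would
    decrease at a uniform positive rate. *)
Lemma cos_sum_mean_le (l : list (R * R)) (M : R) :
  (forall t, rlsum (fun cl => fst cl * cos (snd cl * t)) l <= M) ->
  rlsum (fun cl => if Req_EM_T (snd cl) 0 then fst cl else 0) l <= M.
Proof.
  intros HM; destruct (cos_sum_primitive l) as [G [K [HK HG]]].
  set (a := rlsum (fun cl => if Req_EM_T (snd cl) 0 then fst cl else 0) l) in *.
  destruct (Rle_lt_dec a M) as [H | H]; [exact H | exfalso].
  assert (HK0 : 0 <= K) by (apply Rle_trans with (2 := HK 0), Rabs_pos).
  (* Over this length the primitive would fall by at least 2K + 1, more than its possible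
     oscillation 2K. *)
  set (T := (2 * K + 1) / (a - M)).
  assert (HT : 0 < T) by (apply Rdiv_lt_0_compat; lra).
  destruct (MVT_gen G 0 T (fun t => rlsum (fun cl => fst cl * cos (snd cl * t)) l - a))
    as [c [_ Hc]].
  - intros x _; apply HG.
  - intros x _; apply continuity_pt_filterlim, (ex_derive_continuous G).
    eexists; apply HG.
  - rewrite Rminus_0_r in Hc.
    assert (H1 := HK 0); assert (H2 := HK T).
    apply Rabs_le_between in H1; apply Rabs_le_between in H2.
    assert (H3 : (a - M) * T = 2 * K + 1) by (unfold T; field; lra).
    specialize (HM c); nra.
Qed.

Definition sunim (t : R) (n : nat) : C := (RtoC (sgn2 n) * unim t n)%C.

Lemma unim_cos_sin (t : R) (n : nat) : (0 < n)%nat ->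
  unim t n = (cos (t * ln (INR n)), - sin (t * ln (INR n))).
Proof.
  intros Hn; destruct n as [|n]; [lia|]; unfold unim, dm, Cexp.
  set (l := ln (INR (S n))).
  replace (- (Ci * t) * l)%C with (0, - (t * l)) by (apply C_eq; simpl; ring).
  simpl; rewrite exp_0, cos_neg, sin_neg; apply C_eq; simpl; ring.
Qed.

Lemma re_lsum (f : nat -> C) (l : list nat) :
  Re (lsum f l) = rlsum (fun n => Re (f n)) l.
Proof. induction l as [|x l IH]; simpl; [reflexivity | now rewrite <- IH]. Qed.

Lemma im_lsum (f : nat -> C) (l : list nat) :
  Im (lsum f l) = rlsum (fun n => Im (f n)) l.
Proof. induction l as [|x l IH]; simpl; [reflexivity | now rewrite <- IH]. Qed.

Lemma rlsum_mult {A B : Type} (f : A -> R) (g : B -> R) (l : list A) (l' : list B) :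
  rlsum f l * rlsum g l' = rlsum (fun x => rlsum (fun y => f x * g y) l') l.
Proof.
  rewrite Rmult_comm, <- rlsum_scal; apply rlsum_ext_in; intros x _.
  rewrite rlsum_scal; ring.
Qed.

Lemma Cmod_sqr_lsum_sunim (t : R) (l : list nat) : (forall n, In n l -> (0 < n)%nat) ->
  Cmod (lsum (sunim t) l) * Cmod (lsum (sunim t) l)
  = rlsum (fun cl => fst cl * cos (snd cl * t))
      (map (fun xy => (sgn2 (fst xy) * sgn2 (snd xy), ln (INR (fst xy)) - ln (INR (snd xy))))
         (list_prod l l)).
Proof.
  intros Hl; rewrite Cmod_sqr, re_lsum, im_lsum, rlsum_map, rlsum_list_prod.
  rewrite !rlsum_mult, <- rlsum_plus; apply rlsum_ext_in; intros x Hx.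
  rewrite <- rlsum_plus; apply rlsum_ext_in; intros y Hy; simpl fst; simpl snd.
  unfold sunim; rewrite !unim_cos_sin by auto.
  replace ((ln (INR x) - ln (INR y)) * t) with (t * ln (INR x) - t * ln (INR y)) by ring.
  rewrite cos_minus, !re_scal_l, !im_scal_l; simpl; ring.
Qed.

Lemma rlsum_count (l V : list nat) (g : nat -> R) : NoDup V -> incl l V ->
  rlsum g l = rlsum (fun v => INR (count_occ Nat.eq_dec l v) * g v) V.
Proof.
  intros HV; induction l as [|x l IH]; intros Hl.
  - simpl; induction V as [|v V IHV]; simpl; [reflexivity|].
    inversion HV; subst; rewrite <- IHV; [ring | assumption | intros y []].
  - simpl rlsum at 1; rewrite IH by (intros y Hy; apply Hl; now right).
    assert (Hx : In x V) by (apply Hl; now left).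
    assert (H1 : g x = rlsum (fun v => (if Nat.eq_dec x v then 1 else 0) * g v) V).
    { clear -HV Hx; induction V as [|v V IHV]; [destruct Hx|]; simpl.
      inversion HV as [|? ? Hv HV']; subst.
      destruct (Nat.eq_dec x v) as [-> | Hne].
      - replace (rlsum (fun v0 => (if Nat.eq_dec v v0 then 1 else 0) * g v0) V) with 0;
          [ring|].
        clear -Hv; induction V as [|w V IH]; [reflexivity|]; simpl.
        rewrite <- IH by (intros H; apply Hv; now right).
        destruct (Nat.eq_dec v w) as [-> |]; [destruct Hv; now left | ring].
      - rewrite <- IHV; [ring | assumption | destruct Hx as [Hx | Hx]; [congruence | exact Hx]]. }
    rewrite H1, <- rlsum_plus; apply rlsum_ext_in; intros v _; simpl.
    destruct (Nat.eq_dec x v); rewrite ?S_INR; ring.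
Qed.

(** Cauchy-Schwarz against the constant 1. The induction step combines (n f(v) - a)^2 >= 0 with a^2
    <= n b, the case n = 0 being separate. *)
Lemma rlsum_cauchy (f : nat -> R) (V : list nat) :
  rlsum f V * rlsum f V <= INR (length V) * rlsum (fun v => f v * f v) V.
Proof.
  induction V as [|v V IH]; [simpl; lra|].
  change (length (v :: V)) with (S (length V)); rewrite S_INR; simpl rlsum.
  set (n := INR (length V)) in *; set (a := rlsum f V) in *.
  set (b := rlsum (fun v => f v * f v) V) in *.
  assert (Hn : 0 <= n) by apply pos_INR.
  assert (H : 2 * f v * a <= n * (f v * f v) + b).
  { destruct (Req_dec n 0) as [E | E].
    - rewrite E in IH; assert (a = 0) by nra.
      assert (Hb : 0 <= b).
      { unfold b; clear; induction V as [|w V IH]; simpl; [lra | nra]. }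
      rewrite H, E; lra.
    - assert (0 <= (n * f v - a) * (n * f v - a)) by apply Rle_0_sqr.
      assert (0 < n) by lra. nra. }
  nra.
Qed.

(** The sum on the right counts pairs of equal entries, that is, the squared multiplicities of the
    distinct values; Cauchy-Schwarz over these values gives the bound. *)
Lemma length_sqr_le (l V : list nat) : incl l V ->
  INR (length l) * INR (length l)
  <= INR (length V) * rlsum (fun x => INR (count_occ Nat.eq_dec l x)) l.
Proof.
  (* [V] may repeat values, as [prodvals] does, so the sums run over the distinct entries of [l]. *)
  intros Hl; set (W := nodup Nat.eq_dec l).
  assert (HW : NoDup W) by apply NoDup_nodup.
  assert (HlW : incl l W) by (intros x Hx; now apply nodup_In).
  assert (H1 : INR (length l) = rlsum (fun v => INR (count_occ Nat.eq_dec l v)) W).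
  { transitivity (rlsum (fun _ => 1) l).
    - clear; induction l as [|x l IH]; [reflexivity|].
      change (length (x :: l)) with (S (length l)); rewrite S_INR, IH; simpl; ring.
    - rewrite (rlsum_count l W) by assumption; apply rlsum_ext_in; intros; ring. }
  rewrite (rlsum_count l W (fun x => INR (count_occ Nat.eq_dec l x))) by assumption.
  rewrite H1; apply Rle_trans with (1 := rlsum_cauchy _ W).
  apply Rmult_le_compat_r.
  - clear; induction W as [|w W IH]; simpl; [lra|].
    generalize (pos_INR (count_occ Nat.eq_dec l w)); nra.
  - apply le_INR, NoDup_incl_length; [exact HW|].
    intros x Hx; apply nodup_In in Hx; now apply Hl.
Qed.

(** Injectivity of [ln] on positive integers leaves only the pairs x = y, and there the sign is a
    square, so the choice of signs does not affect the mean. *)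
Lemma rlsum_diag (l : list nat) : (forall n, In n l -> (0 < n)%nat) ->
  rlsum (fun cl => if Req_EM_T (snd cl) 0 then fst cl else 0)
    (map (fun xy => (sgn2 (fst xy) * sgn2 (snd xy), ln (INR (fst xy)) - ln (INR (snd xy))))
       (list_prod l l))
  = rlsum (fun x => INR (count_occ Nat.eq_dec l x)) l.
Proof.
  intros Hl; rewrite rlsum_map, rlsum_list_prod; apply rlsum_ext_in; intros x Hx.
  assert (Hx0 := Hl x Hx); clear Hx; cbn [fst snd].
  induction l as [|y l IH]; [reflexivity|].
  rewrite rlsum_cons, IH by (intros n Hn; apply Hl; now right); simpl count_occ.
  assert (Hy0 : (0 < y)%nat) by (apply Hl; now left).
  destruct (Req_EM_T (ln (INR x) - ln (INR y)) 0) as [E | E], (Nat.eq_dec y x) as [E' | E'].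
  - subst y; rewrite sgn2_sqr, S_INR; ring.
  - destruct E'; symmetry; apply INR_eq, ln_inv; try (apply lt_0_INR; assumption); lra.
  - subst y; destruct E; ring.
  - ring.
Qed.

(** With k + 1 = m^2, the bound ln m <= m - 1 makes N ln(k + 1) at most linear in m, while k ln r is
    quadratic. *)
Lemma pow_dominates_poly (r : R) (N : nat) : 1 < r -> exists k, INR (S k) ^ N < r ^ k.
Proof.
  intros Hr; assert (Hl : 0 < ln r) by (rewrite <- ln_1; apply ln_increasing; lra).
  destruct (INR_unbounded (2 * INR N / ln r + 2)) as [m Hm].
  assert (HN := pos_INR N).
  assert (H0 : 0 <= 2 * INR N / ln r)
    by (apply Rmult_le_pos; [lra | left; now apply Rinv_0_lt_compat]).
  assert (Hm1 : 1 < INR m) by lra.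
  assert (Hmm : (0 < m * m)%nat) by (destruct m; [simpl in Hm1; lra | lia]).
  exists (m * m - 1)%nat.
  replace (S (m * m - 1)) with (m * m)%nat by lia.
  rewrite <- (exp_ln (r ^ (m * m - 1))), ln_pow by (try apply pow_lt; lra).
  rewrite <- (exp_ln (INR (m * m) ^ N)), ln_pow
    by (try apply pow_lt; try (apply lt_0_INR; assumption)).
  apply exp_increasing; rewrite minus_INR by lia; rewrite mult_INR, ln_mult by lra.
  assert (Hlm : ln (INR m) <= INR m - 1).
  { generalize (exp_ineq1_le (ln (INR m))); rewrite exp_ln by lra; lra. }
  assert (E : 2 * INR N = 2 * INR N / ln r * ln r) by (field; lra).
  set (w := 2 * INR N / ln r) in *; simpl (INR 1).
  assert (INR N * (ln (INR m) + ln (INR m)) <= w * ln r * (INR m - 1)) by nra.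
  assert (w * (INR m - 1) < INR m * INR m - 1) by nra.
  nra.
Qed.

Lemma sunim_1 (t : R) : sunim t 1 = RtoC 1.
Proof.
  unfold sunim, unim; rewrite dm_1; change (sgn2 1) with 1; ring.
Qed.

Lemma sunim_mult (t : R) (m n : nat) : (0 < m)%nat -> (0 < n)%nat ->
  sunim t (m * n) = (sunim t m * sunim t n)%C.
Proof.
  intros Hm Hn; unfold sunim, unim.
  rewrite sgn2_mult, dm_mult, RtoC_mult by assumption; ring.
Qed.

Lemma Cmod_sunim (t : R) (n : nat) : (0 < n)%nat -> Cmod (sunim t n) = 1.
Proof.
  intros Hn; unfold sunim; rewrite Cmod_mult, Cmod_unim, Cmod_R, Rmult_1_r by exact Hn.
  unfold sgn2; destruct (odd_val2 _); [rewrite Rabs_left | rewrite Rabs_right]; lra.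
Qed.

(* The mean value of [|P^k|^2] is the number of coincidences among [N^k] products taking
   at most [(k+1)^N] values, so it cannot be bounded by [M^(2k)]. *)
Lemma lsum_sunim_sup (N : nat) (M : R) : M < INR N ->
  exists t, M < Cmod (lsum (sunim t) (seq 1 N)).
Proof.
  intros HM; apply NNPP; intros Hno.
  assert (Hall : forall t, Cmod (lsum (sunim t) (seq 1 N)) <= M).
  { intros t; destruct (Rle_lt_dec (Cmod (lsum (sunim t) (seq 1 N))) M) as [H | H];
      [exact H | destruct Hno; now exists t]. }
  assert (HM0 : 0 <= M) by (apply Rle_trans with (2 := Hall 0), Cmod_ge_0).
  assert (Hk : forall k, (INR N ^ k) * (INR N ^ k) <= INR (S k) ^ N * (M ^ k * M ^ k)).
  { intros k.
    assert (H := length_sqr_le (prods N k) (prodvals N k)).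
    rewrite length_prods, length_prodvals, !pow_INR in H.
    apply Rle_trans with (1 := H ltac:(intros x Hx;
      destruct (in_prods_prodval _ _ _ Hx) as [e [He ->]]; now apply in_prodvals)).
    apply Rmult_le_compat_l; [apply pow_le, pos_INR|].
    rewrite <- rlsum_diag by (apply in_prods_pos).
    apply cos_sum_mean_le; intros t.
    rewrite <- Cmod_sqr_lsum_sunim by (apply in_prods_pos).
    rewrite lsum_prods by (apply sunim_1 || (intros; now apply sunim_mult)).
    rewrite Cmod_pow.
    assert (Hp : Cmod (lsum (sunim t) (seq 1 N)) ^ k <= M ^ k)
      by (apply pow_incr; split; [apply Cmod_ge_0 | apply Hall]).
    assert (0 <= Cmod (lsum (sunim t) (seq 1 N)) ^ k) by (apply pow_le, Cmod_ge_0).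
    nra. }
  (* [M] may be 0; the midpoint is positive and still below [N], so N/M' is defined and exceeds
     1. *)
  set (M' := (M + INR N) / 2).
  assert (HM' : 0 < M' < INR N) by (unfold M'; lra).
  assert (HMM' : M <= M') by (unfold M'; lra).
  destruct (pow_dominates_poly ((INR N / M') * (INR N / M')) N) as [k Hk'].
  { assert (1 < INR N / M').
    { apply Rmult_lt_reg_r with M'; [lra|]; unfold Rdiv.
      rewrite Rmult_assoc, Rinv_l; lra. }
    nra. }
  specialize (Hk k).
  assert (Hp : M ^ k <= M' ^ k) by (apply pow_incr; lra).
  assert (Hp0 : 0 <= M ^ k) by (apply pow_le; lra).
  assert (Hp1 : 0 < M' ^ k) by (apply pow_lt; lra).
  assert (HS : 0 < INR (S k) ^ N) by (apply pow_lt, lt_0_INR; lia).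
  rewrite Rpow_mult_distr in Hk'.
  assert (E : INR N ^ k = (INR N / M') ^ k * M' ^ k)
    by (rewrite <- Rpow_mult_distr; f_equal; field; lra).
  rewrite E in Hk; set (z := (INR N / M') ^ k) in *.
  assert (M ^ k * M ^ k <= M' ^ k * M' ^ k) by nra.
  assert (INR (S k) ^ N * (M ^ k * M ^ k) <= INR (S k) ^ N * (M' ^ k * M' ^ k))
    by (apply Rmult_le_compat_l; lra).
  assert (INR (S k) ^ N * (M' ^ k * M' ^ k) < z * z * (M' ^ k * M' ^ k)).
  { apply Rmult_lt_compat_r; [|exact Hk']. now apply Rmult_lt_0_compat. }
  lra.
Qed.

Lemma Cmod_lsum_sunim_le (t : R) (l : list nat) : (forall n, In n l -> (0 < n)%nat) ->
  Cmod (lsum (sunim t) l) <= INR (length l).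
Proof.
  induction l as [|x l IH]; intros Hl; [simpl; rewrite Cmod_0; lra|].
  change (length (x :: l)) with (S (length l)); rewrite S_INR; simpl lsum.
  apply Rle_trans with (1 := Cmod_triangle _ _).
  rewrite Cmod_sunim by (apply Hl; now left).
  generalize (IH ltac:(intros n Hn; apply Hl; now right)); lra.
Qed.

(** A sum of [N] unimodular numbers of modulus near [N] has nearly parallel terms, and the term at
    1, which equals 1, fixes their common direction. *)
Lemma unim_approx (N : nat) (eps : R) : 0 < eps ->
  exists t, forall n, (1 <= n <= N)%nat -> Cmod (unim t n - sgn2 n) < eps.
Proof.
  (* From |1 + z| > 2 - eta and |1 + z|^2 + |z - 1|^2 = 4 follows |z - 1|^2 < 4 eta; eta <= 1 keeps
     2 - eta positive for squaring. *)
  intros He; set (eta := Rmin 1 (eps * eps / 4)).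
  assert (Heta : 0 < eta) by (apply Rmin_pos; [lra | nra]).
  assert (Heta1 : eta <= 1) by apply Rmin_l.
  assert (Heta2 : eta <= eps * eps / 4) by apply Rmin_r.
  destruct N as [|N]; [exists 0; lia|].
  destruct (lsum_sunim_sup (S N) (INR (S N) - eta) ltac:(lra)) as [t Ht].
  exists t; intros n Hn.
  assert (Hb : Cmod (sunim t n - 1) < eps).
  { destruct (Nat.eq_dec n 1) as [-> | Hn1].
    { rewrite sunim_1; replace (1 - 1)%C with (RtoC 0) by ring; now rewrite Cmod_0. }
    assert (Hin : In n (seq 2 N)) by (apply in_seq; lia).
    assert (Hlen : length (seq 2 N) = N) by apply length_seq.
    assert (Hpos : forall m, In m (seq 2 N) -> (0 < m)%nat)
      by (intros m Hm; apply in_seq in Hm; lia).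
    change (seq 1 (S N)) with (1%nat :: seq 2 N) in Ht; simpl lsum in Ht.
    rewrite sunim_1 in Ht.
    apply in_split in Hin; destruct Hin as [l1 [l2 E]]; rewrite E in *.
    rewrite lsum_app in Ht; simpl lsum in Ht.
    replace (1 + (lsum (sunim t) l1 + (sunim t n + lsum (sunim t) l2)))%C
      with ((1 + sunim t n) + (lsum (sunim t) (l1 ++ l2)))%C in Ht
      by (rewrite lsum_app; ring).
    assert (Hle := Cmod_lsum_sunim_le t (l1 ++ l2)
      ltac:(intros m Hm; apply Hpos; apply in_app_iff in Hm; apply in_app_iff;
            destruct Hm; [left | right; right]; assumption)).
    rewrite length_app in Hlen, Hle; simpl in Hlen.
    assert (HlN : INR (length l1 + length l2) = INR (S N) - 2)
      by (rewrite <- Hlen, Nat.add_succ_r, !S_INR; ring).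
    rewrite HlN in Hle.
    assert (Hsum : 2 - eta < Cmod (1 + sunim t n)).
    { generalize (Cmod_triangle (1 + sunim t n) (lsum (sunim t) (l1 ++ l2))); lra. }
    assert (Hz := Cmod_sunim t n ltac:(lia)).
    assert (Hsq := Cmod_1_re_sqr _ Hz).
    assert (H1 := Cmod_sqr (1 + sunim t n)); assert (H2 := Cmod_sqr (sunim t n - 1)).
    replace (Re (1 + sunim t n)) with (1 + Re (sunim t n)) in H1 by reflexivity.
    replace (Im (1 + sunim t n)) with (Im (sunim t n)) in H1 by (simpl; unfold Im; ring).
    replace (Re (sunim t n - 1)) with (Re (sunim t n) - 1) in H2 by (simpl; unfold Re; ring).
    replace (Im (sunim t n - 1)) with (Im (sunim t n)) in H2 by (simpl; unfold Im; ring).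
    assert (H3 := Cmod_ge_0 (sunim t n - 1)).
    set (c := Re (sunim t n)) in *; set (d := Im (sunim t n)) in *.
    set (u := Cmod (1 + sunim t n)) in *; set (v := Cmod (sunim t n - 1)) in *.
    assert (v * v < eps * eps) by nra.
    destruct (Rlt_le_dec v eps); [assumption | nra]. }
  replace (unim t n - sgn2 n)%C with (sgn2 n * (sunim t n - 1))%C.
  - rewrite Cmod_mult, Cmod_R.
    replace (Rabs (sgn2 n)) with 1; [lra|].
    unfold sgn2; destruct (odd_val2 _); [rewrite Rabs_left | rewrite Rabs_right]; lra.
  - unfold sunim.
    replace (sgn2 n * (sgn2 n * unim t n - 1))%C
      with (RtoC (sgn2 n) * RtoC (sgn2 n) * unim t n - sgn2 n)%C by ring.
    rewrite <- RtoC_mult, sgn2_sqr; ring.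
Qed.

(** * Solving an exponential equation by contraction *)

Lemma Cmod_le_abs (z : C) : Cmod z <= Rabs (Re z) + Rabs (Im z).
Proof.
  apply Rsqr_incr_0_var.
  - unfold Rsqr; rewrite Cmod_sqr.
    assert (H1 := Rabs_pos (Re z)); assert (H2 := Rabs_pos (Im z)).
    assert (E1 := Rsqr_abs (Re z)); assert (E2 := Rsqr_abs (Im z)).
    unfold Rsqr in E1, E2; nra.
  - apply Rplus_le_le_0_compat; apply Rabs_pos.
Qed.

(** The bound on [f 0] keeps the iterates of 0 in the disc. Their limit is the sum of the
    increments, dominated by a geometric series of sum [r], so it stays in the disc too. *)
Lemma contraction_fixed_point (f : C -> C) (r : R) : 0 < r ->
  Cmod (f 0) <= r / 2 ->
  (forall z w, Cmod z <= r -> Cmod w <= r -> Cmod (f z - f w) <= Cmod (z - w) / 2) ->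
  exists z, Cmod z <= r /\ f z = z.
Proof.
  intros Hr H0 Hf.
  set (x := fun k => Nat.iter k f (RtoC 0)).
  assert (Hx : forall k, Cmod (x k) <= r).
  { intros k; induction k as [|k IH]; [simpl; rewrite Cmod_0; lra|].
    change (x (S k)) with (f (x k)).
    replace (f (x k)) with ((f (x k) - f 0) + f 0)%C by ring.
    apply Rle_trans with (1 := Cmod_triangle _ _).
    assert (H := Hf (x k) 0 IH ltac:(rewrite Cmod_0; lra)).
    replace (x k - 0)%C with (x k) in H by ring; lra. }
  assert (Hd : forall k, Cmod (x (S k) - x k) <= r / 2 * (1 / 2) ^ k).
  { intros k; induction k as [|k IH].
    - change (x 1%nat) with (f 0); change (x 0%nat) with (RtoC 0).
      replace (f 0 - 0)%C with (f 0) by ring; rewrite pow_O; lra.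
    - change (x (S (S k))) with (f (x (S k))); change (x (S k)) with (f (x k)) at 2.
      apply Rle_trans with (1 := Hf _ _ (Hx _) (Hx _)); rewrite <- tech_pow_Rmult; lra. }
  assert (Hgeo : is_series (fun k => r / 2 * (1 / 2) ^ k) (r / 2 * / (1 - 1 / 2))).
  { apply (is_series_scal_l (r / 2) (fun k => (1 / 2) ^ k)).
    apply is_series_geom; rewrite Rabs_pos_eq; lra. }
  replace (r / 2 * / (1 - 1 / 2)) with r in Hgeo by field.
  assert (Hex : ex_series (fun k => r / 2 * (1 / 2) ^ k)) by (exists r; exact Hgeo).
  set (z := Csum (fun k => x (S k) - x k)%C).
  assert (Hs := summable_dom _ _ Hd Hex).
  assert (Hz : Cmod z <= r).
  { rewrite <- (is_series_unique _ _ Hgeo); apply Cmod_Csum_le; assumption. }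
  assert (Hlim : forall g : C -> R, g 0 = 0 ->
    (forall k, g (x (S k) - x k)%C = g (x (S k)) - g (x k)) ->
    ex_series (fun k => g (x (S k) - x k)%C) ->
    is_lim_seq (fun k => g (x (S k))) (Series (fun k => g (x (S k) - x k)%C))).
  { intros g Hg0 Hg Hge; apply Series_correct in Hge.
    apply (is_lim_seq_ext (sum_n (fun k => g (x (S k) - x k)%C))); [|exact Hge].
    intros k; induction k as [|k IH].
    - rewrite sum_O, Hg; change (x 0%nat) with (RtoC 0); rewrite Hg0; ring.
    - rewrite sum_Sn, IH, Hg; unfold plus; simpl; ring. }
  assert (HRe := Hlim Re eq_refl
    ltac:(intros k; unfold Re; simpl; ring) (summable_re _ Hs)).
  assert (HIm := Hlim Im eq_refl
    ltac:(intros k; unfold Im; simpl; ring) (summable_im _ Hs)).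
  exists z; split; [exact Hz|].
  assert (Hclose : forall eps, 0 < eps -> exists N, forall k, (N <= k)%nat ->
    Cmod (x (S k) - z) < eps).
  { intros eps He; assert (He2 : 0 < eps / 2) by lra.
    destruct (proj2 (is_lim_seq_spec _ _) HRe (mkposreal _ He2)) as [N1 H1].
    destruct (proj2 (is_lim_seq_spec _ _) HIm (mkposreal _ He2)) as [N2 H2].
    exists (N1 + N2)%nat; intros k Hk.
    specialize (H1 k ltac:(lia)); specialize (H2 k ltac:(lia)); simpl in H1, H2.
    apply Rle_lt_trans with (1 := Cmod_le_abs _).
    replace (eps) with (eps / 2 + eps / 2) by field.
    apply Rplus_lt_compat; [exact H1 | exact H2]. }
  assert (Hfz : Cmod (f z - z) <= 0).
  { apply le_epsilon; intros eps He; rewrite Rplus_0_l.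
    destruct (Hclose (eps / 2) ltac:(lra)) as [N HN].
    assert (H1 := HN N ltac:(lia)); assert (H2 := HN (S N) ltac:(lia)).
    replace (f z - z)%C with ((f z - f (x (S N))) + (x (S (S N)) - z))%C
      by (change (x (S (S N))) with (f (x (S N))); ring).
    apply Rle_trans with (1 := Cmod_triangle _ _).
    assert (H3 := Hf z (x (S N)) Hz (Hx _)).
    rewrite Cmod_minus_sym in H1; lra. }
  assert (H : (f z - z)%C = RtoC 0)
    by (apply Cmod_eq_0; generalize (Cmod_ge_0 (f z - z)); lra).
  replace (f z) with ((f z - z) + z)%C by ring; rewrite H; ring.
Qed.

Lemma Csum_R (a : nat -> R) : Csum (fun n => RtoC (a n)) = RtoC (Series a).
Proof.
  apply C_eq; simpl; [reflexivity|].
  transitivity (Series (fun _ : nat => 0 * 0)); [|rewrite Series_scal_l; ring].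
  apply Series_ext; intros n; ring.
Qed.

(** With v = -l(z - w) the left side is e^(-lw) (e^v - 1 - v) + (e^(-lw) - 1) v. The two parts
    contribute 2r and r to the factor 3r. *)
Lemma Cexp_second_difference (l r : R) (z w : C) : 0 <= l -> Cmod z <= r -> Cmod w <= r ->
  Cmod (Cexp (- l * z) - Cexp (- l * w) + l * (z - w))
  <= 3 * r * (l * l * exp (3 * l * r)) * Cmod (z - w).
Proof.
  intros Hl Hz Hw.
  assert (Hr : 0 <= r) by (apply Rle_trans with (2 := Hz), Cmod_ge_0).
  assert (Hzw : Cmod (z - w) <= 2 * r) by (generalize (Cmod_minus_le z w); lra).
  assert (Hzw0 := Cmod_ge_0 (z - w)); assert (Hw0 := Cmod_ge_0 w).
  set (v := (- l * (z - w))%C).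
  assert (Ev : Cmod v = l * Cmod (z - w))
    by (unfold v; rewrite Cmod_mult, Cmod_opp, Cmod_R, Rabs_pos_eq; lra).
  assert (Ew : Cmod (- l * w) = l * Cmod w)
    by (rewrite Cmod_mult, Cmod_opp, Cmod_R, Rabs_pos_eq; lra).
  replace (Cexp (- l * z) - Cexp (- l * w) + l * (z - w))%C
    with (Cexp (- l * w) * (Cexp v - 1 - v) + (Cexp (- l * w) - 1) * v)%C.
  2: { replace (- l * z)%C with (- l * w + v)%C by (unfold v; ring).
       rewrite Cexp_plus; unfold v; ring. }
  apply Rle_trans with (1 := Cmod_triangle _ _); rewrite !Cmod_mult, Cmod_Cexp.
  assert (H1 : exp (Re (- l * w)) <= exp (l * r)).
  { apply Rexp_le, Rle_trans with (1 := re_le_mod _); rewrite Ew; nra. }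
  assert (H2 := Cexp_taylor_1 v); rewrite Ev in H2.
  assert (H3 := Cexp_minus_1_le_mod (- l * w)); rewrite Ew in H3.
  assert (H4 : exp (l * Cmod (z - w)) <= exp (2 * l * r)) by (apply Rexp_le; nra).
  assert (H5 : exp (l * Cmod w) <= exp (3 * l * r)) by (apply Rexp_le; nra).
  assert (H6 : exp (3 * l * r) = exp (l * r) * exp (2 * l * r))
    by (rewrite <- exp_plus; f_equal; ring).
  rewrite Ev; set (d := Cmod (z - w)) in *.
  assert (P1 := exp_pos (l * r)); assert (P2 := exp_pos (2 * l * r)).
  assert (P3 := exp_pos (3 * l * r)); assert (P4 := exp_pos (l * Cmod w)).
  assert (Hld : 0 <= l * d) by (apply Rmult_le_pos; assumption).
  assert (Hlr : 0 <= l * r) by (apply Rmult_le_pos; assumption).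
  assert (Q1 : exp (Re (- l * w)) * Cmod (Cexp v - 1 - v)
    <= 2 * r * (l * l * exp (3 * l * r)) * d).
  { apply Rle_trans with (exp (l * r) * (l * d * (l * (2 * r)) * exp (2 * l * r))).
    - apply Rmult_le_compat; [left; apply exp_pos | apply Cmod_ge_0 | exact H1 |].
      apply Rle_trans with (1 := H2).
      apply Rmult_le_compat; [apply Rmult_le_pos; assumption | left; apply exp_pos | | exact H4].
      apply Rmult_le_compat_l; [exact Hld | nra].
    - rewrite H6; right; ring. }
  assert (Q2 : Cmod (Cexp (- l * w) - 1) * (l * d)
    <= r * (l * l * exp (3 * l * r)) * d).
  { apply Rle_trans with (l * r * exp (3 * l * r) * (l * d)).
    - apply Rmult_le_compat_r; [exact Hld|].
      apply Rle_trans with (1 := H3).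
      apply Rmult_le_compat; [nra | lra | nra | exact H5].
    - right; ring. }
  lra.
Qed.

(** Newton's map z - (F(z) + 1)/D with frozen derivative: if all [u n] were -1, then F(0) = -1 and
    F'(0) = D. The hypotheses make |f(0)| <= r/2 and give the contraction factor 1/2 as 1/4 from the
    defect of [u] plus 1/4 from the second-order term. *)
Lemma exp_sum_solve (a l : nat -> R) (u : nat -> C) (r : R) :
  0 < r -> (forall n, 0 <= a n) -> (forall n, 0 <= l n) -> (forall n, Cmod (u n) <= 1) ->
  is_series a 1 ->
  ex_series (fun n => a n * l n) -> 0 < Series (fun n => a n * l n) ->
  ex_series (fun n => a n * exp (l n * r)) ->
  ex_series (fun n => a n * (l n * l n * exp (3 * l n * r))) ->
  3 * r * Series (fun n => a n * (l n * l n * exp (3 * l n * r)))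
    <= Series (fun n => a n * l n) / 4 ->
  Series (fun n => a n * Cmod (1 + u n) * l n) <= Series (fun n => a n * l n) / 4 ->
  Series (fun n => a n * Cmod (1 + u n)) <= Series (fun n => a n * l n) * r / 2 ->
  exists z, Cmod z <= r /\
    Csum (fun n => RtoC (a n) * (u n * Cexp (- RtoC (l n) * z)))%C = (- (1))%C.
Proof.
  intros Hr Ha Hl Hu Ha1 Hal HD Hae Ha2 HS2 HW1 HW0.
  set (D := Series (fun n => a n * l n)) in *.
  set (S2 := Series (fun n => a n * (l n * l n * exp (3 * l n * r)))) in *.
  assert (Haex : ex_series a) by (exists 1; exact Ha1).
  assert (H1u : forall n, Cmod (1 + u n) <= 2).
  { intros n; apply Rle_trans with (1 := Cmod_triangle _ _); rewrite Cmod_1.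
    specialize (Hu n); lra. }
  set (F := fun z => Csum (fun n => RtoC (a n) * (u n * Cexp (- RtoC (l n) * z)))%C).
  assert (HF : forall z, Cmod z <= r ->
    summable (fun n => RtoC (a n) * (u n * Cexp (- RtoC (l n) * z)))%C).
  { intros z Hz; apply summable_dom with (2 := Hae); intros n.
    rewrite !Cmod_mult, Cmod_R, Rabs_pos_eq, Cmod_Cexp by apply Ha.
    apply Rmult_le_compat_l; [apply Ha|].
    rewrite <- (Rmult_1_l (exp (l n * r))).
    apply Rmult_le_compat; [apply Cmod_ge_0 | left; apply exp_pos | apply Hu |].
    apply Rexp_le; rewrite <- RtoC_opp, re_scal_l.
    assert (H := re_ge_mod z); specialize (Hl n); nra. }
  assert (Hsl : summable (fun n => RtoC (a n * l n))).
  { apply summable_dom with (2 := Hal); intros n; rewrite Cmod_R, Rabs_pos_eq;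
      [lra | now apply Rmult_le_pos]. }
  set (f := fun z => (z - (F z + 1) / D)%C).
  assert (HDC : RtoC D <> RtoC 0) by (intros E; apply RtoC_inj in E; lra).
  assert (Hw1ex : ex_series (fun n => a n * Cmod (1 + u n) * l n)).
  { apply ex_series_dom with (fun n => 2 * (a n * l n)).
    - intros n; assert (H1 := Cmod_ge_0 (1 + u n)); specialize (H1u n).
      specialize (Ha n); specialize (Hl n).
      assert (0 <= a n * l n) by now apply Rmult_le_pos.
      rewrite Rabs_pos_eq by (repeat apply Rmult_le_pos; assumption); nra.
    - now apply (ex_series_scal_l 2 (fun n => a n * l n)). }
  assert (Hw0ex : ex_series (fun n => a n * Cmod (1 + u n))).
  { apply ex_series_dom with (fun n => 2 * a n).
    - intros n; assert (H1 := Cmod_ge_0 (1 + u n)); specialize (H1u n).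
      specialize (Ha n).
      rewrite Rabs_pos_eq by (repeat apply Rmult_le_pos; assumption); nra.
    - now apply (ex_series_scal_l 2 a). }
  destruct (contraction_fixed_point f r Hr) as [z [Hz Hfz]].
  - unfold f; replace (0 - (F 0 + 1) / D)%C with (- ((F 0 + 1) / D))%C by ring.
    rewrite Cmod_opp, Cmod_div, Cmod_R, (Rabs_pos_eq D) by (exact HDC || lra).
    assert (H0 : (F 0 + 1)%C = Csum (fun n => RtoC (a n) * (1 + u n))%C).
    { transitivity (F 0 + Csum (fun n => RtoC (a n)))%C;
        [now rewrite Csum_R, (is_series_unique _ _ Ha1)|].
      unfold F; rewrite <- Csum_plus.
      - apply Csum_ext; intros n.
        replace (- l n * 0)%C with (RtoC 0) by ring; rewrite Cexp_0; ring.
      - apply HF; rewrite Cmod_0; lra.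
      - apply summable_dom with (2 := Haex); intros n.
        rewrite Cmod_R, Rabs_pos_eq; [lra | apply Ha]. }
    assert (H : Cmod (F 0 + 1) <= D * r / 2).
    { rewrite H0; apply Rle_trans with (2 := HW0), Cmod_Csum_le; [|exact Hw0ex].
      intros n; rewrite Cmod_mult, Cmod_R, Rabs_pos_eq; [lra | apply Ha]. }
    apply Rmult_le_reg_r with D; [exact HD|].
    unfold Rdiv at 1; rewrite Rmult_assoc, Rinv_l by lra; lra.
  - intros z w Hz Hw; unfold f.
    replace (z - (F z + 1) / D - (w - (F w + 1) / D))%C
      with ((D * (z - w) - (F z - F w)) / D)%C by (field; exact HDC).
    rewrite Cmod_div, Cmod_R, (Rabs_pos_eq D) by (exact HDC || lra).
    assert (E : (D * (z - w) - (F z - F w))%C = Csum (fun n => RtoC (a n) *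
      ((1 + u n) * (l n * (z - w))
       - u n * (Cexp (- l n * z) - Cexp (- l n * w) + l n * (z - w))))%C).
    { unfold F, D; rewrite <- Csum_minus by auto.
      rewrite <- Csum_R, Cmult_comm, <- Csum_scal by exact Hsl.
      rewrite <- Csum_minus; [| now apply summable_scal |].
      2: { apply summable_dom with (fun n => Cmod (a n * (u n * Cexp (- l n * z)))
             + Cmod (a n * (u n * Cexp (- l n * w)))); [intros n; apply Cmod_minus_le|].
           apply (ex_series_plus (fun n => Cmod (a n * (u n * Cexp (- l n * z))))
             (fun n => Cmod (a n * (u n * Cexp (- l n * w))))); now apply HF. }
      apply Csum_ext; intros n; rewrite RtoC_mult; ring. }
    assert (Hb : Cmod (D * (z - w) - (F z - F w)) <= D / 2 * Cmod (z - w)).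
    { assert (Hd0 := Cmod_ge_0 (z - w)).
      assert (Hexb : ex_series (fun n => Cmod (z - w) * (a n * Cmod (1 + u n) * l n)
        + 3 * r * Cmod (z - w) * (a n * (l n * l n * exp (3 * l n * r))))).
      { apply (ex_series_plus (fun n => Cmod (z - w) * (a n * Cmod (1 + u n) * l n))
          (fun n => 3 * r * Cmod (z - w) * (a n * (l n * l n * exp (3 * l n * r))))).
        - now apply (ex_series_scal_l (Cmod (z - w)) (fun n => a n * Cmod (1 + u n) * l n)).
        - now apply (ex_series_scal_l (3 * r * Cmod (z - w))
            (fun n => a n * (l n * l n * exp (3 * l n * r)))). }
      rewrite E; apply Rle_trans with (Series (fun n => Cmod (z - w) * (a n * Cmod (1 + u n) * l n)
        + 3 * r * Cmod (z - w) * (a n * (l n * l n * exp (3 * l n * r))))).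
      - apply Cmod_Csum_le; [|exact Hexb]; intros n.
        rewrite Cmod_mult, Cmod_R, Rabs_pos_eq by apply Ha.
        replace (Cmod (z - w) * (a n * Cmod (1 + u n) * l n)
          + 3 * r * Cmod (z - w) * (a n * (l n * l n * exp (3 * l n * r))))
          with (a n * (Cmod (1 + u n) * (l n * Cmod (z - w))
            + 3 * r * (l n * l n * exp (3 * l n * r)) * Cmod (z - w))) by ring.
        apply Rmult_le_compat_l; [apply Ha|].
        apply Rle_trans with (1 := Cmod_minus_le _ _).
        rewrite !Cmod_mult, Cmod_R, Rabs_pos_eq by apply Hl.
        apply Rplus_le_compat_l.
        assert (H := Cexp_second_difference (l n) r z w (Hl n) Hz Hw).
        specialize (Hu n); assert (H0 := Cmod_ge_0 (u n)).
        assert (H1 := Cmod_ge_0 (Cexp (- l n * z) - Cexp (- l n * w) + l n * (z - w))).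
        nra.
      - rewrite Series_plus, !Series_scal_l.
        + fold S2; nra.
        + now apply (ex_series_scal_l (Cmod (z - w)) (fun n => a n * Cmod (1 + u n) * l n)).
        + now apply (ex_series_scal_l (3 * r * Cmod (z - w))
            (fun n => a n * (l n * l n * exp (3 * l n * r)))). }
    apply Rmult_le_reg_r with D; [exact HD|].
    unfold Rdiv at 1; rewrite Rmult_assoc, Rinv_l by lra; lra.
  - exists z; split; [exact Hz|].
    change (F z = (- (1))%C).
    assert (E : ((F z + 1) / D)%C = RtoC 0).
    { transitivity (z - f z)%C; [unfold f; ring | rewrite Hfz; ring]. }
    replace (F z) with ((F z + 1) / D * D - 1)%C by (field; exact HDC).
    rewrite E; ring.
Qed.

(** * The equation [zeta s = 1] *)

(* The indicator function of the odd integers greater than 1. *)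
Definition hcoef (n : nat) : R := rcoef 2 n - delta 1 n.

Lemma tame_hcoef : tame hcoef.
Proof.
  apply tame_bounded with 1; intros n; unfold hcoef, delta.
  assert (H := rcoef_01 2 n).
  destruct (Nat.eqb n 1); apply Rabs_le; lra.
Qed.

Lemma hcoef_odd (k : nat) : (1 <= k)%nat -> hcoef (2 * k + 1) = 1.
Proof.
  intros Hk; unfold hcoef, delta, rcoef.
  destruct (Nat.eqb_spec (2 * k + 1) 1); [lia|].
  replace (rough 2 (2 * k + 1)) with true; [ring|].
  symmetry; apply rough_spec; intros d Hd [m Hm]; assert (d = 2)%nat by lia; lia.
Qed.

Lemma hcoef_cases (n : nat) : hcoef n = 0 \/
  (hcoef n = 1 /\ (3 <= n)%nat /\ sgn2 n = 1).
Proof.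
  destruct (Nat.Even_or_Odd n) as [[k ->] | [k ->]].
  - left; unfold hcoef, delta, rcoef.
    destruct (Nat.eqb_spec (2 * k) 1); [lia|].
    replace (rough 2 (2 * k)) with false; [ring|].
    symmetry; apply Bool.not_true_iff_false; intros H.
    apply (proj1 (rough_spec 2 _) H 2%nat); [lia | exists k; lia].
  - destruct k as [|k].
    + left; unfold hcoef, rcoef, delta; simpl; ring.
    + right; split; [apply hcoef_odd; lia | split; [lia | apply sgn2_odd]].
Qed.

Lemma hcoef_01 (n : nat) : 0 <= hcoef n <= 1.
Proof. destruct (hcoef_cases n) as [-> | [-> _]]; lra. Qed.

Lemma DS_hcoef (s : C) : 1 < Re s -> DS hcoef s = (DA 2 s - 1)%C.
Proof.
  intros Hs; unfold hcoef.
  rewrite DS_minus, DS_delta, dm_1 by auto using tame_rcoef, tame_delta; reflexivity.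
Qed.

(* Multiplying by [1 - 2^(-s)] leaves the odd terms, whose first one cancels the constant. *)
Lemma zeta_eq_1_iff (zeta : C -> C) (s : C) : is_riemann_zeta zeta -> 1 < Re s ->
  zeta s = RtoC 1 <-> DS hcoef s = (- dm s 2)%C.
Proof.
  intros Hz Hs; rewrite (zeta_DA zeta), DS_hcoef by assumption.
  assert (E : DA 2 s = (DA 1 s * (1 - dm s 2))%C) by now apply DA_step.
  assert (Hn : (1 - dm s 2)%C <> RtoC 0) by (apply one_minus_dm_neq_0; [lra | lia]).
  rewrite E; split; intros H.
  - rewrite H; ring.
  - transitivity (((DA 1 s * (1 - dm s 2) - 1) + 1) / (1 - dm s 2))%C; [field; exact Hn|].
    rewrite H; field; exact Hn.
Qed.

Lemma Series_ge_term (a : nat -> R) (q : nat) : (forall n, 0 <= a n) -> ex_series a ->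
  a q <= Series a.
Proof.
  intros Ha Hex; rewrite <- (Series_single q (a q)); apply Series_le; [|exact Hex].
  intros n; specialize (Ha n); destruct (Nat.eqb_spec n q) as [-> |]; lra.
Qed.

Lemma Series_ge_two_terms (a : nat -> R) (p q : nat) : p <> q ->
  (forall n, 0 <= a n) -> ex_series a -> a p + a q <= Series a.
Proof.
  intros Hpq Ha Hex.
  assert (Hs : forall m, ex_series (fun n => if Nat.eqb n m then a m else 0)).
  { intros m; apply ex_series_dom with (2 := Hex); intros n.
    destruct (Nat.eqb_spec n m) as [-> |];
      [rewrite Rabs_pos_eq; [lra | apply Ha] | rewrite Rabs_R0; apply Ha]. }
  rewrite <- (Series_single p (a p)), <- (Series_single q (a q)), <- Series_plus by apply Hs.
  apply Series_le; [|exact Hex]; intros n; specialize (Ha n).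
  destruct (Nat.eqb_spec n p), (Nat.eqb_spec n q); subst; lra || lia.
Qed.

(** At exponent 1 the terms 2/3 + 2/5 already exceed 1. At 21/20, (n/2)^(-1/20) >= 1 - (n/2 - 1)/20
    still leaves 0.65 + 0.37. *)
Lemma rDS_hcoef_large : pw (21 / 20) 2 < rDS hcoef (21 / 20).
Proof.
  assert (H : hcoef 3 * pw (21 / 20) 3 + hcoef 5 * pw (21 / 20) 5 <= rDS hcoef (21 / 20)).
  { apply (Series_ge_two_terms (fun n => hcoef n * pw (21 / 20) n)); [lia | |].
    - intros n; apply Rmult_le_pos; [apply hcoef_01 | apply pw_ge_0].
    - apply ex_series_rDS; [apply tame_hcoef | lra]. }
  assert (E3 : hcoef 3 = 1) by (apply (hcoef_odd 1); lia).
  assert (E5 : hcoef 5 = 1) by (apply (hcoef_odd 2); lia).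
  rewrite E3, E5 in H.
  assert (Hb : forall n, (2 <= n)%nat -> pw (21 / 20) 2 *
    (2 / INR n * (1 - / 20 * (INR n / 2 - 1))) <= pw (21 / 20) n).
  { intros n Hn; assert (Hn2 : 2 <= INR n) by (apply le_INR in Hn; simpl in Hn; lra).
    destruct n as [|n]; [lia|]; unfold pw.
    set (w := ln (INR (S n)) - ln (INR 2)).
    replace (- (21 / 20) * ln (INR (S n))) with (- (21 / 20) * ln (INR 2) + (- w + - / 20 * w))
      by (unfold w; field).
    rewrite exp_plus; apply Rmult_le_compat_l; [left; apply exp_pos|].
    assert (Ew : exp w = INR (S n) / 2).
    { unfold w, Rminus; rewrite exp_plus, exp_Ropp, !exp_ln by (apply lt_0_INR; lia).
      change (INR 2) with (1 + 1); field. }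
    rewrite exp_plus, exp_Ropp, Ew.
    replace (/ (INR (S n) / 2)) with (2 / INR (S n)) by (field; lra).
    apply Rmult_le_compat_l; [left; apply Rdiv_lt_0_compat; lra|].
    assert (H1 := exp_ineq1_le (- / 20 * w)); assert (H2 := exp_ineq1_le w).
    rewrite Ew in H2; lra. }
  assert (H3 := Hb 3%nat ltac:(lia)); assert (H5 := Hb 5%nat ltac:(lia)).
  simpl INR in H3, H5; assert (H2 := pw_pos (21 / 20) 2 ltac:(lia)).
  set (P := pw (21 / 20) 2) in *.
  apply Rlt_le_trans with (P * (2 / (1 + 1 + 1) * (1 - / 20 * ((1 + 1 + 1) / 2 - 1)))
    + P * (2 / (1 + 1 + 1 + 1 + 1) * (1 - / 20 * ((1 + 1 + 1 + 1 + 1) / 2 - 1)))); lra.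
Qed.

(** Telescoping bounds the sum of n^(-4) over n >= 3 by 2^(-3)/3, which is 2/3 of 2^(-4). *)
Lemma rDS_hcoef_small : rDS hcoef 4 < pw 4 2.
Proof.
  assert (Ha : forall N, sum_n (fun n => hcoef n * pw 4 n) (2 + N)
    <= / 3 * (pw 3 2 - pw 3 (2 + N))).
  { intros N; induction N as [|N IH].
    - change (2 + 0)%nat with 2%nat; rewrite !sum_Sn, sum_O; unfold hcoef, rcoef, delta; simpl.
      unfold plus; simpl; lra.
    - rewrite Nat.add_succ_r, sum_Sn.
      assert (H := pw_telescope_le 3 (S N) ltac:(lra)).
      replace (1 + 3) with 4 in H by ring.
      change (S (S (S N))) with (S (2 + N)) in H; change (S (S N)) with (2 + N)%nat in H.
      assert (H1 := hcoef_01 (S (2 + N))); assert (H2 := pw_ge_0 4 (S (2 + N))).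
      change (sum_n (fun n => hcoef n * pw 4 n) (2 + N) + hcoef (S (2 + N)) * pw 4 (S (2 + N))
        <= / 3 * (pw 3 2 - pw 3 (S (2 + N)))).
      nra. }
  assert (Hex := ex_series_rDS hcoef 4 tame_hcoef ltac:(lra)).
  apply Series_correct in Hex.
  assert (Hle : rDS hcoef 4 <= / 3 * pw 3 2).
  { assert (H : Rbar_le (rDS hcoef 4) (/ 3 * pw 3 2)).
    { apply is_lim_seq_le_loc with (2 := Hex : is_lim_seq (sum_n (fun n => hcoef n * pw 4 n)) (rDS hcoef 4))
        (v := fun _ => / 3 * pw 3 2); [|apply is_lim_seq_const].
      exists 2%nat; intros n Hn; specialize (Ha (n - 2)%nat).
      replace (2 + (n - 2))%nat with n in Ha by lia.
      generalize (pw_ge_0 3 n); lra. }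
    exact H. }
  apply Rle_lt_trans with (1 := Hle).
  replace 4 with (3 + 1) by ring; rewrite pw_plus.
  assert (E : pw 1 2 = / 2).
  { unfold pw; rewrite <- Ropp_mult_distr_l, Rmult_1_l, exp_Ropp, exp_ln by (apply lt_0_INR; lia).
    change (INR 2) with (1 + 1); f_equal; ring. }
  rewrite E; generalize (pw_pos 3 2 ltac:(lia)); lra.
Qed.

Lemma sigma0_exists : exists x0, 1 < x0 /\ rDS hcoef x0 = pw x0 2.
Proof.
  destruct (Ranalysis5.IVT_interv (fun x => pw x 2 - rDS hcoef x) (21 / 20) 4)
    as [x [Hx E]].
  - intros a Ha; apply (continuity_pt_minus (fun x => pw x 2) (rDS hcoef)).
    + apply continuity_pt_filterlim; unfold pw.
      apply (ex_derive_continuous (fun y => exp (- y * ln (INR 2)))); auto_derive; trivial.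
    + apply rDS_continuity_pt; [apply tame_hcoef | lra].
  - lra.
  - generalize rDS_hcoef_large; lra.
  - generalize rDS_hcoef_small; lra.
  - exists x; split; lra.
Qed.

Lemma pw_lt_base (d : R) (m n : nat) : 0 < d -> (0 < m < n)%nat -> pw d n < pw d m.
Proof.
  intros Hd Hmn.
  assert (H : ln (INR m) < ln (INR n)).
  { apply ln_increasing; [apply lt_0_INR | apply lt_INR]; lia. }
  destruct m as [|m]; [lia|]; destruct n as [|n]; [lia|].
  apply exp_increasing; nra.
Qed.

Lemma pw_le_base (d : R) (m n : nat) : 0 < d -> (0 < m <= n)%nat -> pw d n <= pw d m.
Proof.
  intros Hd Hmn; destruct (Nat.eq_dec m n) as [-> |]; [lra|].
  left; apply pw_lt_base; [exact Hd | lia].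
Qed.

(** Raising the exponent by d multiplies each term on the left by n^(-d) <= 3^(-d), but the right
    side by the larger 2^(-d). *)
Lemma rDS_hcoef_lt (x0 x : R) : 1 < x0 -> rDS hcoef x0 = pw x0 2 -> x0 < x ->
  rDS hcoef x < pw x 2.
Proof.
  intros H1 H0 Hx; set (d := x - x0); assert (Hd : 0 < d) by (unfold d; lra).
  replace x with (x0 + d) by (unfold d; ring); rewrite pw_plus, <- H0.
  apply Rle_lt_trans with (pw d 3 * rDS hcoef x0).
  - unfold rDS; rewrite <- Series_scal_l; apply Series_le.
    + intros n; rewrite pw_plus; assert (H := pw_ge_0 x0 n); assert (H' := pw_ge_0 d n).
      destruct (hcoef_cases n) as [-> | [-> [Hn _]]]; [lra|].
      assert (H3 := pw_le_base d 3 n Hd ltac:(lia)); nra.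
    + apply (ex_series_scal_l (pw d 3) (fun n => hcoef n * pw x0 n)).
      now apply ex_series_rDS; [apply tame_hcoef|].
  - rewrite Rmult_comm; apply Rmult_lt_compat_l.
    + rewrite H0; apply pw_pos; lia.
    + apply pw_lt_base; [exact Hd | lia].
Qed.

Lemma zeta_one_re_le (zeta : C -> C) (x0 : R) (s : C) : is_riemann_zeta zeta ->
  1 < x0 -> rDS hcoef x0 = pw x0 2 -> zeta_one zeta s -> Re s <= x0.
Proof.
  intros Hz H1 H0 [_ Hs]; destruct (Rle_lt_dec (Re s) x0) as [H | H]; [exact H | exfalso].
  apply (zeta_eq_1_iff zeta) in Hs; [| exact Hz | lra].
  assert (Hle : Cmod (DS hcoef s) <= rDS hcoef (Re s)).
  { apply Cmod_DS_le; [apply tame_hcoef | lra |].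
    intros n; rewrite Rabs_pos_eq; [lra | apply hcoef_01]. }
  rewrite Hs, Cmod_opp, Cmod_dm in Hle.
  generalize (rDS_hcoef_lt x0 (Re s) H1 H0 H); lra.
Qed.

(** The cross term is 2xy times the real part of u times the conjugate of v, and twice that real
    part is |u + v|^2 - 2. Thus a modulus close to |x - y| forces u + v to be small when xy > 0. *)
Lemma Cmod_sqr_comb (x y : R) (u v : C) : Cmod u = 1 -> Cmod v = 1 ->
  Cmod (x * u + y * v) * Cmod (x * u + y * v)
  = (x - y) * (x - y) + x * y * (Cmod (u + v) * Cmod (u + v)).
Proof.
  intros Hu Hv; apply Cmod_1_re_sqr in Hu; apply Cmod_1_re_sqr in Hv.
  rewrite !Cmod_sqr.
  replace (Re (x * u + y * v)) with (x * Re u + y * Re v) by (simpl; unfold Re; ring).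
  replace (Im (x * u + y * v)) with (x * Im u + y * Im v) by (simpl; unfold Im; ring).
  change (Re (u + v)) with (Re u + Re v); change (Im (u + v)) with (Im u + Im v).
  assert (E1 : Im u * Im u = 1 - Re u * Re u) by lra.
  assert (E2 : Im v * Im v = 1 - Re v * Re v) by lra.
  ring_simplify.
  replace (Im u ^ 2) with (1 - Re u * Re u) by (rewrite <- E1; ring).
  replace (Im v ^ 2) with (1 - Re v * Re v) by (rewrite <- E2; ring).
  ring.
Qed.

Lemma lim_0_of_sqr (u : nat -> R) : (forall n, 0 <= u n) ->
  is_lim_seq (fun n => u n * u n) 0 -> is_lim_seq u 0.
Proof.
  intros Hu H; apply is_lim_seq_spec; intros eps.
  assert (Hp : 0 < eps * eps) by (apply Rmult_lt_0_compat; apply cond_pos).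
  destruct (proj2 (is_lim_seq_spec _ _) H (mkposreal _ Hp)) as [N HN].
  exists N; intros n Hn; specialize (HN n Hn); simpl in HN.
  rewrite Rminus_0_r in *; specialize (Hu n).
  rewrite Rabs_pos_eq in HN by (apply Rmult_le_pos; exact Hu).
  rewrite Rabs_pos_eq by exact Hu.
  assert (He := cond_pos eps); destruct (Rlt_le_dec (u n) eps); [assumption | nra].
Qed.

(** Moving the term at [q] to the side of 2^(-s) bounds |2^(-s) + q^(-s)| by the remaining real
    series. That bound tends to 2^(-x0) - q^(-x0), the least modulus such a combination can have at
    [x0]. *)
Lemma unim_plus_lim (zeta : C -> C) (x0 : R) (s : nat -> C) (q : nat) :
  is_riemann_zeta zeta -> 1 < x0 -> rDS hcoef x0 = pw x0 2 ->
  (forall n, zeta_one zeta (s n)) -> is_lim_seq (fun n => Re (s n)) x0 ->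
  hcoef q = 1 ->
  is_lim_seq (fun n => Cmod (unim (Im (s n)) 2 + unim (Im (s n)) q)) 0.
Proof.
  intros Hz H1 H0 Hs Hlim Hq.
  assert (Hq3 : (3 <= q)%nat) by (destruct (hcoef_cases q) as [E | [_ [E _]]]; [lra | exact E]).
  assert (Hr := rDS_lim hcoef _ _ tame_hcoef H1 Hlim); rewrite H0 in Hr.
  assert (Hx := pw_lim 2 _ _ Hlim); assert (Hy := pw_lim q _ _ Hlim).
  assert (Hx0 := pw_pos x0 2 ltac:(lia)); assert (Hy0 := pw_pos x0 q ltac:(lia)).
  destruct (lim_gt_eventually _ _ 1 Hlim H1) as [N HN].
  apply lim_0_of_sqr; [intros n; apply Cmod_ge_0|].
  apply lim_squeeze_above with (u := fun n =>
    ((rDS hcoef (Re (s n)) - pw (Re (s n)) q) * (rDS hcoef (Re (s n)) - pw (Re (s n)) q)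
     - (pw (Re (s n)) 2 - pw (Re (s n)) q) * (pw (Re (s n)) 2 - pw (Re (s n)) q))
    / (pw (Re (s n)) 2 * pw (Re (s n)) q)).
  - exists N; intros n Hn; specialize (HN n Hn).
    split; [apply Rmult_le_pos; apply Cmod_ge_0|].
    assert (E : DS (fun m => hcoef m - delta q m) (s n) = (- (dm (s n) 2 + dm (s n) q))%C).
    { rewrite DS_minus, DS_delta by (auto using tame_hcoef, tame_delta).
      rewrite (proj1 (zeta_eq_1_iff zeta (s n) Hz HN) (proj2 (Hs n))); ring. }
    assert (Htame : tame (fun m => hcoef m - delta q m)).
    { apply tame_bounded with 1; intros m; unfold delta; assert (H := hcoef_01 m).
      destruct (Nat.eqb m q); apply Rabs_le; lra. }
    assert (Hb : Cmod (dm (s n) 2 + dm (s n) q) <= rDS hcoef (Re (s n)) - pw (Re (s n)) q).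
    { rewrite <- Cmod_opp, <- E.
      replace (rDS hcoef (Re (s n)) - pw (Re (s n)) q)
        with (rDS (fun m => hcoef m - delta q m) (Re (s n))).
      - apply Cmod_DS_le; [exact Htame | exact HN |]; intros m.
        rewrite Rabs_pos_eq; [lra|].
        unfold delta; destruct (Nat.eqb_spec m q) as [-> |]; [lra|].
        generalize (hcoef_01 m); lra.
      - apply RtoC_inj; rewrite RtoC_minus, <- !DS_R, <- dm_R, <- DS_delta.
        apply DS_minus; auto using tame_hcoef, tame_delta. }
    rewrite !dm_polar in Hb.
    assert (Hsq := Cmod_sqr_comb (pw (Re (s n)) 2) (pw (Re (s n)) q)
      (unim (Im (s n)) 2) (unim (Im (s n)) q)
      (Cmod_unim _ 2 ltac:(lia)) (Cmod_unim _ q ltac:(lia))).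
    assert (Hc0 := Cmod_ge_0 (pw (Re (s n)) 2 * unim (Im (s n)) 2
      + pw (Re (s n)) q * unim (Im (s n)) q)).
    assert (P2 := pw_pos (Re (s n)) 2 ltac:(lia)).
    assert (Pq := pw_pos (Re (s n)) q ltac:(lia)).
    assert (Pp : 0 < pw (Re (s n)) 2 * pw (Re (s n)) q) by now apply Rmult_lt_0_compat.
    apply Rmult_le_reg_r with (pw (Re (s n)) 2 * pw (Re (s n)) q); [exact Pp|].
    unfold Rdiv; rewrite Rmult_assoc, (Rmult_assoc (_ - _) (/ _)), Rinv_l by lra.
    nra.
  - replace (Finite 0) with (Finite (((pw x0 2 - pw x0 q) * (pw x0 2 - pw x0 q)
      - (pw x0 2 - pw x0 q) * (pw x0 2 - pw x0 q)) / (pw x0 2 * pw x0 q))).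
    + lim_arith; nra.
    + apply (f_equal Finite); field; split; lra.
Qed.

(* [2^(-it) + q^(-it) -> 0] for [q = 3] and [q = 9 = 3^2] forces [3^(-it) -> 1]. *)
Lemma unim_limits (t : nat -> R) :
  (forall q, hcoef q = 1 -> is_lim_seq (fun n => Cmod (unim (t n) 2 + unim (t n) q)) 0) ->
  limit_relations t.
Proof.
  intros H.
  assert (H3 := H 3%nat ltac:(apply (hcoef_odd 1); lia)).
  assert (H9 := H 9%nat ltac:(apply (hcoef_odd 4); lia)).
  assert (H2 : is_lim_seq (fun n => Cmod (unim (t n) 2 + 1)) 0).
  { apply lim_squeeze_above with (u := fun n => Cmod (unim (t n) 2 + unim (t n) 3)
      + (Cmod (unim (t n) 2 + unim (t n) 3) + Cmod (unim (t n) 2 + unim (t n) 9))).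
    - exists 0%nat; intros n _; split; [apply Cmod_ge_0|].
      (* Multiplication by the unimodular 3^(-it) turns 3^(-it) - 1 into 9^(-it) - 3^(-it), a
         difference of the two null sequences. *)
      assert (E : Cmod (unim (t n) 3 - 1) = Cmod (unim (t n) 9 - unim (t n) 3)).
      { replace (unim (t n) 9 - unim (t n) 3)%C with (unim (t n) 3 * (unim (t n) 3 - 1))%C.
        - rewrite Cmod_mult, Cmod_unim by lia; ring.
        - unfold unim; change 9%nat with (3 * 3)%nat; rewrite dm_mult; ring. }
      replace (unim (t n) 2 + 1)%C
        with ((unim (t n) 2 + unim (t n) 3) - (unim (t n) 3 - 1))%C by ring.
      apply Rle_trans with (1 := Cmod_minus_le _ _); rewrite E.
      replace (unim (t n) 9 - unim (t n) 3)%C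
        with ((unim (t n) 2 + unim (t n) 9) - (unim (t n) 2 + unim (t n) 3))%C by ring.
      generalize (Cmod_minus_le (unim (t n) 2 + unim (t n) 9) (unim (t n) 2 + unim (t n) 3)); lra.
    - replace (Finite 0) with (Finite (0 + (0 + 0))) by (apply (f_equal Finite); ring).
      lim_arith. }
  apply limit_relations_of_cos.
  - apply lim_squeeze_above with (u := fun n => -1 + Cmod (unim (t n) 2 + 1)).
    + exists 0%nat; intros n _.
      assert (Hu := Cmod_1_re_bounds _ (Cmod_unim (t n) 2 ltac:(lia))).
      assert (Hr := re_le_mod (unim (t n) 2 + 1)); rewrite re_plus, re_RtoC in Hr; lra.
    + replace (Finite (-1)) with (Finite (-1 + 0)) by (apply (f_equal Finite); ring).
      lim_arith.
  - intros p Hp Hp2.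
    assert (Hp' := prime_ge_2 _ Hp).
    assert (Hh : hcoef p = 1).
    { destruct (Nat.Even_or_Odd p) as [[k E] | [k ->]]; [|apply hcoef_odd; lia].
      exfalso; assert (Hd : (2 | Z.of_nat p)%Z) by (exists (Z.of_nat k); lia).
      destruct (prime_divisors _ Hp _ Hd) as [D | [D | [D | D]]]; lia. }
    apply lim_squeeze_below with (u := fun n =>
      1 - (Cmod (unim (t n) 2 + 1) + Cmod (unim (t n) 2 + unim (t n) p))).
    + exists 0%nat; intros n _.
      assert (Hu := Cmod_1_re_bounds _ (Cmod_unim (t n) p ltac:(lia))).
      assert (Hr := re_le_mod ((unim (t n) 2 + 1) - (unim (t n) 2 + unim (t n) p))).
      assert (Hm := Cmod_minus_le (unim (t n) 2 + 1) (unim (t n) 2 + unim (t n) p)).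
      replace (Re (unim (t n) 2 + 1 - (unim (t n) 2 + unim (t n) p)))
        with (1 - Re (unim (t n) p)) in Hr by (simpl; unfold Re; ring).
      lra.
    + replace (Finite 1) with (Finite (1 - (0 + 0))) by (apply (f_equal Finite); ring).
      assert (Hl := H p Hh); lim_arith.
Qed.

(** Dividing the equation by 2^(-s) and writing s = x0 + it + z gives [exp_sum_solve] with a =
    (n/2)^(-x0), l = ln(n/2) and u = (n/2)^(-it) over the odd n >= 3. The approximation of signs
    brings u close to -1. *)
Lemma zeta_one_near (zeta : C -> C) (x0 e : R) : is_riemann_zeta zeta ->
  1 < x0 -> rDS hcoef x0 = pw x0 2 -> 0 < e ->
  exists s, x0 - e < Re s /\ zeta_one zeta s.
Proof.
  intros Hz H1 H0 He.
  set (P := pw x0 2) in *; assert (HP : 0 < P) by (apply pw_pos; lia).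
  set (a := fun n => / P * (hcoef n * pw x0 n)).
  (* The factor [hcoef n] suppresses the negative values at n = 0 and n = 1. *)
  set (l := fun n => hcoef n * (ln (INR n) - ln (INR 2))).
  assert (HiP : 0 < / P) by now apply Rinv_0_lt_compat.
  assert (Ha : forall n, 0 <= a n).
  { intros n; unfold a; apply Rmult_le_pos; [lra|].
    apply Rmult_le_pos; [apply hcoef_01 | apply pw_ge_0]. }
  assert (Hl : forall n, 0 <= l n <= ln (INR n)).
  { intros n; assert (H := lnN_ge_0 n); unfold l.
    destruct (hcoef_cases n) as [-> | [-> [Hn _]]]; [lra|].
    assert (H2 : ln (INR 2) <= ln (INR n))
      by (apply ln_le; [apply lt_0_INR | apply le_INR]; lia).
    generalize (lnN_ge_0 2); lra. }
  assert (Ha_le : forall n, a n <= / P * pw x0 n).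
  { intros n; unfold a; apply Rmult_le_compat_l; [lra|].
    generalize (hcoef_01 n) (pw_ge_0 x0 n); nra. }
  assert (Hexp : forall n r, 0 <= r -> a n * exp (l n * r) <= / P * pw (x0 - r) n).
  { intros n r Hr; destruct n as [|n].
    - unfold a; simpl; lra.
    - apply Rle_trans with (/ P * pw x0 (S n) * exp (ln (INR (S n)) * r)).
      + apply Rmult_le_compat; [apply Ha | left; apply exp_pos | apply Ha_le |].
        apply Rexp_le, Rmult_le_compat_r; [exact Hr | apply Hl].
      + right; unfold pw; rewrite Rmult_assoc, <- exp_plus; do 2 f_equal; ring. }
  assert (Ha1 : is_series a 1).
  { replace 1 with (/ P * rDS hcoef x0) by (rewrite H0; field; lra).
    apply (is_series_scal_l (/ P) (fun n => hcoef n * pw x0 n)), Series_correct.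
    apply ex_series_rDS; [apply tame_hcoef | exact H1]. }
  assert (Hal : ex_series (fun n => a n * l n)).
  { apply ex_series_dom with (fun n => / P * (ln (INR n) * pw x0 n)).
    - intros n; assert (H := Hl n); assert (H' := Ha n); assert (H'' := Ha_le n).
      rewrite Rabs_pos_eq by (apply Rmult_le_pos; lra).
      apply Rle_trans with (/ P * pw x0 n * ln (INR n));
        [apply Rmult_le_compat; lra | right; ring].
    - now apply (ex_series_scal_l (/ P) (fun n => ln (INR n) * pw x0 n)), ex_series_ln_pw. }
  set (D := Series (fun n => a n * l n)).
  assert (HD : 0 < D).
  { apply Rlt_le_trans with (a 3%nat * l 3%nat).
    - assert (E3 : hcoef 3 = 1) by (apply (hcoef_odd 1); lia).
      unfold a, l; rewrite E3, !Rmult_1_l.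
      apply Rmult_lt_0_compat; [apply Rmult_lt_0_compat; [exact HiP | apply pw_pos; lia]|].
      apply Rlt_0_minus, ln_increasing; [apply lt_0_INR | apply lt_INR]; lia.
    - apply (Series_ge_term (fun n => a n * l n)); [|exact Hal].
      intros n; apply Rmult_le_pos; [apply Ha | apply Hl]. }
  (* Then x0 - 3 r0 is the midpoint of 1 and x0, so the majorant with exponent lowered by 3 r0 still
     converges. *)
  set (r0 := (x0 - 1) / 6); assert (Hr0 : 0 < r0) by (unfold r0; lra).
  assert (Hexb : ex_series (fun n => / P * (ln (INR n) * (ln (INR n) * pw (x0 - 3 * r0) n)))).
  { apply (ex_series_scal_l (/ P) (fun n => ln (INR n) * (ln (INR n) * pw (x0 - 3 * r0) n))).
    apply ex_series_ln2_pw; unfold r0; lra. }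
  set (K := Series (fun n => / P * (ln (INR n) * (ln (INR n) * pw (x0 - 3 * r0) n)))) in *.
  (* The entries ensure convergence, Re s > x0 - e, and 3 r K <= D/4. *)
  set (r := Rmin (Rmin r0 (e / 2)) (D / (12 * (Rabs K + 1)))).
  assert (HK := Rabs_pos K).
  assert (Hr : 0 < r).
  { repeat apply Rmin_pos; try lra; apply Rdiv_lt_0_compat; lra. }
  assert (Hr1 : r <= r0) by (apply Rle_trans with (1 := Rmin_l _ _), Rmin_l).
  assert (Hr2 : r <= e / 2) by (apply Rle_trans with (1 := Rmin_l _ _), Rmin_r).
  assert (Hr3 : r * (12 * (Rabs K + 1)) <= D).
  { assert (H : r <= D / (12 * (Rabs K + 1))) by apply Rmin_r.
    apply Rmult_le_compat_r with (r := 12 * (Rabs K + 1)) in H; [|lra].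
    unfold Rdiv in H; rewrite Rmult_assoc, Rinv_l in H by lra; lra. }
  assert (Ha2le : forall n, 0 <= a n * (l n * l n * exp (3 * l n * r))
    <= / P * (ln (INR n) * (ln (INR n) * pw (x0 - 3 * r0) n))).
  { intros n; assert (H := Hl n); assert (H2 := exp_pos (3 * l n * r)); split.
    - apply Rmult_le_pos; [apply Ha | apply Rmult_le_pos; [apply Rmult_le_pos|]; lra].
    - replace (a n * (l n * l n * exp (3 * l n * r)))
        with (l n * l n * (a n * exp (l n * (3 * r)))) by
        (replace (l n * (3 * r)) with (3 * l n * r) by ring; ring).
      replace (/ P * (ln (INR n) * (ln (INR n) * pw (x0 - 3 * r0) n)))
        with (ln (INR n) * ln (INR n) * (/ P * pw (x0 - 3 * r0) n)) by ring.
      apply Rmult_le_compat.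
      + apply Rmult_le_pos; lra.
      + apply Rmult_le_pos; [apply Ha | left; apply exp_pos].
      + apply Rmult_le_compat; lra.
      + apply Rle_trans with (1 := Hexp n (3 * r) ltac:(lra)).
        apply Rmult_le_compat_l; [lra | apply pw_decr; lra]. }
  (* The weight 1 + l dominates both 1 and l, so one estimate serves both smallness conditions on 1
     + u. *)
  set (b := fun n => a n * (1 + l n)).
  assert (Hb0 : forall n, 0 <= b n).
  { intros n; unfold b; assert (H := Hl n); apply Rmult_le_pos; [apply Ha | lra]. }
  assert (Hb : ex_series b).
  { apply ex_series_ext with (fun n => a n + a n * l n);
      [intros n; change (a n + a n * l n = a n * (1 + l n)); ring|].
    apply (ex_series_plus a (fun n => a n * l n)); [exists 1; exact Ha1 | exact Hal]. }
  set (eta := Rmin (D / 4) (D * r / 2)).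
  assert (Heta : 0 < eta) by (apply Rmin_pos; nra).
  destruct (Series_tail_small b (eta / 4) ltac:(lra) Hb) as [N HN].
  specialize (HN N (le_n N)).
  set (Sb := Series b) in *.
  assert (HSb : 0 <= Sb).
  { apply Rle_trans with (b 0%nat); [apply Hb0 | now apply Series_ge_term]. }
  (* [N + 2] keeps the index 2 in range for every [N]. With this accuracy the indices up to [N]
     contribute at most eta/2, and the tail beyond [N] contributes at most another eta/2. *)
  destruct (unim_approx (N + 2) (eta / (4 * (Sb + 1)))) as [t Ht].
  { apply Rdiv_lt_0_compat; lra. }
  set (ep := eta / (4 * (Sb + 1))) in *.
  assert (Hep : ep * (4 * (Sb + 1)) = eta) by (unfold ep; field; lra).
  assert (Hep0 : 0 < ep) by (apply Rdiv_lt_0_compat; lra).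
  set (u := fun n => (unim t n / unim t 2)%C).
  assert (HU2 : Cmod (unim t 2) = 1) by (apply Cmod_unim; lia).
  assert (HU2n : unim t 2 <> RtoC 0) by (apply Cmod_gt_0; lra).
  assert (Hu : forall n, Cmod (u n) <= 1).
  { intros n; unfold u; rewrite Cmod_div, HU2 by exact HU2n.
    destruct n as [|n]; [unfold unim; simpl; rewrite Cmod_0; lra|].
    rewrite Cmod_unim by lia; lra. }
  assert (Hw : forall n, hcoef n * Cmod (1 + u n) <= 2 * ep + 2 * (if Nat.ltb N n then 1 else 0)).
  { intros n; assert (Hif : 0 <= (if Nat.ltb N n then 1 else 0)) by (destruct (Nat.ltb N n); lra).
    destruct (hcoef_cases n) as [-> | [-> [Hn Hsg]]]; [lra|].
    rewrite Rmult_1_l; destruct (Nat.ltb_spec N n) as [HNn | HNn].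
    - apply Rle_trans with (1 := Cmod_triangle _ _); rewrite Cmod_1.
      specialize (Hu n); lra.
    - assert (E : (1 + u n)%C = (((unim t 2 - sgn2 2) + (unim t n - sgn2 n)) / unim t 2)%C).
      { unfold u; rewrite Hsg; change (sgn2 2) with (-1).
        replace (RtoC (-1)) with (- (1))%C by (apply C_eq; simpl; ring).
        field; exact HU2n. }
      rewrite E, Cmod_div, HU2 by exact HU2n.
      generalize (Cmod_triangle (unim t 2 - sgn2 2) (unim t n - sgn2 n))
        (Ht 2%nat ltac:(lia)) (Ht n ltac:(lia)); lra. }
  assert (Hah : forall n, a n = hcoef n * a n).
  { intros n; unfold a; destruct (hcoef_cases n) as [-> | [-> _]]; ring. }
  assert (Htailex : ex_series (fun n => if Nat.ltb N n then b n else 0)).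
  { eexists; now apply Series_tail. }
  assert (HWex : ex_series (fun n => 2 * ep * b n + 2 * (if Nat.ltb N n then b n else 0))).
  { apply (ex_series_plus (fun n => 2 * ep * b n)
      (fun n => 2 * (if Nat.ltb N n then b n else 0))).
    - now apply (ex_series_scal_l (2 * ep) b).
    - now apply (ex_series_scal_l 2 (fun n => if Nat.ltb N n then b n else 0)). }
  assert (HW : Series (fun n => 2 * ep * b n + 2 * (if Nat.ltb N n then b n else 0)) <= eta).
  { rewrite Series_plus, !Series_scal_l.
    - fold Sb; assert (H := Rle_abs (Series (fun n => if Nat.ltb N n then b n else 0))). nra.
    - now apply (ex_series_scal_l (2 * ep) b).
    - now apply (ex_series_scal_l 2 (fun n => if Nat.ltb N n then b n else 0)). }
  assert (HWt : forall n c, 0 <= c <= 1 + l n ->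
    0 <= a n * Cmod (1 + u n) * c <= 2 * ep * b n + 2 * (if Nat.ltb N n then b n else 0)).
  { intros n c Hc; assert (H2 := Cmod_ge_0 (1 + u n)); split.
    - apply Rmult_le_pos; [apply Rmult_le_pos; [apply Ha | exact H2] | lra].
    - replace (2 * ep * b n + 2 * (if Nat.ltb N n then b n else 0))
        with ((2 * ep + 2 * (if Nat.ltb N n then 1 else 0)) * b n)
        by (destruct (Nat.ltb N n); ring).
      apply Rle_trans with (hcoef n * Cmod (1 + u n) * b n);
        [|apply Rmult_le_compat_r; [apply Hb0 | apply Hw]].
      rewrite (Hah n); unfold b.
      replace (hcoef n * a n * Cmod (1 + u n) * c)
        with (hcoef n * Cmod (1 + u n) * (a n * c)) by ring.
      apply Rmult_le_compat_l; [apply Rmult_le_pos; [apply hcoef_01 | exact H2]|].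
      apply Rmult_le_compat_l; [apply Ha | lra]. }
  destruct (exp_sum_solve a l u r) as [z [Hzr Hsum]]; try assumption.
  - intros n; apply Hl.
  - apply ex_series_dom with (fun n => / P * pw (x0 - r) n).
    + intros n; rewrite Rabs_pos_eq; [apply Hexp; lra|].
      apply Rmult_le_pos; [apply Ha | left; apply exp_pos].
    + apply (ex_series_scal_l (/ P) (pw (x0 - r))), ex_series_pw; unfold r0 in *; lra.
  - apply ex_series_dom with (2 := Hexb); intros n; rewrite Rabs_pos_eq; apply Ha2le.
  - assert (H : Series (fun n => a n * (l n * l n * exp (3 * l n * r))) <= K)
      by (apply Series_le; assumption).
    fold D; generalize (Rle_abs K); nra.
  - apply Rle_trans with (D / 4); [|unfold D; lra].
    apply Rle_trans with (2 := Rmin_l (D / 4) (D * r / 2)), Rle_trans with (2 := HW).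
    apply Series_le; [|exact HWex]; intros n; apply HWt; generalize (Hl n); lra.
  - apply Rle_trans with (D * r / 2); [|unfold D; lra].
    apply Rle_trans with (2 := Rmin_r (D / 4) (D * r / 2)), Rle_trans with (2 := HW).
    apply Series_le; [|exact HWex]; intros n.
    rewrite <- (Rmult_1_r (a n * Cmod (1 + u n))); apply HWt; generalize (Hl n); lra.
  - set (s := (RtoC x0 + Ci * RtoC t + z)%C).
    assert (Hre : Re s = x0 + Re z) by (unfold s; simpl; unfold Re; ring).
    assert (Hzre := re_ge_mod z).
    assert (Hs1 : 1 < Re s) by (rewrite Hre; unfold r0 in *; lra).
    exists s; split; [rewrite Hre; lra|].
    split; [intros E; rewrite E in Hs1; simpl in Hs1; lra|].
    apply (zeta_eq_1_iff zeta); [exact Hz | exact Hs1 |].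
    assert (Hd2 : dm s 2 <> RtoC 0) by (apply dm_neq_0; lia).
    assert (E : Csum (fun n => RtoC (a n) * (u n * Cexp (- RtoC (l n) * z)))%C
      = (/ dm s 2 * DS hcoef s)%C).
    { unfold DS; rewrite <- Csum_scal by (apply summable_DS; [apply tame_hcoef | exact Hs1]).
      apply Csum_ext; intros n; unfold a, l.
      destruct (hcoef_cases n) as [-> | [-> [Hn _]]].
      - rewrite Rmult_0_l, Rmult_0_r; ring.
      - rewrite !Rmult_1_l; unfold u, s; rewrite !dm_plus, !dm_R; fold P.
        change (dm (Ci * t) n) with (unim t n); change (dm (Ci * t) 2) with (unim t 2).
        assert (Ez : dm z n = (dm z 2 * Cexp (- RtoC (ln (INR n) - ln (INR 2)) * z))%C).
        { destruct n as [|n]; [lia|]; unfold dm; rewrite <- Cexp_plus; f_equal.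
          rewrite RtoC_minus; ring. }
        rewrite Ez, RtoC_mult, RtoC_inv by lra.
        assert (HPC : RtoC P <> RtoC 0) by (intros E; apply RtoC_inj in E; lra).
        assert (Hdz : dm z 2 <> RtoC 0) by (apply dm_neq_0; lia).
        field; repeat split; assumption. }
    rewrite Hsum in E.
    transitivity (dm s 2 * (/ dm s 2 * DS hcoef s))%C; [field; exact Hd2|].
    rewrite <- E; ring.
Qed.

Lemma is_sigma1_eq (zeta : C -> C) (sigma1 x0 : R) : is_riemann_zeta zeta ->
  is_sigma1 zeta sigma1 -> 1 < x0 -> rDS hcoef x0 = pw x0 2 -> sigma1 = x0.
Proof.
  intros Hz [Hub Hlub] H1 H0; apply Rle_antisym.
  - apply Hlub; intros x [t Ht].
    replace x with (Re (RtoC x + Ci * RtoC t)) by (simpl; ring).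
    now apply (zeta_one_re_le zeta).
  - apply le_epsilon; intros e He.
    destruct (zeta_one_near zeta x0 e Hz H1 H0 He) as [s [Hs Hone]].
    assert (Re s <= sigma1); [|lra].
    apply Hub; exists (Im s).
    replace (RtoC (Re s) + Ci * RtoC (Im s))%C with s; [exact Hone|].
    apply C_eq; simpl; unfold Re, Im; ring.
Qed.

Theorem theorem6p1 (zeta : C -> C) (Hzeta : is_riemann_zeta zeta) :
  (forall (sigma1 : R) (s : nat -> C),
     is_sigma1 zeta sigma1 ->
     almost_extremal_one zeta sigma1 s ->
     limit_relations (fun n : nat => Im (s n))) /\
  (forall (E : R) (rho : nat -> C),
     is_E zeta E ->
     almost_extremal_deriv zeta E rho ->
     limit_relations (fun n : nat => Im (rho n))).
Proof.
  split.
  - intros sigma1 s Hsig [Hs Hlim].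
    destruct sigma0_exists as [x0 [H1 H0]].
    rewrite (is_sigma1_eq zeta sigma1 x0 Hzeta Hsig H1 H0) in Hlim.
    apply unim_limits; intros q Hq.
    now apply unim_plus_lim with zeta x0.
  - intros E rho HE Hrho; now apply almost_extremal_deriv_limits with zeta E.
Qed.
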